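(* Let $\gamma=\{\gamma(t)=t+iy(t):t\in[a,b]\}$, $-\infty<a<b<\infty$, be the graph of a Lipschitz function $y:[a,b]\to\mathbb{R}$, and let $\varphi$ be a subharmonic function on $\mathbb{C}$. Let $\gamma(t_1),\dots,\gamma(t_n)$ be the points of $\gamma$ at which the Lelong number satisfies $\nu(\varphi)(\gamma(t_i))\ge1$, and let $Q(z)=\prod_{i=1}^n(z-\gamma(t_i))^{[\nu(\varphi)(\gamma(t_i))]}$, where $[x]$ denotes the largest integer $\le x$. Let $\sqrt{Q}$ denote a function on $\gamma$ whose square is $Q$. Then polynomials are dense in $L^2(\gamma,\varphi)$ if and only if $\sqrt{Q}$ can be approximated arbitrarily well by polynomials in $L^2(\gamma,\varphi)$.
   Context: The Lelong number of a subharmonic function $\varphi\not\equiv-\infty$ at $z$ is $\nu(\varphi)(z)=\lim_{r\to0^+}\frac{\max_{|\zeta-z|=r}\varphi(\zeta)}{\log r}$, equal to the mass at $z$ of $\frac{1}{2\pi}\Delta\varphi$; there are only finitely many points of $\gamma$ with $\nu(\varphi)\ge1$. $L^2(\gamma,\varphi)$ is the space of measurable $f$ on $\gamma$ with $\int_\gamma|f|^2e^{-\varphi}ds<\infty$, $ds$ arc length. ''Polynomials are dense'' means every element of $L^2(\gamma,\varphi)$ is a limit in this norm of holomorphic polynomials. *)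

(* Defs.v *)
From HB Require Import structures.
From mathcomp Require Import all_boot all_order all_algebra.
From mathcomp Require Import all_classical all_reals all_analysis.
From mathcomp Require Import complex.
Set Implicit Arguments. Unset Strict Implicit. Unset Printing Implicit Defensive.
Import Order.TTheory GRing.Theory Num.Theory.
Import numFieldNormedType.Exports.
Local Open Scope classical_set_scope.
Local Open Scope ring_scope.

Section Defs.
Variable R : realType.

Definition cabs (z : R[i]) : R := Num.sqrt (complex.Re z ^+ 2 + complex.Im z ^+ 2).

Definition circ (z : R[i]) (r theta : R) : R[i] :=
  Complex (complex.Re z + r * cos theta) (complex.Im z + r * sin theta).

Definition usc (phi : R[i] -> \bar R) : Prop :=
  forall (z : R[i]) (c : R), (phi z < c%:E)%E ->
    exists2 d : R, 0 < d & forall w : R[i], cabs (w - z) < d -> (phi w < c%:E)%E.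

Definition subharmonic (phi : R[i] -> \bar R) : Prop :=
  [/\ forall z, phi z != +oo%E,
      usc phi,
      exists z, phi z != -oo%E &
      forall (z : R[i]) (r : R), 0 < r ->
        (phi z <= ((2 * pi)^-1 : R)%:E *
           \int[lebesgue_measure]_(theta in `[0%R, (2 * pi)%R]) phi (circ z r theta))%E].

Definition lelong (phi : R[i] -> \bar R) (z : R[i]) : \bar R :=
  lim ((fun r : R => (ereal_sup (range (fun theta => phi (circ z r theta)))
                       * ((ln r)^-1)%:E)%E) @ 0^'+).

Definition gam (y : R -> R) (t : R) : R[i] := Complex t (y t).

(* arc-length density |gamma'(t)| = sqrt(1 + y'(t)^2) (y' exists a.e.) *)
Definition arcdens (y : R -> R) (t : R) : R := Num.sqrt (1 + (derive1 y t) ^+ 2).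

Definition weight (phi : R[i] -> \bar R) (z : R[i]) : \bar R :=
  match phi z with
  | EFin r => (expR (- r))%:E
  | +oo%E => 0%E
  | -oo%E => +oo%E
  end.

Definition l2dist2 (a b : R) (y : R -> R) (phi : R[i] -> \bar R)
  (f g : R[i] -> R[i]) : \bar R :=
  (\int[lebesgue_measure]_(t in `[a, b])
     ((cabs (f (gam y t) - g (gam y t)) ^+ 2)%:E * weight phi (gam y t)
       * (arcdens y t)%:E))%E.

Definition meas_on_gamma (a b : R) (y : R -> R) (f : R[i] -> R[i]) : Prop :=
  measurable_fun `[a, b] (fun t => complex.Re (f (gam y t))) /\
  measurable_fun `[a, b] (fun t => complex.Im (f (gam y t))).

Definition inL2 (a b : R) (y : R -> R) (phi : R[i] -> \bar R)
  (f : R[i] -> R[i]) : Prop :=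
  meas_on_gamma a b y f /\ (l2dist2 a b y phi f (fun _ => 0%R) < +oo)%E.

Definition poly_approx (a b : R) (y : R -> R) (phi : R[i] -> \bar R)
  (f : R[i] -> R[i]) : Prop :=
  forall eps : R, 0 < eps ->
    exists p : {poly R[i]}, (l2dist2 a b y phi f (fun z => p.[z]) < eps%:E)%E.

Definition polys_dense (a b : R) (y : R -> R) (phi : R[i] -> \bar R) : Prop :=
  forall f, inL2 a b y phi f -> poly_approx a b y phi f.

Definition Qpoly (y : R -> R) (phi : R[i] -> \bar R) (ts : seq R) : {poly R[i]} :=
  \prod_(t <- ts) ('X - (gam y t)%:P) ^+ Num.truncn (fine (lelong phi (gam y t))).

End Defs.

(* Main.v *)
Require Import Defs.
From HB Require Import structures.
From mathcomp Require Import all_boot all_order all_algebra.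
From mathcomp Require Import all_classical all_reals all_analysis.
From mathcomp Require Import measurable_realfun complex.
From mathcomp Require Import ring lra.
Set Implicit Arguments. Unset Strict Implicit. Unset Printing Implicit Defensive.
Import Order.TTheory GRing.Theory Num.Theory.
Import numFieldNormedType.Exports.
Local Open Scope classical_set_scope.
Local Open Scope ring_scope.

(** Write [W = |Q| e^{-phi}]. The heart of the matter is that [W] is integrable along the graph. Near a point [z0] of
    the graph with Lelong number [nu], put [k = [nu]] and [Phi = phi - k log |. - z0|]. By the three circles theorem
    the maxima of [Phi] over discs [D(z, r)] grow in [log r] with slope at most some [m < 1], uniformly for [z] near
    [z0]. On a disc of radius [rho] at distance comparable to [rho] from [z0] this bounds the averages of the
    superharmonic function [v = M - Phi >= 0] over discs of radius [r <= rho] by [C + m log (rho / r)]; telescoping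
    dyadic averages of [v] then gives [int e^v ds <= C' rho] along the graph, and summing over a geometric sequence of
    discs gives the integrability of [|. - z0|^k e^{-phi}] near [z0]. In particular [sqrt Q] lies in [L^2(gamma, phi)],
    so that it is approximable as soon as polynomials are dense.

    Polynomials are dense in [L^2(W dt)] for every integrable [W]: on a Lipschitz graph [gamma(t) - gamma(s)] lies in a
    double cone [|Im z| <= L |Re z|], which [z |-> 2z / (1 + z^2)] maps to itself. Its poles [+i] and [-i] can be
    pushed to infinity along the imaginary axis, so its iterates at [gamma(t) - gamma(s)] are uniform limits of
    polynomials, and they converge boundedly to [sign (t - s)]. Hence if [f] is in [L^2(gamma, phi)] and
    [sqrt Q] is approximated by a polynomial [p], then [f / sqrt Q ~ q] in [L^2(W dt)] gives
    [f ~ q sqrt Q ~ q p] in [L^2(gamma, phi)]. *)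

(** * Shears and rotations of the plane *)

(** In the code [Phi] is phi itself, viewed on [R * R]; the logarithm is subtracted only inside
    [disc_sup], so that the mean value inequality is always applied to a subharmonic function. The
    difficulty is to pass from planar information to integrability on a one-dimensional set. No
    Riesz measure is built: at scale [r] its role is played by [v - avg r v], which is nonnegative
    and has integral of order [r ^ 2] because averaging is self-adjoint and a semiconvex cutoff
    loses at most that much under it. Restricting a disc average to the graph costs a factor
    [1 / r], so the J-th dyadic increment of [v] has integral of order [rho / 2 ^ J] along the
    graph, while the exponential may have grown to [2 ^ (m J)]. The sum converges because [m < 1],
    and this is where removing the integer part of the Lelong number enters. Discs are kept away
    from the pole so that [k log |. - z0|] oscillates there by a bounded amount only. In the
    approximation part, the rational map is the doubling formula of the hyperbolic tangent,
    conjugate to squaring by a Cayley transform; this is why its iterates converge to the sign. *)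

Section lebesgue_on_R.
Context {R : realType}.

(** Lebesgue measure on the canonical measurable structure of [R], so that products live on [R * R]. *)
Definition leb : set R -> \bar R := @lebesgue_measure R.

Let leb0 : leb set0 = 0%E. Proof. exact: measure0. Qed.
Let leb_ge0 A : (0 <= leb A)%E. Proof. exact: measure_ge0. Qed.
Let leb_sigma_additive : semi_sigma_additive leb.
Proof. exact: (@measure_semi_sigma_additive _ _ _ (@lebesgue_measure R)). Qed.

HB.instance Definition _ := isMeasure.Build _ R R leb leb0 leb_ge0 leb_sigma_additive.

Let leb_sigma_finite : sigma_finite setT leb.
Proof. exact: (@sigma_finiteT _ _ _ (@lebesgue_measure R)). Qed.

HB.instance Definition _ := @Measure_isSigmaFinite.Build _ R R leb leb_sigma_finite.

(** Both measures are the same set function on different measurable structures, so pushing forward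
    along the identity carries one integral to the other. *)
Lemma ge0_integral_leb (D : set R) (f : R -> \bar R) : measurable D ->
  measurable_fun D f -> (forall x, D x -> (0 <= f x)%E) ->
  (\int[leb]_(x in D) f x = \int[lebesgue_measure]_(x in D) f x)%E.
Proof.
move=> mD mf f0.
have mid : measurable_fun setT (id : measurableTypeR R -> R) by [].
transitivity (\int[pushforward (@lebesgue_measure R) (id : measurableTypeR R -> R)]_(x in D) f x)%E.
  by apply: eq_measure_integral.
by rewrite ge0_integral_pushforward // => x; rewrite inE; exact: f0.
Qed.

Lemma leb_shift (a : R) (A : set R) : measurable A -> pushforward leb (fun x => x + a) A = leb A.
Proof.
move=> mA; apply/esym/(@lebesgue_measure_unique _ (pushforward lebesgue_measure ((fun x => x + a) : measurableTypeR R -> measurableTypeR R))) => //=.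
  exact: measurable_funD.
move=> mf _ [[b c]] _ <-.
rewrite /pushforward.
rewrite (_ : _ @^-1` _ = `]b - a, c - a]%classic); last first.
  apply/seteqP; split => x /=; rewrite !in_itv/= => /andP[h1 h2]; apply/andP; split; lra.
rewrite !lebesgue_measure_itv/= !lte_fin ltrD2r.
by case: ifP => // _; rewrite -!EFinB; congr EFin; ring.
Qed.

End lebesgue_on_R.

Section lebesgue_on_plane.
Context {R : realType}.

(** Packaging the product as a sigma-finite measure on [R * R] allows Tonelli to be applied a second
    time, to pairs of points of the plane. *)
Definition leb2 : set (R * R) -> \bar R := (@leb R \x @leb R)%E.

Let leb20 : leb2 set0 = 0%E. Proof. exact: measure0. Qed.
Let leb2_ge0 A : (0 <= leb2 A)%E. Proof. exact: measure_ge0. Qed.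
Let leb2_sigma_additive : semi_sigma_additive leb2.
Proof. exact: (@measure_semi_sigma_additive _ _ _ (@leb R \x @leb R)%E). Qed.

HB.instance Definition _ :=
  isMeasure.Build _ (R * R)%type R leb2 leb20 leb2_ge0 leb2_sigma_additive.

Let leb2_sigma_finite : sigma_finite setT leb2.
Proof.
have /sigma_finiteP[F [TF ndF Foo]] := sigma_finiteT (@leb R).
exists (fun n => F n `*` F n).
  rewrite -setXTT TF predeqE => -[x y]; split.
    move=> [/= [n _ Fnx] [k _ Fky]]; exists (maxn n k) => //; split.
    - by move: x Fnx; exact/subsetPset/ndF/leq_maxl.
    - by move: y Fky; exact/subsetPset/ndF/leq_maxr.
  by move=> [n _ []/= ? ?]; split; exists n.
move=> k; have [? ?] := Foo k; split; first exact: measurableX.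
by rewrite /leb2 product_measure1E// lte_mul_pinfty// ge0_fin_numE.
Qed.

HB.instance Definition _ :=
  @Measure_isSigmaFinite.Build _ (R * R)%type R leb2 leb2_sigma_finite.

End lebesgue_on_plane.

Section planar_measure.
Context {R : realType}.
Local Notation mu := (@leb R).
Local Notation mu2 := (@leb2 R).

Lemma ge0_integral_shift (a : R) (f : R -> \bar R) :
  measurable_fun setT f -> (forall x, 0 <= f x)%E ->
  (\int[mu]_x f (x + a)%R = \int[mu]_x f x)%E.
Proof.
move=> mf f0.
have ms : measurable_fun setT (fun x : R => x + a) by exact: measurable_funD.
transitivity (\int[pushforward mu (fun x : R => x + a)%R]_x f x)%E.
  by rewrite ge0_integral_pushforward.
by apply: eq_measure_integral => //= A mA _; exact: leb_shift.
Qed.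

Lemma plane_tonelli1 (f : R * R -> \bar R) :
  measurable_fun setT f -> (forall p, 0 <= f p)%E ->
  (\int[mu2]_p f p = \int[mu]_x \int[mu]_y f (x, y))%E.
Proof. by move=> mf f0; exact: (fubini_tonelli1 (m1 := mu) (m2 := mu) f mf f0). Qed.

Lemma plane_tonelli2 (f : R * R -> \bar R) :
  measurable_fun setT f -> (forall p, 0 <= f p)%E ->
  (\int[mu2]_p f p = \int[mu]_y \int[mu]_x f (x, y))%E.
Proof. by move=> mf f0; exact: (fubini_tonelli2 (m1 := mu) (m2 := mu) f mf f0). Qed.

Lemma ge0_integral_plane_shift (q : R * R) (f : R * R -> \bar R) :
  measurable_fun setT f -> (forall p, 0 <= f p)%E ->
  (\int[mu2]_p f (p.1 + q.1, p.2 + q.2)%R = \int[mu2]_p f p)%E.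
Proof.
move=> mf f0.
rewrite (plane_tonelli1 (f := fun p : R * R => f (p.1 + q.1, p.2 + q.2)%R)) //; last first.
  apply: measurableT_comp => //; apply: measurable_fun_pair; exact: measurable_funD.
rewrite [RHS](plane_tonelli1 mf f0).
rewrite /=.
under eq_integral => x _.
  rewrite (ge0_integral_shift q.2 (f := fun y : R => f (x + q.1, y)%R)) //; last exact: measurableT_comp.
  over.
rewrite (ge0_integral_shift q.1 (f := fun x : R => \int[mu]_y f (x, y))%E) //.
- exact: (measurable_fun_fubini_tonelli_F (m2 := mu)).
- by move=> x; apply: integral_ge0.
Qed.

Definition rotp (c s : R) (p : R * R) : R * R := (c * p.1 - s * p.2, s * p.1 + c * p.2).

Lemma measurable_rotp c s : measurable_fun setT (rotp c s).
Proof.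
apply: measurable_fun_pair.
  by apply: measurable_funB; apply: measurable_funM => //; exact: measurable_cst.
by apply: measurable_funD; apply: measurable_funM => //; exact: measurable_cst.
Qed.

Lemma measurable_shearx (a : R) : measurable_fun setT (fun p : R * R => (p.1 + a * p.2, p.2)).
Proof.
apply: measurable_fun_pair => //.
by apply: measurable_funD => //; apply: measurable_funM.
Qed.

Lemma measurable_sheary (a : R) : measurable_fun setT (fun p : R * R => (p.1, p.2 + a * p.1)).
Proof.
apply: measurable_fun_pair => //.
by apply: measurable_funD => //; apply: measurable_funM.
Qed.

Lemma ge0_integral_shearx (a : R) (f : R * R -> \bar R) :
  measurable_fun setT f -> (forall p, 0 <= f p)%E ->
  (\int[mu2]_p f (p.1 + a * p.2, p.2)%R = \int[mu2]_p f p)%E.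
Proof.
move=> mf f0.
rewrite (plane_tonelli2 (f := fun p : R * R => f (p.1 + a * p.2, p.2)%R)) //; last first.
  by apply: measurableT_comp => //; exact: measurable_shearx.
rewrite [RHS](plane_tonelli2 mf f0).
apply: eq_integral => y _ /=.
by rewrite (ge0_integral_shift (a * y) (f := fun x : R => f (x, y))) //; exact: measurableT_comp.
Qed.

Lemma ge0_integral_sheary (a : R) (f : R * R -> \bar R) :
  measurable_fun setT f -> (forall p, 0 <= f p)%E ->
  (\int[mu2]_p f (p.1, p.2 + a * p.1)%R = \int[mu2]_p f p)%E.
Proof.
move=> mf f0.
rewrite (plane_tonelli1 (f := fun p : R * R => f (p.1, p.2 + a * p.1)%R)) //; last first.
  by apply: measurableT_comp => //; exact: measurable_sheary.
rewrite [RHS](plane_tonelli1 mf f0).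
apply: eq_integral => x _; rewrite /=.
by rewrite (ge0_integral_shift (a * x) (f := fun y : R => f (x, y))) //; exact: measurableT_comp.
Qed.

(** A rotation of angle other than pi is a product of three shears. *)
Lemma ge0_integral_rotp (c s : R) (f : R * R -> \bar R) : c ^+ 2 + s ^+ 2 = 1 ->
  measurable_fun setT f -> (forall p, 0 <= f p)%E ->
  (\int[mu2]_p f (rotp c s p) = \int[mu2]_p f p)%E.
Proof.
have rot (c' s' : R) (g : R * R -> \bar R) : c' ^+ 2 + s' ^+ 2 = 1 -> 1 + c' != 0 ->
    measurable_fun setT g -> (forall p, 0 <= g p)%E ->
    (\int[mu2]_p g (rotp c' s' p) = \int[mu2]_p g p)%E.
  move=> cs c1 mg g0.
  (* With [t = s' / (1 + c')], the tangent of the half angle, the shears are [x - t y], then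
     [y + s' x], then [x - t y] again; [ct] and [tc] are the identities that make their product the
     rotation. *)
  have ct : 1 + - (s' / (1 + c')) * s' = c'.
    apply: (mulIf c1); rewrite mulrDl mulNr mulNr -mulrA (mulrC s' (1 + c')) mulrA mulfVK//.
    by nra.
  have tc : (s' / (1 + c')) * (1 + c') = s' by rewrite mulfVK.
  set t := s' / (1 + c') in ct tc.
  have h1 := measurable_shearx (- t).
  have h2 := measurable_sheary s'.
  rewrite -(ge0_integral_shearx (- t) mg g0).
  rewrite -(ge0_integral_sheary s' (f := fun p : R * R => g (p.1 + - t * p.2, p.2))) //; last exact: measurableT_comp.
  rewrite -(ge0_integral_shearx (- t) (f := fun p : R * R => g (p.1 + - t * (p.2 + s' * p.1), p.2 + s' * p.1))) //.
    apply: eq_integral => p _ /=; congr g; rewrite /rotp; congr pair.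
      have sE : s' = t * 2 - t * t * s' by rewrite -{1}tc -ct; ring.
      transitivity (c' * p.1 - (t * 2 - t * t * s') * p.2); first by congr (_ - _ * _).
      by rewrite -ct; ring.
    by rewrite -ct; ring.
  by apply: (measurableT_comp mg); apply: (measurableT_comp h1 h2).
move=> cs mf f0; have [c1|c1] := eqVneq (1 + c) 0; last exact: rot.
have cE : c = -1 by lra.
have sE : s = 0 by apply/eqP; rewrite -sqrf_eq0; apply/eqP; move: cs; rewrite cE; nra.
(* The half turn is the quarter turn applied twice, and the quarter turn has [1 + c = 1]. *)
have r01 : (0 : R) ^+ 2 + 1 ^+ 2 = 1 by rewrite expr0n/= add0r expr1n.
have r1 : (1 + 0 : R) != 0 by rewrite addr0 oner_neq0.
rewrite -[RHS](rot 0 1 f) //.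
rewrite -[RHS](rot 0 1 (f \o rotp 0 1)) //; [|by apply: measurableT_comp => //; exact: measurable_rotp|by move=> p; exact: f0].
by apply: eq_integral => p _; rewrite /rotp /= cE sE; congr (f (_, _)); ring.
Qed.

(** Each point of [U] lies in a box with rational centre and side governed by some [1 / (n + 1)]
    that is contained in [U], so [U] is a countable union of measurable boxes. *)
Lemma measurable_plane_open (U : set (R * R)) :
  (forall p, U p -> exists2 d : R, 0 < d & forall q : R * R, `|q.1 - p.1| < d -> `|q.2 - p.2| < d -> U q) ->
  measurable U.
Proof.
move=> oU.
pose B (a b : rat) (n : nat) : set (R * R) := ball (ratr a : R) (n.+1%:R^-1) `*` ball (ratr b : R) (n.+1%:R^-1).
rewrite (_ : U = \bigcup_(a : rat) \bigcup_(b : rat) \bigcup_n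
    (if `[< B a b n `<=` U >] then B a b n else set0)).
  apply: bigcupT_measurable_rat => a; apply: bigcupT_measurable_rat => b.
  apply: bigcupT_measurable => n; case: ifP => // _.
  by apply: measurableX; exact: measurable_ball.
apply/seteqP; split=> p; last first.
  by move=> [a _ [b _ [n _]]]; case: ifP => // /asboolP h /h.
move=> Up; have [d d0 dU] := oU p Up.
have [n /= nd] : exists n : nat, (n.+1%:R^-1 : R) < d / 2.
  have [n h] := ltr_add_invr (divr_gt0 d0 (ltr0Sn R 1)).
  by exists n; rewrite add0r in h.
have [e eE] : exists e : R, e = n.+1%:R^-1 by eexists.
have e0 : 0 < e by rewrite eE invr_gt0.
rewrite -eE in nd.
have [a] := @rat_in_itvoo _ (p.1 - e) (p.1 + e) ltac:(lra).
rewrite in_itv /= => /andP[a1 a2].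
have [b] := @rat_in_itvoo _ (p.2 - e) (p.2 + e) ltac:(lra).
rewrite in_itv /= => /andP[b1 b2].
exists a => //; exists b => //; exists n => //.
rewrite ifT; last first.
  apply/asboolP => q [/=]; rewrite /ball/= -eE !ltr_norml => /andP[? ?] /andP[? ?].
  by apply: dU; rewrite ltr_norml; apply/andP; split; lra.
by split; rewrite /ball/= -eE ltr_norml; apply/andP; split; lra.
Qed.

Lemma measurable_plane_usc (f : R * R -> \bar R) :
  (forall p c, (f p < c%:E)%E -> exists2 d : R, 0 < d &
     forall q : R * R, `|q.1 - p.1| < d -> `|q.2 - p.2| < d -> (f q < c%:E)%E) ->
  measurable_fun setT f.
Proof.
move=> uscf; apply: (measurability _ (ErealGenInftyO.measurableE R)) => _ [_ [c ->]] <-.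
rewrite setTI; apply: measurable_plane_open => p /=; rewrite in_itv /= => /uscf[d d0 h].
by exists d => // q h1 h2; rewrite in_itv /=; exact: h.
Qed.

End planar_measure.

(** * Averages over discs *)

Section disc_average.
Context {R : realType}.
Local Notation mu := (@leb R).
Local Notation mu2 := (@leb2 R).

(** Distances are handled through their squares, so that discs and circles are polynomial conditions
    within reach of [ring], [nra] and [lra]. *)
Definition sqn (p : R * R) : R := p.1 ^+ 2 + p.2 ^+ 2.
Definition padd (z p : R * R) : R * R := (z.1 + p.1, z.2 + p.2).
Definition psub (z p : R * R) : R * R := (z.1 - p.1, z.2 - p.2).

Lemma sqn_ge0 p : 0 <= sqn p.
Proof. by rewrite addr_ge0 // sqr_ge0. Qed.

Lemma sqn_ltr_norm p (r : R) : 0 < r -> sqn p < r ^+ 2 -> `|p.1| < r /\ `|p.2| < r.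
Proof.
rewrite /sqn => r0 h.
have n x : x ^+ 2 < r ^+ 2 -> `|x| < r.
  by move=> hx; rewrite -(ltr_pXn2r (n := 2)) ?nnegrE ?(ltW r0)//= real_normK ?num_real.
by split; apply: n; have := sqr_ge0 p.1; have := sqr_ge0 p.2; lra.
Qed.

Lemma measurable_sqn : measurable_fun setT sqn.
Proof. by apply: measurable_funD; apply: measurable_funX. Qed.

Lemma measurable_padd2 : measurable_fun setT (fun zp : (R * R) * (R * R) => padd zp.1 zp.2).
Proof.
by apply: measurable_fun_pair; apply: measurable_funD; apply: measurableT_comp.
Qed.

Lemma measurable_psub2 : measurable_fun setT (fun zp : (R * R) * (R * R) => psub zp.1 zp.2).
Proof.
by apply: measurable_fun_pair; apply: measurable_funB; apply: measurableT_comp.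
Qed.

Lemma measurable_padd z : measurable_fun setT (padd z).
Proof. by apply: measurable_fun_pair; apply: measurable_funD. Qed.

Lemma measurable_paddr z : measurable_fun setT (padd^~ z).
Proof. by apply: measurable_fun_pair; apply: measurable_funD. Qed.

Lemma measurable_psub z : measurable_fun setT (psub z).
Proof. by apply: measurable_fun_pair; apply: measurable_funB. Qed.

Lemma measurable_psubr z : measurable_fun setT (psub^~ z).
Proof. by apply: measurable_fun_pair; apply: measurable_funB. Qed.

Lemma ge0_integral_padd (q : R * R) (f : R * R -> \bar R) :
  measurable_fun setT f -> (forall p, 0 <= f p)%E ->
  (\int[mu2]_p f (padd p q) = \int[mu2]_p f p)%E.
Proof. exact: ge0_integral_plane_shift. Qed.

Lemma ge0_integral_opp (f : R * R -> \bar R) :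
  measurable_fun setT f -> (forall p, 0 <= f p)%E ->
  (\int[mu2]_p f (- p.1, - p.2)%R = \int[mu2]_p f p)%E.
Proof.
move=> mf f0; rewrite -[RHS](ge0_integral_rotp (c := -1) (s := 0)) //; last first.
  by rewrite sqrrN expr1n expr0n addr0.
by apply: eq_integral => p _; rewrite /rotp /=; congr (f (_, _)); ring.
Qed.

Definition disc (r : R) : set (R * R) := [set p | sqn p < r ^+ 2].

Lemma measurable_disc r : measurable (disc r).
Proof.
have := measurable_sqn measurableT (measurable_itv `]-oo, r ^+ 2[).
by rewrite setTI; congr measurable; apply/seteqP; split => p /=; rewrite in_itv.
Qed.

Lemma leb_itv_oo (a b : R) : a <= b -> leb `]a, b[%classic = (b - a)%:E.
Proof.
move=> ab; rewrite /leb lebesgue_measure_itv /= lte_fin lt_neqAle ab andbT -EFinB.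
by case: eqP => //= ->; rewrite subrr.
Qed.

Lemma plane_measureX (A B : set R) : measurable A -> measurable B ->
  mu2 (A `*` B) = (leb A * leb B)%E.
Proof. by move=> mA mB; rewrite /leb2 product_measure1E. Qed.

Lemma plane2_tonelli (F : (R * R) * (R * R) -> \bar R) :
  measurable_fun setT F -> (forall p, 0 <= F p)%E ->
  (\int[mu2]_z \int[mu2]_q F (z, q) = \int[mu2]_q \int[mu2]_z F (z, q))%E.
Proof. move=> mF F0; exact (@fubini_tonelli _ _ (R * R)%type (R * R)%type R mu2 mu2 F mF F0). Qed.

Lemma measurable_plane_integral (F : (R * R) * (R * R) -> \bar R) :
  measurable_fun setT F -> (forall p, 0 <= F p)%E ->
  measurable_fun setT (fun z => \int[mu2]_q F (z, q))%E.
Proof. move=> mF F0; exact (@measurable_fun_fubini_tonelli_F _ _ (R * R)%type (R * R)%type R mu2 F mF F0). Qed.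

(** A square of side [r] inside the disc and one of side [2 * r] around it bracket the area; later
    constants come from these two bounds. *)
Lemma disc_lower (r : R) : 0 < r -> ((r ^+ 2)%:E <= mu2 (disc r))%E.
Proof.
move=> r0; rewrite (_ : (r ^+ 2)%:E = mu2 (`]- (r / 2), r / 2[%classic `*` `]- (r / 2), r / 2[%classic)).
  apply: le_measure; rewrite ?inE; [exact: measurableX|exact: measurable_disc|].
  move=> [x y] /= []; rewrite !in_itv /= => /andP[h1 h2] /andP[h3 h4].
  by rewrite /disc /sqn /=; nra.
rewrite plane_measureX // !leb_itv_oo; [|lra..].
by rewrite -EFinM; congr EFin; field.
Qed.

Lemma disc_upper (r : R) : 0 < r -> (mu2 (disc r) <= (4 * r ^+ 2)%:E)%E.
Proof.
move=> r0; rewrite (_ : (4 * r ^+ 2)%:E = mu2 (`]- r, r[%classic `*` `]- r, r[%classic)).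
  apply: le_measure; rewrite ?inE; [exact: measurable_disc|exact: measurableX|].
  move=> [x y]; rewrite /disc /sqn /= !in_itv /= => h.
  split; rewrite -ltr_norml -(ltr_pXn2r (n := 2)) ?nnegrE ?(ltW r0)//= real_normK ?num_real//; nra.
rewrite plane_measureX // !leb_itv_oo; [|lra..].
by rewrite -EFinM; congr EFin; ring.
Qed.

Definition darea (r : R) : R := fine (mu2 (disc r)).

Lemma dareaE (r : R) : 0 < r -> mu2 (disc r) = (darea r)%:E.
Proof.
move=> r0; rewrite fineK // ge0_fin_numE ?measure_ge0 //.
by apply: le_lt_trans (disc_upper r0) _; exact: ltry.
Qed.

Lemma darea_ge (r : R) : 0 < r -> r ^+ 2 <= darea r.
Proof. by move=> r0; rewrite -lee_fin -dareaE // disc_lower. Qed.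

Lemma darea_le (r : R) : 0 < r -> darea r <= 4 * r ^+ 2.
Proof. by move=> r0; rewrite -lee_fin -dareaE // disc_upper. Qed.

Lemma darea_gt0 (r : R) : 0 < r -> 0 < darea r.
Proof. by move=> r0; apply: lt_le_trans (darea_ge r0); rewrite exprn_gt0. Qed.

Definition kern (r : R) (p : R * R) : R := (darea r)^-1 * \1_(disc r) p.

Lemma kern_ge0 (r : R) p : 0 < r -> 0 <= kern r p.
Proof. by move=> r0; rewrite mulr_ge0 // invr_ge0 ltW // darea_gt0. Qed.

Lemma kernE0 (r : R) p : r ^+ 2 <= sqn p -> kern r p = 0.
Proof.
by move=> h; rewrite /kern indicE memNset ?mulr0 // /disc /= ltNge h.
Qed.

Lemma kernE (r : R) p : sqn p < r ^+ 2 -> kern r p = (darea r)^-1.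
Proof. by move=> h; rewrite /kern indicE mem_set // mulr1. Qed.

Lemma measurable_kern r : measurable_fun setT (kern r).
Proof. by apply: measurable_funM => //; apply: measurable_indic; exact: measurable_disc. Qed.

Lemma kern_eq r p q : sqn p = sqn q -> kern r p = kern r q.
Proof.
move=> pq; have [h|h] := ltP (sqn q) (r ^+ 2).
  by rewrite !kernE // pq.
by rewrite !kernE0 // pq.
Qed.

Lemma integral_kern (r : R) : 0 < r -> (\int[mu2]_p (kern r p)%:E = 1)%E.
Proof.
move=> r0; under eq_integral do rewrite /kern EFinM.
rewrite ge0_integralZl_EFin //; last 2 first.
- by apply/measurable_EFinP; apply: measurable_indic; exact: measurable_disc.
- by rewrite invr_ge0 ltW // darea_gt0.
rewrite integral_indic //; last exact: measurable_disc.
by rewrite setIT [X in (_ * X)%E](dareaE r0) -EFinM mulVf // gt_eqF // darea_gt0.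
Qed.

(** Written as a convolution over the whole plane, so that symmetry, commutation of scales and
    restriction to a graph all become instances of Tonelli. *)
Definition avg (r : R) (f : R * R -> \bar R) (z : R * R) : \bar R :=
  (\int[mu2]_p (f (padd z p) * (kern r p)%:E))%E.

Section avg1.
Variables (r : R) (r0 : 0 < r).

Lemma avg_ge0 (f : R * R -> \bar R) z : (forall p, 0 <= f p)%E -> (0 <= avg r f z)%E.
Proof. by move=> f0; apply: integral_ge0 => p _; rewrite mule_ge0 // lee_fin kern_ge0. Qed.

Lemma measurable_avg_integrand (f : R * R -> \bar R) z : measurable_fun setT f ->
  measurable_fun setT (fun p => f (padd z p) * (kern r p)%:E)%E.
Proof.
move=> mf; apply: emeasurable_funM.
  by apply: measurableT_comp => //; exact: measurable_padd.
by apply/measurable_EFinP; exact: measurable_kern.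
Qed.

Lemma measurable_avg (f : R * R -> \bar R) : measurable_fun setT f -> (forall p, 0 <= f p)%E ->
  measurable_fun setT (avg r f).
Proof.
move=> mf f0.
apply: (measurable_plane_integral (F := fun zp => f (padd zp.1 zp.2) * (kern r zp.2)%:E)%E).
  apply: emeasurable_funM.
    by apply: measurableT_comp => //; exact: measurable_padd2.
  by apply/measurable_EFinP; apply: measurableT_comp => //; exact: measurable_kern.
by move=> p; rewrite mule_ge0 // lee_fin kern_ge0.
Qed.

Lemma le_avg (f g : R * R -> \bar R) z : measurable_fun setT f -> measurable_fun setT g ->
  (forall p, 0 <= f p)%E -> (forall p, sqn p < r ^+ 2 -> (f (padd z p) <= g (padd z p))%E) ->
  (avg r f z <= avg r g z)%E.
Proof.
move=> mf mg f0 fg; apply: ge0_le_integral => //.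
- by move=> p _; rewrite mule_ge0 // lee_fin kern_ge0.
- exact: measurable_avg_integrand.
- exact: measurable_avg_integrand.
move=> p _; have [h|h] := ltP (sqn p) (r ^+ 2); last by rewrite kernE0 // !mule0.
by apply: lee_wpmul2r; [rewrite lee_fin kern_ge0|exact: fg].
Qed.

Lemma avg_cst (c : R) z : 0 <= c -> avg r (fun=> c%:E) z = c%:E.
Proof.
move=> c0; rewrite /avg ge0_integralZl_EFin //.
- by rewrite integral_kern // mule1.
- by move=> p _; rewrite lee_fin kern_ge0.
- by apply/measurable_EFinP; exact: measurable_kern.
Qed.

Lemma avgE_sub (f : R * R -> \bar R) z : measurable_fun setT f -> (forall p, 0 <= f p)%E ->
  avg r f z = (\int[mu2]_q (f q * (kern r (psub q z))%:E))%E.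
Proof.
move=> mf f0; rewrite -[RHS](ge0_integral_padd z).
- apply: eq_integral => p _; congr (f _ * (kern r _)%:E)%E.
    by rewrite /padd addrC (addrC z.2).
  by rewrite /psub /padd /= !addrK; case: p.
- apply: emeasurable_funM => //; apply/measurable_EFinP.
  by apply: measurableT_comp; [exact: measurable_kern|exact: measurable_psubr].
- by move=> p; rewrite mule_ge0 // lee_fin kern_ge0.
Qed.

Lemma avg_opp (f : R * R -> \bar R) z : measurable_fun setT f -> (forall p, 0 <= f p)%E ->
  avg r f z = (\int[mu2]_p (f (psub z p) * (kern r p)%:E))%E.
Proof.
move=> mf f0; rewrite /avg -[LHS]ge0_integral_opp.
- apply: eq_integral => p _; rewrite (@kern_eq _ _ p) // /sqn /=; ring.
- exact: measurable_avg_integrand.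
- by move=> p; rewrite mule_ge0 // lee_fin kern_ge0.
Qed.

End avg1.

Section avg2.
Variables (r : R) (r0 : 0 < r).

(** The kernel is even, hence averaging is self-adjoint. This moves an average from a superharmonic
    function, about which little is known, to an explicit cutoff. *)
Lemma integral_avg_sym (f g : R * R -> \bar R) : measurable_fun setT f -> (forall p, 0 <= f p)%E ->
  measurable_fun setT g -> (forall p, 0 <= g p)%E ->
  (\int[mu2]_z (g z * avg r f z) = \int[mu2]_z (f z * avg r g z))%E.
Proof.
move=> mf f0 mg g0.
have k0 p : (0 <= (kern r p)%:E)%E by rewrite lee_fin kern_ge0.
have mk : measurable_fun setT (fun zq : (R * R) * (R * R) => (kern r (psub zq.2 zq.1))%:E).
  apply/measurable_EFinP; apply: measurableT_comp; first exact: measurable_kern.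
  exact: (measurableT_comp measurable_psub2 (@measurable_swap _ _ _ _)).
transitivity (\int[mu2]_z \int[mu2]_q (g z * (f q * (kern r (psub q z))%:E)))%E.
  apply: eq_integral => z _; rewrite avgE_sub // ge0_integralZl //.
  - apply: emeasurable_funM => //; apply/measurable_EFinP.
    by apply: measurableT_comp; [exact: measurable_kern|exact: measurable_psubr].
  - by move=> p _; rewrite mule_ge0.
rewrite (plane2_tonelli (F := fun zq => g zq.1 * (f zq.2 * (kern r (psub zq.2 zq.1))%:E))%E) /=; last 2 first.
- by apply: emeasurable_funM; [exact: measurableT_comp|apply: emeasurable_funM => //; exact: measurableT_comp].
- by move=> p; rewrite !mule_ge0.
apply: eq_integral => q _; rewrite [in RHS]avgE_sub // -ge0_integralZl //.
- apply: eq_integral => z _; rewrite muleCA; congr (_ * (_ * (_)%:E))%E.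
  by apply: kern_eq; rewrite /sqn /=; ring.
- apply: emeasurable_funM => //; apply/measurable_EFinP.
  by apply: measurableT_comp; [exact: measurable_kern|exact: measurable_psubr].
- by move=> p _; rewrite mule_ge0.
Qed.

Lemma avg_comm (s : R) (f : R * R -> \bar R) z : 0 < s ->
  measurable_fun setT f -> (forall p, 0 <= f p)%E ->
  avg r (avg s f) z = avg s (avg r f) z.
Proof.
move=> s0 mf f0.
have k0 t p : 0 < t -> (0 <= (kern t p)%:E)%E by move=> t0; rewrite lee_fin kern_ge0.
have mk t : measurable_fun setT (fun p => (kern t p)%:E).
  by apply/measurable_EFinP; exact: measurable_kern.
transitivity (\int[mu2]_p \int[mu2]_q (f (padd (padd z p) q) * (kern s q)%:E * (kern r p)%:E))%E.
  apply: eq_integral => p _; rewrite /avg ge0_integralZr //.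
  - exact: measurable_avg_integrand.
  - by move=> q _; rewrite mule_ge0 // k0.
  - exact: k0.
rewrite (plane2_tonelli (F := fun pq => f (padd (padd z pq.1) pq.2) * (kern s pq.2)%:E * (kern r pq.1)%:E)%E) /=; last 2 first.
- apply: emeasurable_funM; last exact: (measurableT_comp (mk r) measurable_fst).
  apply: emeasurable_funM; last exact: (measurableT_comp (mk s) measurable_snd).
  apply: (measurableT_comp mf).
  exact: (measurableT_comp measurable_padd2 (measurable_fun_pair (measurableT_comp (measurable_padd z) measurable_fst) measurable_snd)).
- by move=> p; rewrite !mule_ge0 // k0.
apply: eq_integral => q _; rewrite /avg -ge0_integralZr //.
- apply: eq_integral => p _; rewrite -!muleA (muleC (kern s q)%:E); congr (f _ * _)%E.
  by rewrite /padd /= addrAC (addrAC z.2).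
- exact: measurable_avg_integrand.
- by move=> p _; rewrite mule_ge0 // k0.
- exact: k0.
Qed.

(** For fixed [q], the graph meets the disc of radius [r] about [q] only for [t] within [r] of
    [q.1], an interval of length [2 * r], and the kernel is at most [1 / r ^ 2]. The factor [2 / r]
    is the price of restricting to a graph. *)
Lemma integral_avg_graph (y : R -> R) (f : R * R -> \bar R) : measurable_fun setT y ->
  measurable_fun setT f -> (forall p, 0 <= f p)%E ->
  (\int[mu]_t avg r f (t, y t) <= (2 / r)%:E * \int[mu2]_q f q)%E.
Proof.
move=> my mf f0.
have k0 p : (0 <= (kern r p)%:E)%E by rewrite lee_fin kern_ge0.
have mg : measurable_fun setT (fun t => (t, y t)) by exact: measurable_fun_pair.
have mF : measurable_fun setT (fun tq : R * (R * R) => f tq.2 * (kern r (psub tq.2 (tq.1, y tq.1)))%:E)%E.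
  apply: emeasurable_funM; first exact: measurableT_comp.
  apply/measurable_EFinP; apply: measurableT_comp; first exact: measurable_kern.
  exact: (measurableT_comp measurable_psub2 (measurable_fun_pair measurable_snd (measurableT_comp mg measurable_fst))).
have -> : (\int[mu]_t avg r f (t, y t) = \int[mu]_t \int[mu2]_q (f q * (kern r (psub q (t, y t)))%:E))%E.
  by apply: eq_integral => t _; rewrite avgE_sub.
rewrite (fubini_tonelli (m1 := mu) (m2 := mu2) (fun tq : R * (R * R) => f tq.2 * (kern r (psub tq.2 (tq.1, y tq.1)))%:E)%E) //=; last first.
  by move=> p; rewrite mule_ge0.
have r2 : 0 <= 2 / r by rewrite divr_ge0 // ltW.
rewrite -ge0_integralZl_EFin //.
apply: ge0_le_integral => //.
- by move=> q _; apply: integral_ge0 => t _; rewrite mule_ge0.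
- by apply: (measurable_fun_fubini_tonelli_G (m1 := mu) _ mF) => p; rewrite mule_ge0.
- exact: measurable_funeM.
move=> q _.
have mkt : measurable_fun setT (fun t => (kern r (psub q (t, y t)))%:E).
  apply/measurable_EFinP; apply: measurableT_comp; first exact: measurable_kern.
  by apply: measurableT_comp; first exact: measurable_psub.
rewrite ge0_integralZl // muleC; apply: lee_wpmul2r => //.
apply: (@le_trans _ _ (\int[mu]_t ((darea r)^-1%:E * (\1_(`]q.1 - r, q.1 + r[%classic) t)%:E))%E).
  apply: ge0_le_integral => //.
    by apply: measurable_funeM; apply/measurable_EFinP; apply: measurable_indic.
  move=> t _; have [h|h] := ltP (sqn (psub q (t, y t))) (r ^+ 2); last first.
    by rewrite kernE0 // mule_ge0 // lee_fin ?invr_ge0 // ltW // darea_gt0.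
  rewrite kernE // indicE mem_set ?mule1 //= in_itv /=.
  have [+ _] := sqn_ltr_norm r0 h; rewrite /= ltr_norml => /andP[h1 h2]; apply/andP; split; lra.
rewrite ge0_integralZl_EFin //; last 2 first.
  by apply/measurable_EFinP; apply: measurable_indic.
  by rewrite invr_ge0 // ltW // darea_gt0.
have -> : (\int[mu]_x (\1_`]q.1 - r, q.1 + r[%classic x)%:E = (q.1 + r - (q.1 - r))%:E)%E.
  by rewrite integral_indic // setIT; apply: leb_itv_oo; rewrite lerD2l ge0_cp // ltW.
rewrite -EFinM lee_fin mulrC ler_pdivrMr ?darea_gt0 //.
have := darea_ge r0; rewrite (_ : q.1 + r - (q.1 - r) = 2 / r * r ^+ 2); last by field; rewrite gt_eqF.
by move=> h; apply: ler_wpM2l.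
Qed.

(** [z |-> max(0, 1 - |z-w|^2/rho^2)] is semiconvex: its second differences are bounded below. *)
Definition cutoff (w : R * R) (rho : R) (z : R * R) : R :=
  Num.max 0 (1 - sqn (psub z w) / rho ^+ 2).

Lemma cutoff_ge0 w rho z : 0 <= cutoff w rho z.
Proof. by rewrite /cutoff le_max lexx. Qed.

Lemma measurable_cutoff w rho : measurable_fun setT (cutoff w rho).
Proof.
apply: measurable_maxr => //; apply: measurable_funB => //; apply: measurable_funM => //.
by apply: measurableT_comp; [exact: measurable_sqn|exact: measurable_psubr].
Qed.

(** Where the cutoff is positive this is the parallelogram law for the quadratic function below it;
    elsewhere the left side vanishes. *)
Lemma cutoff_second_difference w (rho : R) z p : 0 < rho ->
  2 * cutoff w rho z <= cutoff w rho (padd z p) + cutoff w rho (psub z p) + 2 * (sqn p / rho ^+ 2).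
Proof.
move=> h0; have [h|h] := leP (1 - sqn (psub z w) / rho ^+ 2) 0; rewrite {1}/cutoff.
  by rewrite (max_l h) mulr0 !addr_ge0 ?cutoff_ge0 // mulr_ge0 // divr_ge0 ?sqn_ge0 // exprn_ge0 // ltW.
rewrite (max_r (ltW h)).
have h1 : 1 - sqn (psub (padd z p) w) / rho ^+ 2 <= cutoff w rho (padd z p) by rewrite le_max lexx orbT.
have h2 : 1 - sqn (psub (psub z p) w) / rho ^+ 2 <= cutoff w rho (psub z p) by rewrite le_max lexx orbT.
apply: le_trans (lerD (lerD h1 h2) (lexx _)).
rewrite le_eqVlt; apply/orP; left; apply/eqP; rewrite /sqn /=; field.
by rewrite gt_eqF.
Qed.

(** The second difference inequality is averaged over [p]: since the kernel is even, the two shifted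
    terms have the same average, and [sqn p] is at most [r ^ 2] on its support. *)
Lemma cutoff_avg w (rho : R) z : 0 < rho ->
  ((cutoff w rho z)%:E <= avg r (fun p => (cutoff w rho p)%:E) z + (r ^+ 2 / rho ^+ 2)%:E)%E.
Proof.
move=> h0.
have mc : measurable_fun setT (fun p => (cutoff w rho p)%:E) by apply/measurable_EFinP; exact: measurable_cutoff.
have c0 p : (0 <= (cutoff w rho p)%:E)%E by rewrite lee_fin cutoff_ge0.
have k0 p : (0 <= (kern r p)%:E)%E by rewrite lee_fin kern_ge0.
have e0 : 0 <= r ^+ 2 / rho ^+ 2 by rewrite divr_ge0 // exprn_ge0 // ltW.
have mk : measurable_fun setT (fun p => (kern r p)%:E).
  by apply/measurable_EFinP; exact: measurable_kern.
have mo : measurable_fun setT (fun p => (cutoff w rho (psub z p))%:E * (kern r p)%:E)%E.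
  by apply: emeasurable_funM => //; exact: (measurableT_comp mc (measurable_psub z)).
have mi := measurable_avg_integrand r z mc.
suff sum : ((2 * cutoff w rho z)%:E <= avg r (fun p => (cutoff w rho p)%:E) z +
    \int[mu2]_p ((cutoff w rho (psub z p))%:E * (kern r p)%:E) + (2 * (r ^+ 2 / rho ^+ 2))%:E)%E.
  move: sum; rewrite -(avg_opp r0 z mc c0); case: (avg r _ z) (avg_ge0 r0 z c0) => [u| |] //=.
    by rewrite -!EFinD !lee_fin => _ h; lra.
  by move=> _ _; rewrite addye // leey.
have e2 : 0 <= 2 * (r ^+ 2 / rho ^+ 2) by rewrite mulr_ge0.
have c2 : 0 <= 2 * cutoff w rho z by rewrite mulr_ge0 // cutoff_ge0.
rewrite -(avg_cst r0 z e2) -(avg_cst r0 z c2).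
have mc2 : measurable_fun setT (fun p : R * R => (2 * (r ^+ 2 / rho ^+ 2))%:E * (kern r p)%:E)%E.
  exact: measurable_funeM.
rewrite /avg -ge0_integralD //; last 2 first.
- by move=> p _; rewrite mule_ge0.
- by move=> p _; rewrite mule_ge0.
rewrite -ge0_integralD //; last 3 first.
- by move=> p _; rewrite adde_ge0 // mule_ge0.
- exact: emeasurable_funD.
- by move=> p _; rewrite mule_ge0 // lee_fin.
apply: ge0_le_integral => //.
- by move=> p _; rewrite mule_ge0 // lee_fin.
- exact: measurable_funeM.
- by apply: emeasurable_funD => //; exact: emeasurable_funD.
move=> p _; have [h|h] := ltP (sqn p) (r ^+ 2); last by rewrite kernE0 // !mule0 !adde0.
rewrite -!EFinM -!EFinD lee_fin -!mulrDl; apply: ler_wpM2r; first exact: kern_ge0.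
apply: le_trans (cutoff_second_difference w z p h0) _; rewrite lerD2l ler_pM2l //.
by apply: ler_wpM2r; [rewrite invr_ge0 exprn_ge0 // ltW|exact: ltW].
Qed.

End avg2.
End disc_average.

(** * Circle means and disc averages *)

Section supermean.
Context {R : realType}.
Local Notation mu := (@leb R).
Local Notation mu2 := (@leb2 R).

Section period.
Variable g : R -> \bar R.
Hypotheses (mg : measurable_fun setT g) (g0 : forall x, (0 <= g x)%E).

Lemma integral_itv_shift (a b c : R) :
  (\int[mu]_(x in `[a, b[) g (x + c)%R = \int[mu]_(x in `[(a + c)%R, (b + c)%R[) g x)%E.
Proof.
rewrite [LHS]integral_mkcond [RHS]integral_mkcond -[RHS](ge0_integral_shift c).
- apply: eq_integral => x _; rewrite !patchE; congr (if _ then _ else _).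
  by apply/idP/idP; rewrite !inE /= !in_itv /= => /andP[h1 h2]; apply/andP; split; lra.
- by apply/(measurable_restrictT _ _).1 => //; exact: measurable_funTS.
- by move=> x; rewrite patchE; case: ifP.
Qed.

Lemma integral_itv_split (a b c : R) : a <= b -> b <= c ->
  (\int[mu]_(x in `[a, c[) g x = \int[mu]_(x in `[a, b[) g x + \int[mu]_(x in `[b, c[) g x)%E.
Proof.
move=> ab bc; rewrite -ge0_integral_setU //.
- congr (integral _ _ _); apply/seteqP; split => x /=; rewrite !in_itv /=.
    by move=> /andP[h1 h2]; have [h|h] := ltP x b; [left|right]; apply/andP; split; lra.
  by move=> [] /andP[h1 h2]; apply/andP; split; lra.
- exact: measurable_funTS.
- apply/disj_setPS => x /= []; rewrite !in_itv /= => /andP[h1 h2] /andP[h3 h4].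
  by move: (lt_le_trans h2 h3); rewrite ltxx.
Qed.

Lemma integral_period_shift (T c : R) : (forall x, g (x + T) = g x) -> 0 <= c <= T ->
  (\int[mu]_(x in `[0%R, T[) g (x + c)%R = \int[mu]_(x in `[0%R, T[) g x)%E.
Proof.
move=> gT /andP[c0 cT]; rewrite integral_itv_shift add0r.
rewrite (@integral_itv_split c T (T + c)) ?lerDl //.
have := integral_itv_shift 0 c T; rewrite add0r (addrC c) => <-.
under [X in (_ + X)%E]eq_integral do rewrite gT.
by rewrite addeC -(@integral_itv_split 0 c T).
Qed.

End period.

Lemma polar_form (p : R * R) :
  exists s c : R, [/\ 0 <= s, 0 <= c <= pi *+ 2, p = (s * cos c, s * sin c) & sqn p = s ^+ 2].
Proof.
have [p0|p0] := eqVneq (sqn p) 0.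
  exists 0, 0; rewrite lexx mulrn_wge0 ?pi_ge0 // !mul0r expr0n /= p0; split => //.
  move: p0 => /eqP; rewrite /sqn paddr_eq0 ?sqr_ge0 // !sqrf_eq0.
  by case: p => x y /= /andP[/eqP -> /eqP ->].
have sp : 0 < sqn p by rewrite lt_def p0 sqn_ge0.
pose s := Num.sqrt (sqn p); have s0 : 0 < s by rewrite sqrtr_gt0.
have s2 : s ^+ 2 = sqn p by rewrite sqr_sqrtr // ltW.
have x1 : -1 <= p.1 / s <= 1.
  rewrite -ler_norml normrM normfV (gtr0_norm s0) ler_pdivrMr // mul1r.
  by rewrite -sqrtr_sqr; apply: ler_wsqrtr; rewrite /sqn lerDl sqr_ge0.
have [/andP[a0 api] ca] := acos_def x1.
have sa := sin_acos x1.
have sy : Num.sqrt (1 - (p.1 / s) ^+ 2) = `|p.2| / s.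
  rewrite (_ : _ - _ = (`|p.2| / s) ^+ 2) ?sqrtr_sqr ?normrM ?normr_id ?normfV ?(gtr0_norm s0) //.
  rewrite !expr_div_n s2 real_normK ?num_real //; apply: (mulIf (lt0r_neq0 sp)).
  by rewrite mulrBl !mulfVK // mul1r /sqn addrAC subrr add0r.
have pi0 := pi_ge0 R.
have [y0|y0] := leP 0 p.2.
  exists s, (acos (p.1 / s)); split; rewrite ?s2 ?(ltW s0) //; first by apply/andP; split => //; lra.
  rewrite ca sa sy ger0_norm // !(mulrC s) !mulfVK ?gt_eqF //; by case: (p).
exists s, (pi *+ 2 - acos (p.1 / s)); split; rewrite ?s2 ?(ltW s0) //.
  by apply/andP; split; lra.
rewrite cosB sinB cos2pi sin2pi ca sa sy ltr0_norm // mul1r !mul0r sub0r addr0 mul1r.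
by rewrite mulNr opprK !(mulrC s) !mulfVK ?gt_eqF //; case: (p).
Qed.

Lemma measurable_cos : measurable_fun setT (@cos R).
Proof. by apply: continuous_measurable_fun; exact: continuous_cos. Qed.

Lemma measurable_sin : measurable_fun setT (@sin R).
Proof. by apply: continuous_measurable_fun; exact: continuous_sin. Qed.

Lemma sqn_rotp (c s : R) p : c ^+ 2 + s ^+ 2 = 1 -> sqn (rotp c s p) = sqn p.
Proof.
by move=> cs; rewrite -[RHS]mul1r -cs /sqn /rotp /=; ring.
Qed.

(** The half-open period lets a shifted interval be cut into disjoint pieces and reassembled. *)
Definition circle_integral (v : R * R -> \bar R) (z : R * R) (s : R) : \bar R :=
  (\int[mu]_(x in `[0%R, (pi *+ 2)%R[) v (z.1 + s * cos x, z.2 + s * sin x)%R)%E.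

Lemma measurable_circle (v : R * R -> \bar R) (z : R * R) (s c : R) : measurable_fun setT v ->
  measurable_fun setT (fun x : R => v (z.1 + s * cos (x + c), z.2 + s * sin (x + c))).
Proof.
move=> mv; apply: (measurableT_comp mv).
apply: measurable_fun_pair; apply: measurable_funD => //; apply: measurable_funM => //.
  by apply: (measurableT_comp measurable_cos); exact: measurable_funD.
by apply: (measurableT_comp measurable_sin); exact: measurable_funD.
Qed.

(** The disc average is an average of circle means, by rotation invariance. *)
Lemma avg_le_center (r : R) (v : R * R -> \bar R) z : 0 < r -> measurable_fun setT v ->
  (forall p, (0 <= v p)%E) ->
  (forall s, 0 <= s < r -> (circle_integral v z s <= (pi *+ 2)%:E * v z)%E) ->
  (avg r v z <= v z)%E.
Proof.
move=> r0 mv v0 hv.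
have k0 p : (0 <= (kern r p)%:E)%E by rewrite lee_fin kern_ge0.
have pi0 : 0 < pi *+ 2 :> R by rewrite mulrn_wgt0 // pi_gt0.
have mk : measurable_fun setT (fun p => (kern r p)%:E).
  by apply/measurable_EFinP; exact: measurable_kern.
have mi := measurable_avg_integrand r z mv.
pose I x : R := \1_(`[0%R, (pi *+ 2)%R[%classic : set R) x.
have I0 x : (0 <= (I x)%:E)%E by rewrite lee_fin.
have mI : measurable_fun setT (fun x => (I x)%:E) by apply/measurable_EFinP; apply: measurable_indic.
have intI f : (\int[mu]_(x in `[0%R, (pi *+ 2)%R[) f x = \int[mu]_x ((I x)%:E * f x))%E.
  rewrite integral_mkcond; apply: eq_integral => x _; rewrite patchE /I indicE.
  by case: ifP => h; rewrite ?mul1e ?mul0e.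
have rotE x : avg r v z = (\int[mu2]_p (v (padd z (rotp (cos x) (sin x) p)) * (kern r p)%:E))%E.
  rewrite /avg -[LHS](@ge0_integral_rotp _ (cos x) (sin x)) //.
  - apply: eq_integral => p _; congr (_ * (_)%:E)%E; apply: kern_eq.
    by rewrite sqn_rotp // cos2Dsin2.
  - exact: cos2Dsin2.
  - by move=> p; rewrite mule_ge0.
rewrite -(@lee_pmul2l _ (pi *+ 2)%:E) ?lte_fin //.
(* Each rotation leaves the average unchanged, so [2 pi] times it is its integral over all angles.
   Tonelli then fixes [p] and lets the angle run, which sweeps the circle through [p]. *)
have -> : ((pi *+ 2)%:E * avg r v z =
   \int[mu]_x \int[mu2]_p ((I x)%:E * (v (padd z (rotp (cos x) (sin x) p)) * (kern r p)%:E)))%E.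
  have a0 := avg_ge0 (r := r) r0 z v0.
  transitivity (\int[mu]_(x in `[0%R, (pi *+ 2)%R[) (cst (avg r v z) x))%E.
    rewrite integral_cst // muleC; congr (_ * _)%E.
    by rewrite -[RHS]/(@lebesgue_measure R `[0%R, (pi *+ 2)%R[%classic) lebesgue_measure_itv /= lte_fin pi0 -EFinB subr0.
  rewrite intI; apply: eq_integral => x _; rewrite [cst _ _](rotE x) ge0_integralZl //.
  - apply: emeasurable_funM => //; apply: (measurableT_comp mv).
    by apply: (measurableT_comp (measurable_padd z)); exact: measurable_rotp.
  - by move=> p _; rewrite mule_ge0.
have mF : measurable_fun setT (fun xp : R * (R * R) =>
    (I xp.1)%:E * (v (padd z (rotp (cos xp.1) (sin xp.1) xp.2)) * (kern r xp.2)%:E))%E.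
  apply: emeasurable_funM; first exact: (measurableT_comp mI measurable_fst).
  apply: emeasurable_funM; last exact: (measurableT_comp mk measurable_snd).
  apply: (measurableT_comp mv); apply: (measurableT_comp (measurable_padd z)).
  have mc := measurableT_comp measurable_cos (@measurable_fst _ _ R (R * R)%type).
  have ms := measurableT_comp measurable_sin (@measurable_fst _ _ R (R * R)%type).
  have m1 := measurableT_comp measurable_fst (@measurable_snd _ _ R (R * R)%type).
  have m2 := measurableT_comp measurable_snd (@measurable_snd _ _ R (R * R)%type).
  apply: measurable_fun_pair.
    by apply: measurable_funB; apply: measurable_funM.
  by apply: measurable_funD; apply: measurable_funM.
rewrite (fubini_tonelli (m1 := mu) (m2 := mu2) _ mF); last by move=> p; rewrite !mule_ge0.
have -> : ((pi *+ 2)%:E * v z = \int[mu2]_p ((pi *+ 2)%:E * v z * (kern r p)%:E))%E.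
  by rewrite ge0_integralZl // ?integral_kern ?mule1 // mule_ge0 // lee_fin ltW.
apply: ge0_le_integral => //.
- by move=> p _; apply: integral_ge0 => x _; rewrite !mule_ge0.
- by apply: (measurable_fun_fubini_tonelli_G (m1 := mu) _ mF) => p; rewrite !mule_ge0.
- exact: measurable_funeM.
move=> p _ /=; have [h|h] := ltP (sqn p) (r ^+ 2); last first.
  by rewrite kernE0 // mule0; under eq_integral do rewrite !mule0; rewrite integral0.
have mvx : measurable_fun setT (fun x => v (padd z (rotp (cos x) (sin x) p))).
  apply: (measurableT_comp mv); apply: (measurableT_comp (measurable_padd z)).
  apply: measurable_fun_pair.
    by apply: measurable_funB; apply: measurable_funM => //; [exact: measurable_cos|exact: measurable_sin].
  by apply: measurable_funD; apply: measurable_funM => //; [exact: measurable_sin|exact: measurable_cos].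
under eq_integral do rewrite muleA.
rewrite ge0_integralZr //; last 2 first.
- exact: emeasurable_funM.
- by move=> x _; rewrite mule_ge0.
apply: lee_wpmul2r => //.
(* In polar coordinates the inner integral is the circle integral of radius [s] shifted by the angle
   [c] of [p]; periodicity removes the shift. *)
have [s [c [s0 cpi pE p2]]] := polar_form p.
rewrite -intI.
have sr : 0 <= s < r.
  by rewrite s0 /= -(ltr_pXn2r (n := 2)) ?nnegrE ?(ltW r0) // -p2.
apply: le_trans (hv s sr); rewrite /circle_integral.
pose g x := v (z.1 + s * cos x, z.2 + s * sin x)%R.
have mg : measurable_fun setT g.
  by have := measurable_circle z s 0 mv; under eq_fun do rewrite addr0.
have gT x : g (x + pi *+ 2) = g x by rewrite /g mulr2n addrA !cosDpi !sinDpi !opprK.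
rewrite -(integral_period_shift mg (fun x => v0 _) gT cpi).
rewrite le_eqVlt; apply/orP; left; apply/eqP; apply: eq_integral => x _.
by rewrite pE /rotp /padd /g /= cosD sinD; congr (v (_, _)); ring.
Qed.

End supermean.

(** * Superharmonic functions along Lipschitz graphs *)

Section ereal_limits.
Context {R : realType}.
Implicit Types (a b x : \bar R) (u : (\bar R)^nat).
Local Open Scope ereal_scope.

Lemma lee_real_lt a b : (forall c : R, c%:E < a -> c%:E <= b) -> a <= b.
Proof.
case: a => [r| |] h; last by rewrite leNye.
  apply/lee_subgt0Pr => e e0; apply: h; rewrite lte_fin; lra.
suff -> : b = +oo by [].
by apply/eqyP => A A0; apply: h; rewrite ltry.
Qed.

Lemma limn_einf_ge u a N : (forall n, (N <= n)%N -> a <= u n) -> a <= limn_einf u.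
Proof.
move=> h; rewrite limn_einf_lim (cvg_lim _ (@cvg_einfs_sup _ u)) //.
apply: (@le_trans _ _ (einfs u N)); last by apply: ereal_sup_ubound; exists N.
by apply: le_ereal_inf_tmp => _ [k /= Nk <-]; exact: h.
Qed.

Lemma limn_einf_le u a : (forall n, u n <= a) -> limn_einf u <= a.
Proof.
move=> h; rewrite limn_einf_lim (cvg_lim _ (@cvg_einfs_sup _ u)) //.
apply: ge_ereal_sup => _ [n _ <-]; apply: le_trans (h n).
by apply: ereal_inf_lbound; exists n => /=.
Qed.

Lemma measurable_expeR : measurable_fun setT (@expeR R).
Proof.
apply: (measurability _ (ErealGenOInfty.measurableE R)) => _ [_ [c ->]] <-.
rewrite setTI; have [c0|c0] := ltP c%:E 0.
  rewrite (_ : _ @^-1` _ = setT) //; apply/seteqP; split => x //= _.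
  by rewrite in_itv /= andbT (lt_le_trans c0) // expeR_ge0.
have [z zc] := expeR_total c0.
rewrite (_ : _ @^-1` _ = `]z, +oo[%classic); first exact: emeasurable_itv.
by apply/seteqP; split => x /=; rewrite !in_itv /= !andbT -zc lte_expeR.
Qed.

End ereal_limits.

Section average_more.
Context {R : realType}.
Local Notation mu := (@leb R).
Local Notation mu2 := (@leb2 R).
Variables (r : R) (r0 : 0 < r).

Lemma avg_add (f g : R * R -> \bar R) z : measurable_fun setT f -> measurable_fun setT g ->
  (forall p, 0 <= f p)%E -> (forall p, 0 <= g p)%E ->
  (avg r (fun p => f p + g p) z = avg r f z + avg r g z)%E.
Proof.
move=> mf mg f0 g0.
have k0 p : (0 <= (kern r p)%:E)%E by rewrite lee_fin kern_ge0.
rewrite /avg -ge0_integralD //.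
- by apply: eq_integral => p _; rewrite ge0_muleDl.
- by move=> p _; rewrite mule_ge0.
- exact: measurable_avg_integrand.
- by move=> p _; rewrite mule_ge0.
- exact: measurable_avg_integrand.
Qed.

Lemma avg_le_integral (f : R * R -> \bar R) z : measurable_fun setT f -> (forall p, 0 <= f p)%E ->
  (avg r f z <= ((darea r)^-1)%:E * \int[mu2]_p f p)%E.
Proof.
move=> mf f0.
have d0 : 0 <= (darea r)^-1 by rewrite invr_ge0 ltW // darea_gt0.
have mfz := measurableT_comp mf (measurable_padd z).
rewrite -(ge0_integral_padd z) // -ge0_integralZl_EFin //; last first.
  exact: (measurableT_comp mf (measurable_paddr z)).
apply: ge0_le_integral => //.
- by move=> p _; rewrite mule_ge0 // lee_fin kern_ge0.
- exact: measurable_avg_integrand.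
- by apply: measurable_funeM; exact: (measurableT_comp mf (measurable_paddr z)).
move=> p _; rewrite muleC /padd (addrC z.1) (addrC z.2); apply: lee_wpmul2r => //.
rewrite lee_fin; have [h|h] := ltP (sqn p) (r ^+ 2); first by rewrite kernE.
by rewrite kernE0.
Qed.

Lemma avg_le_cst (f : R * R -> \bar R) (c : R) z : 0 <= c -> measurable_fun setT f ->
  (forall p, 0 <= f p)%E -> (forall p, f p <= c%:E)%E -> (avg r f z <= c%:E)%E.
Proof.
move=> c0 mf f0 fc; rewrite -(avg_cst r0 z c0); apply: le_avg => //.
Qed.

Lemma avg_ge_cst (f : R * R -> \bar R) (c : R) z : measurable_fun setT f ->
  (forall p, 0 <= f p)%E -> (forall p, sqn p < r ^+ 2 -> (c%:E <= f (padd z p))%E) ->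
  (c%:E <= avg r f z)%E.
Proof.
move=> mf f0 fc; have [c0|c0] := leP 0 c.
  by rewrite -(avg_cst r0 z c0); apply: le_avg => // p; rewrite lee_fin.
by apply: le_trans (avg_ge0 r0 z f0); rewrite lee_fin ltW.
Qed.

End average_more.

(** Lagrange's identity gives Cauchy-Schwarz, which bounds the cross term of the expanded square by
    [r * s]. *)
Lemma sqn_padd_lt (R : realType) (p q : R * R) (r s : R) : 0 < r -> 0 < s ->
  sqn p < r ^+ 2 -> sqn q < s ^+ 2 -> sqn (padd p q) < (r + s) ^+ 2.
Proof.
move=> r0 s0; rewrite /sqn /= => hp hq.
have h : (p.1 * q.1 + p.2 * q.2) ^+ 2 <= (r * s) ^+ 2.
  apply: (@le_trans _ _ ((p.1 ^+ 2 + p.2 ^+ 2) * (q.1 ^+ 2 + q.2 ^+ 2))).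
    rewrite -subr_ge0 (_ : _ - _ = (p.1 * q.2 - p.2 * q.1) ^+ 2) ?sqr_ge0 //; ring.
  by rewrite exprMn; apply: ler_pM; rewrite ?addr_ge0 ?sqr_ge0 // ltW.
have {}h : p.1 * q.1 + p.2 * q.2 <= r * s.
  have rs0 : 0 <= r * s by rewrite mulr_ge0 // ltW.
  have [h1|h1] := leP (p.1 * q.1 + p.2 * q.2) 0; first exact: le_trans rs0.
  by rewrite -(ler_pXn2r (n := 2)) // nnegrE ltW.
rewrite (_ : _ + _ = (p.1 ^+ 2 + p.2 ^+ 2) + (q.1 ^+ 2 + q.2 ^+ 2) + 2 * (p.1 * q.1 + p.2 * q.2)); last by ring.
rewrite (_ : (r + s) ^+ 2 = r ^+ 2 + s ^+ 2 + 2 * (r * s)); last by ring.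
lra.
Qed.

(** The tangent of the exponential at [b] lies below its graph. The increment [d] is thereby
    multiplied by the exponential of the upper end [b], which is the quantity bounded in advance
    when averages are telescoped. *)
Lemma expeR_step (R : realType) (a b : R) (d : \bar R) : (0 <= d)%E -> (b%:E <= a%:E + d)%E ->
  (expeR b%:E <= expeR a%:E + (expR b)%:E * d)%E.
Proof.
case: d => [d| |] //=; rewrite ?lee_fin => d0 h; last first.
  by rewrite gt0_muley ?lte_fin ?expR_gt0 // addey // leey.
have := expR_ge1Dx (a - b); have := expR_gt0 b => b0 h1.
have : expR b * (1 + (a - b)) <= expR a.
  by rewrite -[leRHS](_ : expR b * expR (a - b) = _) ?ler_pM2l // -expRD; congr expR; ring.
have : expR b * (b - a) <= expR b * d by rewrite ler_pM2l //; lra.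
lra.
Qed.

Lemma lt_sqr_trans (R : realType) (x a b : R) : 0 <= a -> a <= b ->
  x < a ^+ 2 -> x < b ^+ 2.
Proof. by move=> a0 ab h; apply: lt_le_trans h _; rewrite ler_sqr ?nnegrE // (le_trans a0). Qed.

Definition graph_disc (R : realType) (y : R -> R) (w : R * R) (rho : R) : set R :=
  [set t | sqn (psub (t, y t) w) < rho ^+ 2].

(** * Exponential integrability from telescoping dyadic averages *)

Section local_exp_bound.
Context {R : realType}.
Local Notation mu := (@leb R).
Local Notation mu2 := (@leb2 R).
Variables (y : R -> R) (w0 : R * R) (rho C1 m : R) (v : R * R -> \bar R).
Hypotheses (my : measurable_fun setT y) (mv : measurable_fun setT v).
Hypothesis v0 : forall p, (0 <= v p)%E.
Hypotheses (rho0 : 0 < rho) (m0 : 0 <= m) (m1 : m < 1) (C10 : 0 <= C1).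
(** In the application [v] is [M - Phi] set to [0] outside the disc of radius [8 * rho]; so
    semicontinuity and mean value bounds are asked only near [w0], while the integral bound is over
    the whole plane. *)
Hypothesis vlsc : forall z (c : R), sqn (psub z w0) < rho ^+ 2 -> (c%:E < v z)%E ->
  exists2 d : R, 0 < d & forall p, sqn p < d ^+ 2 -> (c%:E <= v (padd z p))%E.
Hypothesis vsm : forall z (r : R), sqn (psub z w0) < (4 * rho) ^+ 2 -> 0 < r <= rho ->
  (avg r v z <= v z)%E.
Hypothesis vint : (\int[mu2]_p v p <= (C1 * rho ^+ 2)%:E)%E.
Hypothesis vbd : forall z (r : R), sqn (psub z w0) < (2 * rho) ^+ 2 -> 0 < r <= rho ->
  (avg r v z <= (C1 + m * ln (rho / r))%:E)%E.

Let rad (J : nat) : R := rho / 2 ^+ J.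
Let D (s : R) : set (R * R) := [set p | sqn (psub p w0) < (s * rho) ^+ 2].
(** A stand-in for the Riesz measure of [- v] seen at scale [rad J], nonnegative by the super mean
    value property. [D 4] is the set where the cutoff of radius [4 * rho] is positive; [D 2]
    contains the discs of radius at most [rho] about points within [rho] of [w0]. *)
Let G (s : R) (J : nat) : R * R -> \bar R := (fun p => v p - avg (rad J) v p)%E \_ (D s).

Let rad_gt0 J : 0 < rad J.
Proof. by rewrite divr_gt0 // exprn_gt0. Qed.

Let rad_le J : 0 < rad J <= rho.
Proof.
by rewrite rad_gt0 /= ler_pdivrMr ?exprn_gt0 // ler_peMr ?(ltW rho0) // exprn_ege1 // ler1n.
Qed.

Let rho_le1 : 0 <= rho. Proof. exact: ltW. Qed.
Let rho_le2 : rho <= 2 * rho. Proof. by rewrite ler_peMl // ler1n. Qed.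
Let rho2_ge0 : 0 <= 2 * rho. Proof. by rewrite mulr_ge0. Qed.
Let rho_le4 : 2 * rho <= 4 * rho. Proof. by rewrite ler_pM2r // ler_nat. Qed.

Let measurable_D s : measurable (D s).
Proof.
have := measurableT_comp measurable_sqn (measurable_psubr w0).
move=> /(_ measurableT _ (measurable_itv `]-oo, (s * rho) ^+ 2[)).
by rewrite setTI; congr measurable; apply/seteqP; split => p /=; rewrite in_itv.
Qed.

Let v_int_lty : (\int[mu2]_p v p < +oo)%E.
Proof. by apply: le_lt_trans vint _; rewrite ltry. Qed.

Let avg_fin J z : avg (rad J) v z \is a fin_num.
Proof.
rewrite ge0_fin_numE; last exact: avg_ge0.
apply: le_lt_trans (avg_le_integral (rad_gt0 J) z mv v0) _.
by rewrite lte_mul_pinfty // lee_fin invr_ge0 ltW // darea_gt0.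
Qed.

Let measurable_avgv J : measurable_fun setT (avg (rad J) v).
Proof. exact: measurable_avg. Qed.

Let measurable_G s J : measurable_fun setT (G s J).
Proof.
apply/(measurable_restrictT _ _).1 => //.
by apply: emeasurable_funB; exact: measurable_funTS.
Qed.

Let G_ge0 s J p : 0 <= s <= 4 -> (0 <= G s J p)%E.
Proof.
move=> /andP[s0 s4]; rewrite /G patchE; case: ifPn => // pD; rewrite sube_ge0 ?avg_fin //.
apply: vsm (rad_le J); move: pD; rewrite inE /D /=; apply: lt_sqr_trans.
  by rewrite mulr_ge0 // ltW.
by rewrite ler_pM2r.
Qed.

(** By self-adjointness, testing [v - avg v] against the cutoff is testing [v] against the cutoff
    minus its average, which is at most [rad J ^ 2 / (4 * rho) ^ 2]. Both sides are kept as sums,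
    [E1] and [E2], and the common term is cancelled only once it is known to be finite. *)
Let integral_cutoff_G J :
  (\int[mu2]_p ((cutoff w0 (4 * rho) p)%:E * G 4 J p) <= (C1 * rad J ^+ 2 / 16)%:E)%E.
Proof.
pose c p : \bar R := (cutoff w0 (4 * rho) p)%:E.
have c0 p : (0 <= c p)%E by rewrite lee_fin cutoff_ge0.
have mc : measurable_fun setT c by apply/measurable_EFinP; exact: measurable_cutoff.
have rho4 : 0 < 4 * rho by rewrite mulr_gt0.
have a0 p : (0 <= avg (rad J) v p)%E by exact: avg_ge0.
have G0 p : (0 <= G 4 J p)%E by apply: G_ge0; rewrite lexx andbT.
have ac0 p : (0 <= avg (rad J) c p)%E by exact: avg_ge0.
have mac : measurable_fun setT (avg (rad J) c) by exact: measurable_avg.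
have ac1 p : (avg (rad J) c p <= 1)%E.
  apply: avg_le_cst => // q; rewrite lee_fin /cutoff ge_max ler01 /=.
  by rewrite lerBlDr lerDl divr_ge0 ?sqn_ge0 // exprn_ge0 // ltW.
pose e : R := rad J ^+ 2 / (4 * rho) ^+ 2.
have e0 : 0 <= e by rewrite divr_ge0 // exprn_ge0 // ltW.
have E1 : (\int[mu2]_p (c p * v p) = \int[mu2]_p (c p * G 4 J p) + \int[mu2]_p (v p * avg (rad J) c p))%E.
  rewrite -(integral_avg_sym (rad_gt0 J) mv v0 mc c0) -ge0_integralD //.
  - apply: eq_integral => p _; have [pD|pD] := boolP (p \in D 4).
      rewrite /G patchE pD -ge0_muleDr //; last first.
        by have := G0 p; rewrite /G patchE pD.
      by rewrite subeK // avg_fin.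
    rewrite /c /cutoff (_ : Num.max _ _ = 0) ?mul0e ?add0e //.
    apply: max_l; rewrite subr_le0 ler_pdivlMr ?exprn_gt0 // mul1r.
    by move: pD; rewrite notin_setE /D /= => /negP; rewrite -leNgt.
  - by move=> p _; rewrite mule_ge0.
  - exact: emeasurable_funM.
  - by move=> p _; rewrite mule_ge0.
  - exact: emeasurable_funM.
have E2 : (\int[mu2]_p (c p * v p) <= \int[mu2]_p (v p * avg (rad J) c p) + e%:E * \int[mu2]_p v p)%E.
  rewrite -ge0_integralZl_EFin // -ge0_integralD //.
  - apply: ge0_le_integral => //.
    + by move=> p _; rewrite mule_ge0.
    + exact: emeasurable_funM.
    + apply: emeasurable_funD; first exact: emeasurable_funM.
      exact: measurable_funeM.
    move=> p _; rewrite muleC (muleC e%:E) -ge0_muleDr ?lee_fin //.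
    by apply: lee_wpmul2l => //; exact: cutoff_avg.
  - by move=> p _; rewrite mule_ge0.
  - exact: emeasurable_funM.
  - by move=> p _; rewrite mule_ge0.
  - exact: measurable_funeM.
have A0 : (0 <= \int[mu2]_p (v p * avg (rad J) c p))%E by apply: integral_ge0 => p _; rewrite mule_ge0.
have Afin : (\int[mu2]_p (v p * avg (rad J) c p) < +oo)%E.
  apply: le_lt_trans v_int_lty; apply: ge0_le_integral => //.
  - by move=> p _; rewrite mule_ge0.
  - exact: emeasurable_funM.
  - by move=> p _; rewrite -[leRHS]mule1; apply: lee_wpmul2l.
move: E2; rewrite E1 addeC leeD2lE ?ge0_fin_numE // => /le_trans; apply.
apply: (@le_trans _ _ (e%:E * (C1 * rho ^+ 2)%:E)%E); first by apply: lee_wpmul2l.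
rewrite -EFinM lee_fin le_eqVlt; apply/orP; left; apply/eqP; rewrite /e; field.
by rewrite gt_eqF.
Qed.

(** On [D 2] the cutoff is at least [3 / 4], and [4 / 3] of [1 / 16] is [1 / 12]. *)
Let integral_G2 J : (\int[mu2]_p G 2 J p <= (C1 * rad J ^+ 2 / 12)%:E)%E.
Proof.
have mc : measurable_fun setT (fun p => (cutoff w0 (4 * rho) p)%:E).
  by apply/measurable_EFinP; exact: measurable_cutoff.
have G20 p : (0 <= G 2 J p)%E by apply: G_ge0; lra.
have G40 p : (0 <= G 4 J p)%E by apply: G_ge0; lra.
apply: (@le_trans _ _ ((4 / 3)%:E * \int[mu2]_p ((cutoff w0 (4 * rho) p)%:E * G 4 J p))%E).
  have mcG : measurable_fun setT (fun p => (cutoff w0 (4 * rho) p)%:E * G 4 J p)%E by exact: emeasurable_funM.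
  rewrite -ge0_integralZl_EFin //; last by move=> p _; rewrite mule_ge0 // lee_fin cutoff_ge0.
  apply: ge0_le_integral => //; first exact: measurable_funeM.
  move=> p _; have [pD|pD] := boolP (p \in D 2); last first.
    by rewrite {1}/G patchE (negbTE pD) !mule_ge0 ?lee_fin ?divr_ge0 ?cutoff_ge0.
  have pD2 : sqn (psub p w0) < (2 * rho) ^+ 2 by move: pD; rewrite inE.
  have pD4 : p \in D 4.
    by rewrite inE /D /=; exact: lt_sqr_trans rho2_ge0 rho_le4 pD2.
  have c34 : 3 / 4 <= cutoff w0 (4 * rho) p.
    rewrite /cutoff le_max; apply/orP; right.
    have h : sqn (psub p w0) / (4 * rho) ^+ 2 <= 1 / 4.
      rewrite ler_pdivrMr ?exprn_gt0 ?mulr_gt0 //; apply: le_trans (ltW pD2) _.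
      by rewrite le_eqVlt; apply/orP; left; apply/eqP; field.
    lra.
  have -> : G 2 J p = G 4 J p by rewrite /G !patchE pD pD4.
  rewrite muleA -EFinM -[leLHS]mul1e; apply: lee_wpmul2r => //; rewrite lee_fin; lra.
apply: (@le_trans _ _ ((4 / 3)%:E * (C1 * rad J ^+ 2 / 16)%:E)%E).
  by apply: lee_wpmul2l; [rewrite lee_fin divr_ge0|exact: integral_cutoff_G].
by rewrite -EFinM lee_fin; lra.
Qed.

(** On the disc concerned, [v] is its average at scale J plus [G 2 J]. Averages at two scales
    commute, so averaging [avg (rad J) v] once more at scale J + 1 gives the average at scale J of
    something at most [v]. *)
Let avg_step J z : sqn (psub z w0) < rho ^+ 2 ->
  (avg (rad J.+1) v z <= avg (rad J) v z + avg (rad J.+1) (G 2 J) z)%E.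
Proof.
move=> hz.
have G20 p : (0 <= G 2 J p)%E by apply: G_ge0; lra.
have near i p : sqn p < rad i ^+ 2 -> sqn (psub (padd z p) w0) < (2 * rho) ^+ 2.
  move=> hp; have := sqn_padd_lt rho0 (rad_gt0 i) hz hp.
  rewrite (_ : padd (psub z w0) p = psub (padd z p) w0); last by rewrite /padd /psub /=; congr pair; ring.
  by have /andP[ri hi] := rad_le i; apply: lt_sqr_trans; lra.
apply: (@le_trans _ _ (avg (rad J.+1) (fun p => avg (rad J) v p + G 2 J p)%E z)).
  apply: le_avg => //; first exact: emeasurable_funD.
  move=> p /near hp; rewrite /G patchE mem_set // addeC subeK //.
rewrite avg_add //; last by move=> p; exact: avg_ge0.
rewrite leeD2r // avg_comm //; apply: le_avg => //.
  by move=> p; exact: avg_ge0.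
by move=> p /near hp; apply: vsm (rad_le _); exact: lt_sqr_trans rho2_ge0 rho_le4 hp.
Qed.

Let ln_rad J : ln (rho / rad J) = ln 2 *+ J.
Proof.
by rewrite -lnXn //; congr ln; rewrite /rad invf_div mulrCA mulfV ?mulr1 // gt_eqF.
Qed.

Let avg_rad_le J z : sqn (psub z w0) < rho ^+ 2 ->
  (avg (rad J) v z <= (C1 + m * ln 2 *+ J)%:E)%E.
Proof.
move=> hz; rewrite -mulrnAr -ln_rad; by apply: vbd (rad_le J); exact: lt_sqr_trans rho_le1 rho_le2 hz.
Qed.

Let exp_telescope N z : sqn (psub z w0) < rho ^+ 2 ->
  (expeR (avg (rad N) v z) <= (expR C1)%:E +
     \sum_(J < N) (expR (C1 + m * ln 2 *+ J.+1))%:E * avg (rad J.+1) (G 2 J) z)%E.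
Proof.
move=> hz; elim: N => [|N IH].
  rewrite big_ord0 adde0 -[leRHS]/(expeR C1%:E) lee_expeR.
  by have := avg_rad_le 0 hz; rewrite mulr0n addr0.
rewrite big_ord_recr /= addeA.
have d0 : (0 <= avg (rad N.+1) (G 2 N) z)%E.
  by apply: avg_ge0 => // p; apply: G_ge0; lra.
apply: (@le_trans _ _ (expeR (avg (rad N) v z) +
    (expR (C1 + m * ln 2 *+ N.+1))%:E * avg (rad N.+1) (G 2 N) z)%E); last by rewrite leeD2r.
have := avg_step N hz; have := avg_rad_le N.+1 hz.
rewrite -(fineK (avg_fin N.+1 z)) -(fineK (avg_fin N z)) lee_fin => hb.
move=> /(expeR_step d0) /le_trans; apply; rewrite leeD2l //; apply: lee_wpmul2r => //.
by rewrite lee_fin ler_expR.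
Qed.

Let mg : measurable_fun setT (fun t => (t, y t)).
Proof. exact: measurable_fun_pair. Qed.

Lemma measurable_graph_disc : measurable (graph_disc y w0 rho).
Proof.
have := measurableT_comp measurable_sqn (measurableT_comp (measurable_psubr w0) mg).
move=> /(_ measurableT _ (measurable_itv `]-oo, rho ^+ 2[)).
by rewrite setTI; congr measurable; apply/seteqP; split => t /=; rewrite in_itv.
Qed.

(** The first term contributes [expR C1] times a length of at most [2 * rho]. Term J carries the
    factors [2 / rad J.+1] from the graph and [C1 * rad J ^ 2 / 12] from the mass, hence is a
    constant times [rho * q ^ J] with [q = 2 ^ m / 2], and [m < 1] gives [q < 1]. *)
Let exp_avg_integral N :
  (\int[mu]_(t in graph_disc y w0 rho) expeR (avg (rad N) v (t, y t)) <=
   ((2 * expR C1 + C1 * expR C1 * expR (m * ln 2) / 3 / (1 - expR (m * ln 2) / 2)) * rho)%:E)%E.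
Proof.
set E := graph_disc y w0 rho.
have mE : measurable E by exact: measurable_graph_disc.
have G20 J p : (0 <= G 2 J p)%E by apply: G_ge0; lra.
have d0 J t : (0 <= avg (rad J.+1) (G 2 J) (t, y t))%E by exact: avg_ge0.
have md J : measurable_fun setT (fun t => avg (rad J.+1) (G 2 J) (t, y t)).
  exact: (measurableT_comp (measurable_avg (rad_gt0 J.+1) (measurable_G 2 J) (G20 J)) mg).
have e0 x : (0 <= (expR x)%:E :> \bar R)%E by rewrite lee_fin expR_ge0.
have mterm J : measurable_fun setT (fun t => (expR (C1 + m * ln 2 *+ J.+1))%:E * avg (rad J.+1) (G 2 J) (t, y t))%E.
  exact: measurable_funeM.
have term0 J t : (0 <= (expR (C1 + m * ln 2 *+ J.+1))%:E * avg (rad J.+1) (G 2 J) (t, y t))%E by rewrite mule_ge0.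
apply: (@le_trans _ _ (\int[mu]_(t in E) ((expR C1)%:E +
   \sum_(J < N) (expR (C1 + m * ln 2 *+ J.+1))%:E * avg (rad J.+1) (G 2 J) (t, y t)))%E).
  apply: ge0_le_integral => //.
  - by move=> t _; exact: expeR_ge0.
  - apply: measurable_funTS; apply: (measurableT_comp (@measurable_expeR R)).
    exact: (measurableT_comp (measurable_avgv N) mg).
  - apply: measurable_funTS; apply: emeasurable_funD => //.
    by apply: emeasurable_sum => J.
  by move=> t Et; exact: exp_telescope.
rewrite ge0_integralD //; last 2 first.
- by move=> t _; exact: sume_ge0.
- by apply: measurable_funTS; apply: emeasurable_sum.
rewrite integral_cst // mulrDl EFinD; apply: leeD.
  pose I : set R := `]w0.1 - rho, w0.1 + rho[%classic.
  have EI : (mu E <= mu I)%E.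
    apply: le_measure; rewrite ?inE //; first exact: measurable_itv.
    move=> t /= /(sqn_ltr_norm rho0) [+ _]; rewrite /I /= in_itv /= ltr_norml => /andP[h1 h2].
    by apply/andP; split; lra.
  have IE : mu I = (2 * rho)%:E.
    by rewrite leb_itv_oo; [congr EFin; ring|rewrite lerD2l ge0_cp // ltW].
  apply: (@le_trans _ _ ((expR C1)%:E * (2 * rho)%:E)%E).
    by apply: lee_wpmul2l => //; rewrite -IE.
  by rewrite -EFinM lee_fin le_eqVlt; apply/orP; left; apply/eqP; ring.
rewrite ge0_integral_sum //; last first.
  by move=> J; exact: measurable_funTS.
set q := expR (m * ln 2) / 2.
have ln20 : 0 < ln 2 :> R by rewrite ln_gt0 // ltr1n.
have q0 : 0 <= q by rewrite divr_ge0 // expR_ge0.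
have q1 : q < 1.
  rewrite ltr_pdivrMr // mul1r -[ltRHS](@lnK _ 2) ?posrE // ltr_expR.
  by rewrite gtr_pMl.
have termle J : (\int[mu]_(t in E) ((expR (C1 + m * ln 2 *+ J.+1))%:E * avg (rad J.+1) (G 2 J) (t, y t)) <=
    (C1 * expR C1 * expR (m * ln 2) / 3 * rho * q ^+ J)%:E)%E.
  rewrite ge0_integralZl_EFin ?expR_ge0 //; last exact: measurable_funTS.
  apply: (@le_trans _ _ ((expR (C1 + m * ln 2 *+ J.+1))%:E * ((2 / rad J.+1)%:E * (C1 * rad J ^+ 2 / 12)%:E))%E).
    apply: lee_wpmul2l => //.
    apply: (@le_trans _ _ (\int[mu]_t avg (rad J.+1) (G 2 J) (t, y t))%E).
      exact: ge0_subset_integral.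
    apply: le_trans (integral_avg_graph (rad_gt0 J.+1) my (measurable_G 2 J) (G20 J)) _.
    by apply: lee_wpmul2l; [rewrite lee_fin divr_ge0 // ltW|exact: integral_G2].
  rewrite -!EFinM lee_fin le_eqVlt; apply/orP; left; apply/eqP.
  rewrite expRD mulrS expRD -[m * ln 2 *+ J]mulr_natl expRM_natl /q /rad !expr_div_n exprS.
  have : (2 : R) ^+ J != 0 by rewrite expf_neq0.
  have : rho != 0 by rewrite gt_eqF.
  move: (2 ^+ J) (expR (m * ln 2)) (expR C1) => P x z r0' P0.
  move: (x ^+ J) => X; field.
  by rewrite r0' P0.
apply: (@le_trans _ _ (\sum_(J < N) (C1 * expR C1 * expR (m * ln 2) / 3 * rho * q ^+ J)%:E)%E).
  by apply: lee_sum => J _; exact: termle.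
rewrite sumEFin lee_fin -mulr_sumr.
have c0 : 0 <= C1 * expR C1 * expR (m * ln 2) / 3 * rho.
  by rewrite !mulr_ge0 ?expR_ge0 ?invr_ge0.
rewrite [leRHS]mulrAC; apply: ler_wpM2l => //.
rewrite -[leRHS]mul1r ler_pdivlMr ?subr_gt0 // mulrC.
have -> : (1 - q) * (\sum_(i < N) q ^+ i) = 1 - q ^+ N.
  by rewrite -[1 - q]opprB mulNr -subrX1 opprB.
by rewrite gerBl exprn_ge0.
Qed.

(** Lower semicontinuity makes [v] at most the lower limit of its averages over shrinking discs, and
    Fatou transfers the uniform bound on those averages. *)
Lemma local_exp_bound_aux :
  (\int[mu]_(t in graph_disc y w0 rho) expeR (v (t, y t)) <=
   ((2 * expR C1 + C1 * expR C1 * expR (m * ln 2) / 3 / (1 - expR (m * ln 2) / 2)) * rho)%:E)%E.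
Proof.
have mu_ n : measurable_fun (graph_disc y w0 rho) (fun t => expeR (avg (rad n) v (t, y t))).
  apply: measurable_funTS; apply: (measurableT_comp (@measurable_expeR R)).
  exact: (measurableT_comp (measurable_avgv n) mg).
apply: (@le_trans _ _ (\int[mu]_(t in graph_disc y w0 rho) limn_einf (fun n => expeR (avg (rad n) v (t, y t))))%E).
  apply: ge0_le_integral => //; first exact: measurable_graph_disc.
  - by move=> t _; exact: expeR_ge0.
  - apply: measurable_funTS; apply: (measurableT_comp (@measurable_expeR R)).
    exact: (measurableT_comp mv mg).
  - rewrite /limn_einf; apply: measurableT_comp => //.
    apply: measurable_fun_limn_esup => // n.
    by apply: measurableT_comp.
  move=> t Et; apply: lee_real_lt => c; have [c0 _|c0] := leP c 0.
    apply: (@limn_einf_ge _ _ _ 0) => n _.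
    by apply: le_trans (expeR_ge0 _); rewrite lee_fin.
  rewrite -[c](@lnK R) ?posrE // -[((expR _)%:E)]/(expeR (ln c)%:E) lte_expeR => /(vlsc Et)[d d0 hd].
  (* As [2 ^ n > n], every radius [rad n] with [n >= N] is at most [d]. *)
  pose N := Num.bound (rho / d).
  apply: (@limn_einf_ge _ _ _ N) => n Nn; rewrite lee_expeR.
  apply: avg_ge_cst => // p hp; apply: hd; apply: lt_sqr_trans hp; first exact: ltW.
  rewrite /rad ler_pdivrMr ?exprn_gt0 // mulrC -ler_pdivrMr //.
  apply: le_trans (ltW (archi_boundP _)) _; first by rewrite divr_ge0 // ltW.
  by rewrite -natrX ler_nat (leq_trans Nn) // ltnW // ltn_expl.
apply: le_trans (fatou _ _ mu_ _) _; first exact: measurable_graph_disc.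
  by move=> n t _; exact: expeR_ge0.
by apply: limn_einf_le => n; exact: exp_avg_integral.
Qed.

End local_exp_bound.

(** * Maximum principle and three circles *)

Section log_expansion.
Context {R : realType}.
Implicit Types (p q z : R * R).

(** The difference of the two sides has derivative [t ^ 3 / (1 + t)], of the sign of [t], so its
    minimum is its value [0] at the origin. *)
Lemma ln1D_le3 (x : R) : -1 < x -> ln (1 + x) <= x - x ^+ 2 / 2 + x ^+ 3 / 3.
Proof.
move=> x1.
pose f (t : R) := t - t ^+ 2 / 2 + t ^+ 3 / 3 - ln (1 + t).
have df (t : R) : -1 < t -> is_derive t (1 : R) f (t ^+ 3 / (1 + t)).
  move=> t1; have t0 : 0 < 1 + t by lra.
  rewrite /f.
  have dl : is_derive t (1 : R) (fun t => ln (1 + t)) ((1 + t)^-1).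
    have := @is_derive1_comp R (@ln R) (fun t => 1 + t) t ((1 + t)^-1) 1.
    rewrite mulr1; apply; first exact: is_derive1_ln.
    by rewrite -[X in is_derive _ _ _ X]add0r; apply: is_deriveD.
  apply: is_derive_eq.
  rewrite !scaler1 /GRing.scale /=; field.
  by rewrite gt_eqF.
suff : 0 <= f x by rewrite /f; lra.
have f0 : f 0 = 0 by rewrite /f !expr0n /= addr0 ln1 !mul0r !subr0 addr0.
have cf (t : R) : -1 < t -> {for t, continuous f}.
  by move=> /df [d _]; exact/differentiable_continuous/derivable1_diffP.
rewrite -f0; clearbody f; have [x0|x0] := leP 0 x.
  apply: (@ger0_derive1_ndecr _ f 0 x) => //.
  - by move=> t; rewrite in_itv /= => /andP[t0 _]; have [] := df t ltac:(lra).
  - move=> t; rewrite in_itv /= => /andP[t0 _]; rewrite derive1E; have [_ ->] := df t ltac:(lra).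
    by rewrite divr_ge0 ?exprn_ge0 ?addr_ge0 // ltW.
  - apply: continuous_in_subspaceT => t; rewrite inE /= in_itv /= => /andP[t0 _]; apply: cf; lra.
apply: (@ler0_derive1_nincr _ f x 0) => //; last exact: ltW.
- by move=> t; rewrite in_itv /= => /andP[t0 _]; have [] := df t ltac:(lra).
- move=> t; rewrite in_itv /= => /andP[t0 t1]; rewrite derive1E; have [_ ->] := df t ltac:(lra).
  rewrite ler_pdivrMr ?mul0r; last lra.
  by rewrite exprS mulr_le0_ge0 ?sqr_ge0 // ltW.
- apply: continuous_in_subspaceT => t; rewrite inE /= in_itv /= => /andP[t0 _]; apply: cf; lra.
Qed.

(** [h] is dominated near [q], along circles, by a second-order expansion of Laplacian [2 * T]. *)
Definition quad_bound (h : R * R -> R) q (T : R) : Prop :=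
  exists a b A B C K r0 : R, [/\ 0 < r0, 0 <= K, A + C = T &
    forall rho c s : R, 0 < rho -> rho < r0 -> c ^+ 2 + s ^+ 2 = 1 ->
      h (q.1 + rho * c, q.2 + rho * s) <=
      h q + rho * (a * c + b * s) + rho ^+ 2 * (A * c ^+ 2 + B * (c * s) + C * s ^+ 2) + K * rho ^+ 3].

Lemma quad_bound_cst (k : R) q : quad_bound (fun=> k) q 0.
Proof.
exists 0, 0, 0, 0, 0, 0, 1; split; rewrite ?addr0 // => rho c s _ _ _.
by rewrite !mul0r !addr0 !mulr0 !addr0.
Qed.

Lemma quad_bound_add f g q S T : quad_bound f q S -> quad_bound g q T ->
  quad_bound (fun p => f p + g p) q (S + T).
Proof.
move=> [a [b [A [B [C [K [r [r0 K0 AC hf]]]]]]]] [a' [b' [A' [B' [C' [K' [r' [r0' K0' AC' hg]]]]]]]].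
exists (a + a'), (b + b'), (A + A'), (B + B'), (C + C'), (K + K'), (Num.min r r'); split.
- by rewrite lt_min r0.
- exact: addr_ge0.
- by rewrite -AC -AC' addrACA.
move=> rho c s h0; rewrite lt_min => /andP[h1 h2] cs.
have := lerD (hf rho c s h0 h1 cs) (hg rho c s h0 h2 cs) => /le_trans; apply.
by rewrite le_eqVlt; apply/orP; left; apply/eqP; ring.
Qed.

Lemma quad_bound_scale (k : R) f q T : 0 <= k -> quad_bound f q T ->
  quad_bound (fun p => k * f p) q (k * T).
Proof.
move=> k0 [a [b [A [B [C [K [r [r0 K0 AC hf]]]]]]]].
exists (k * a), (k * b), (k * A), (k * B), (k * C), (k * K), r; split => //.
- exact: mulr_ge0.
- by rewrite -AC mulrDr.
move=> rho c s h0 h1 cs; have := ler_wpM2l k0 (hf rho c s h0 h1 cs) => /le_trans; apply.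
by rewrite le_eqVlt; apply/orP; left; apply/eqP; ring.
Qed.

Lemma quad_bound_oppsqn (e : R) z q : quad_bound (fun p => - e * sqn (psub p z)) q (- 2 * e).
Proof.
exists (- 2 * e * (q.1 - z.1)), (- 2 * e * (q.2 - z.2)), (- e), 0, (- e), 0, 1; split => //.
  by ring.
by move=> rho c s _ _ _; rewrite le_eqVlt; apply/orP; left; apply/eqP; rewrite /sqn /=; ring.
Qed.

Definition logdist (p q : R * R) : R := ln (sqn (psub p q)) / 2.

Lemma quad_bound_logdist z q : 0 < sqn (psub q z) -> quad_bound (logdist^~ z) q 0.
Proof.
set u := q.1 - z.1; set w := q.2 - z.2; set D := sqn _ => D0.
have DE : D = u ^+ 2 + w ^+ 2 by [].
have Esq rho c s : sqn (psub (q.1 + rho * c, q.2 + rho * s) z) =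
    D + 2 * rho * (u * c + w * s) + rho ^+ 2 * (c ^+ 2 + s ^+ 2).
  by rewrite DE /sqn /= /u /w; ring.
have ED : logdist q z = ln D / 2 by [].
clearbody u w D.
have [U UE] : exists U : R, U = `|u| + `|w| by eexists.
have [V VE] : exists V : R, V = (2 * U + 1) / D by eexists.
have U0 : 0 <= U by rewrite UE addr_ge0.
have V0 : 0 < V by rewrite VE divr_gt0 // ltr_wpDl // mulr_ge0.
(* Gradient and half Hessian of the logarithm at [q]; harmonicity is the vanishing trace. With [x]
   the relative change of the squared distance, [U / D ^ 2] absorbs the cubic part of the term in
   [x ^ 2], and [V ^ 3 / 6] the term in [x ^ 3], as [|x| <= rho * V]. The radius [1 / V] keeps
   [|x| < 1]. *)
exists (u / D), (w / D), (1 / (2 * D) - u ^+ 2 / D ^+ 2), (- 2 * u * w / D ^+ 2),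
  (1 / (2 * D) - w ^+ 2 / D ^+ 2), (U / D ^+ 2 + V ^+ 3 / 6), (Num.min 1 (V^-1)); split.
- by rewrite lt_min ltr01 invr_gt0.
- by rewrite addr_ge0 // divr_ge0 // ?exprn_ge0 // ltW.
- transitivity (1 / D - (u ^+ 2 + w ^+ 2) / D ^+ 2); first by field; rewrite gt_eqF.
  by rewrite -DE; field; rewrite gt_eqF.
move=> rho c s rho0; rewrite lt_min => /andP[rho1 rhoV] cs.
pose g := u * c + w * s; pose x := (2 * rho * g + rho ^+ 2) / D.
have c1 : `|c| <= 1 by rewrite -(ler_pXn2r (n := 2)) ?nnegrE // expr1n real_normK ?num_real //; have := sqr_ge0 s; lra.
have s1 : `|s| <= 1 by rewrite -(ler_pXn2r (n := 2)) ?nnegrE // expr1n real_normK ?num_real //; have := sqr_ge0 c; lra.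
have gU : `|g| <= U.
  by rewrite (le_trans (ler_normD _ _)) // !normrM UE lerD // ler_piMr.
have xV : `|x| <= rho * V.
  rewrite /x VE normrM normfV (gtr0_norm D0) mulrA ler_pM2r ?invr_gt0 //.
  apply: le_trans (ler_normD _ _) _.
  rewrite (ger0_norm (sqr_ge0 rho)) !normrM (gtr0_norm rho0) (ger0_norm (ler0n _ 2)).
  have h1 : rho * `|g| <= rho * U by rewrite ler_pM2l.
  have h2 : rho ^+ 2 <= rho by rewrite expr2 ger_pMl // ltW.
  rewrite mulrDr mulr1; lra.
have rhoV1 : rho * V < 1 by rewrite -ltr_pdivlMr // div1r.
have x1 : -1 < x by move: (le_lt_trans xV rhoV1); rewrite ltr_norml => /andP[].
have E : sqn (psub (q.1 + rho * c, q.2 + rho * s) z) = D * (1 + x).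
  by rewrite Esq cs mulr1 -/g /x; field; rewrite gt_eqF.
have x10 : 0 < 1 + x by lra.
rewrite ED /logdist E lnM ?posrE // mulrDl -!addrA lerD2l.
have x3 : x ^+ 3 <= rho ^+ 3 * V ^+ 3.
  rewrite -exprMn; apply: le_trans (ler_norm _) _; rewrite normrX.
  by rewrite ler_pXn2r // nnegrE ?mulr_ge0 // ltW.
have g2 : - (4 * rho ^+ 3 * g + rho ^+ 4) / (4 * D ^+ 2) <= rho ^+ 3 * (U / D ^+ 2).
  rewrite ler_pdivrMr ?mulr_gt0 ?exprn_gt0 //.
  rewrite (_ : rho ^+ 3 * (U / D ^+ 2) * (4 * D ^+ 2) = 4 * rho ^+ 3 * U); last by field; rewrite gt_eqF.
  have : - (rho ^+ 3 * g) <= rho ^+ 3 * U.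
    rewrite -mulrN ler_pM2l ?exprn_gt0 //; apply: le_trans gU; rewrite -normrN; exact: ler_norm.
  have : 0 <= rho ^+ 4 by rewrite exprn_ge0 // ltW.
  lra.
have := ln1D_le3 x1.
have -> : x - x ^+ 2 / 2 = 2 * (rho * (u / D * c + w / D * s) + rho ^+ 2 * ((1 / (2 * D) - u ^+ 2 / D ^+ 2) * c ^+ 2 +
    - 2 * u * w / D ^+ 2 * (c * s) + (1 / (2 * D) - w ^+ 2 / D ^+ 2) * s ^+ 2)) + 2 * (- (4 * rho ^+ 3 * g + rho ^+ 4) / (4 * D ^+ 2)).
  (* Inserting powers of [c ^ 2 + s ^ 2 = 1] gives each term the same degree in [rho] as in the pair
     of [c] and [s]; the identity then holds formally and [field] proves it. *)
  rewrite /x [in LHS](_ : 2 * rho * g + rho ^+ 2 = 2 * rho * g + rho ^+ 2 * (c ^+ 2 + s ^+ 2)); last by rewrite cs mulr1.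
  rewrite [in RHS](_ : rho ^+ 4 = rho ^+ 4 * (c ^+ 2 + s ^+ 2) ^+ 2); last by rewrite cs expr1n mulr1.
  rewrite [in RHS](_ : 4 * rho ^+ 3 * g = 4 * rho ^+ 3 * g * (c ^+ 2 + s ^+ 2)); last by rewrite cs mulr1.
  by rewrite /g; field; rewrite gt_eqF.
lra.
Qed.

End log_expansion.

Section trig_integral.
Context {R : realType}.

Lemma integral_trig (a0 a b A B C : R) :
  (\int[@lebesgue_measure R]_(x in `[0%R, (2 * pi)%R])
    (a0 + a * cos x + b * sin x + A * cos x ^+ 2 + B * (cos x * sin x) + C * sin x ^+ 2)%:E
   = (2 * pi * (a0 + (A + C) / 2))%:E)%E.
Proof.
pose F (x : R) := a0 * x + a * sin x - b * cos x + A * ((x + sin x * cos x) / 2) + B * (sin x ^+ 2 / 2)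
   + C * ((x - sin x * cos x) / 2).
have pi0 : 0 < 2 * pi :> R by rewrite mulr_gt0 // pi_gt0.
have dF (x : R) : is_derive x (1 : R) F (a0 + a * cos x + b * sin x + A * cos x ^+ 2 + B * (cos x * sin x) + C * sin x ^+ 2).
  rewrite /F; apply: is_derive_eq.
  rewrite !scaler1 /= /GRing.scale /=.
  have := cos2Dsin2 x; move: (cos x) (sin x) => c s cs.
  (* The derivative of [F] equals the integrand only modulo [c ^ 2 + s ^ 2 = 1]; the multiples of
     that relation are supplied by hand. *)
  have -> : C * s ^+ 2 = C * s ^+ 2 - C * (c ^+ 2 + s ^+ 2 - 1) / 2.
    by rewrite cs; ring.
  have -> : A * c ^+ 2 = A * c ^+ 2 - A * (c ^+ 2 + s ^+ 2 - 1) / 2 by rewrite cs; ring.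
  by field.
have cF : continuous F.
  by move=> x; have [d _] := dF x; exact/differentiable_continuous/derivable1_diffP.
rewrite (@continuous_FTC2 _ _ F) //.
- rewrite /F mulr_natl cos2pi sin2pi cos0 sin0 -EFinB; congr EFin; rewrite -mulr_natl; ring.
- apply: continuous_subspaceT => x.
  by apply/differentiable_continuous/derivable1_diffP; exact: ex_derive.
- split; first by move=> x _; have [] := dF x.
  - by apply: cvg_at_right_filter; exact: cF.
  - by apply: cvg_at_left_filter; exact: cF.
- by move=> x _; rewrite derive1E; have [_ ->] := dF x.
Qed.
End trig_integral.

Section lower_continuity.
Context {R : realType}.
Implicit Types (p q z : R * R).

Definition lsc_at (h : R * R -> R) q : Prop := forall e : R, 0 < e ->
  exists2 d : R, 0 < d & forall q', sqn (psub q' q) < d ^+ 2 -> h q - e < h q'.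

Lemma lsc_at_cst (k : R) q : lsc_at (fun=> k) q.
Proof. by move=> e e0; exists 1 => // q' _; rewrite ltrBlDr ltrDl. Qed.

Lemma lsc_at_add f g q : lsc_at f q -> lsc_at g q -> lsc_at (fun p => f p + g p) q.
Proof.
move=> hf hg e e0; have e2 : 0 < e / 2 by rewrite divr_gt0.
have [d d0 fd] := hf _ e2; have [d' d0' gd] := hg _ e2.
exists (Num.min d d') => [|q' h]; first by rewrite lt_min d0.
have m0 : 0 <= Num.min d d' by rewrite le_min !ltW.
have h1 : sqn (psub q' q) < d ^+ 2 by apply: lt_sqr_trans h; rewrite // ge_min lexx.
have h2 : sqn (psub q' q) < d' ^+ 2 by apply: lt_sqr_trans h; rewrite // ge_min lexx orbT.
have := fd _ h1; have := gd _ h2; lra.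
Qed.

Lemma lsc_at_scale (k : R) f q : 0 <= k -> lsc_at f q -> lsc_at (fun p => k * f p) q.
Proof.
rewrite le_eqVlt => /predU1P[<- _|k0 hf] e e0.
  by exists 1 => // q' _; rewrite !mul0r sub0r oppr_lt0.
have [d d0 fd] := hf (e / k) ltac:(by rewrite divr_gt0).
exists d => // q' /fd; rewrite -(ltr_pM2l k0) mulrBr mulrCA mulfV ?mulr1 // gt_eqF //.
Qed.

Lemma sqn_shift q' q z : sqn (psub q' z) = sqn (psub q z)
  + 2 * ((q.1 - z.1) * (q'.1 - q.1) + (q.2 - z.2) * (q'.2 - q.2)) + sqn (psub q' q).
Proof. by rewrite /sqn /=; ring. Qed.

Lemma sqn_shift_le q' q z (d : R) : 0 < d -> sqn (psub q' q) < d ^+ 2 ->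
  `|(q.1 - z.1) * (q'.1 - q.1) + (q.2 - z.2) * (q'.2 - q.2)| <= (`|q.1 - z.1| + `|q.2 - z.2|) * d.
Proof.
move=> d0 /(sqn_ltr_norm d0)[/= h1 h2].
rewrite [leRHS]mulrDl; apply: le_trans (ler_normD _ _) _; rewrite !normrM.
by apply: lerD; apply: ler_wpM2l => //; exact: ltW.
Qed.

Lemma lsc_at_oppsqn (k : R) z q : 0 <= k -> lsc_at (fun p => - k * sqn (psub p z)) q.
Proof.
move=> k0; have : lsc_at (fun p => - sqn (psub p z)) q; last first.
  by move=> /(lsc_at_scale k0) h e /h [d d0 hd]; exists d => // q' /hd; rewrite !mulNr !mulrN.
move=> e e0.
have [U UE] : exists U : R, U = `|q.1 - z.1| + `|q.2 - z.2| by eexists.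
have U0 : 0 <= U by rewrite UE addr_ge0.
exists (Num.min 1 (e / (2 * U + 2))).
  by rewrite lt_min ltr01 divr_gt0 // ltr_wpDl // mulr_ge0.
set d := Num.min _ _ => q' h.
have d0 : 0 < d by rewrite /d lt_min ltr01 divr_gt0 // ltr_wpDl // mulr_ge0.
have d1 : d <= 1 by rewrite ge_min lexx.
have de : d * (2 * U + 2) <= e.
  by rewrite -ler_pdivlMr ?ltr_wpDl ?mulr_ge0 // /d ge_min lexx orbT.
have := sqn_shift_le z d0 h; rewrite -UE ler_norml => /andP[h1 h2].
rewrite (sqn_shift q' q z); move: h h1 h2; move: (_ + _ : R) (sqn (psub q' q)) => X Y h h1 h2.
have : d ^+ 2 <= d by rewrite expr2 ger_pMl.
clearbody d; nra.
Qed.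

Lemma lsc_at_logdist z q : 0 < sqn (psub q z) -> lsc_at (logdist^~ z) q.
Proof.
move=> D0 e e0.
have [U UE] : exists U : R, U = `|q.1 - z.1| + `|q.2 - z.2| by eexists.
have U0 : 0 <= U by rewrite UE addr_ge0.
have c1 : 0 < 1 - expR (- (2 * e)) by rewrite subr_gt0 -expR0 ltr_expR oppr_lt0 mulr_gt0.
(* Chosen so that the squared distance to [z] shrinks at worst by the factor [expR (- (2 * e))],
   that is, so that half its logarithm drops by at most [e]. *)
have [d [d0 dE]] : exists d : R, 0 < d /\ d * (2 * U + 1) = sqn (psub q z) * (1 - expR (- (2 * e))).
  exists (sqn (psub q z) * (1 - expR (- (2 * e))) / (2 * U + 1)); split.
    by rewrite !divr_gt0 ?mulr_gt0 // ltr_wpDl // mulr_ge0.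
  by rewrite mulfVK // gt_eqF // ltr_wpDl // mulr_ge0.
exists d => // q' h.
have := sqn_shift_le z d0 h; rewrite -UE ler_norml => /andP[h1 _].
have h2 : sqn (psub q z) * expR (- (2 * e)) < sqn (psub q' z).
  rewrite (sqn_shift q' q z); have := sqn_ge0 (psub q' q).
  move: h1; move: (_ + _ : R) (sqn (psub q' q)) => X Y h1 Y0; nra.
have h3 : 0 < sqn (psub q' z) by apply: lt_trans h2; rewrite mulr_gt0 // expR_gt0.
rewrite /logdist ltrBlDr -ltrBlDl.
have : ln (sqn (psub q z)) - 2 * e < ln (sqn (psub q' z)).
  by rewrite -[X in _ - X]opprK -(expRK (- (2 * e))) opprK -lnM ?posrE ?expR_gt0 // ltr_ln ?posrE ?mulr_gt0 ?expR_gt0.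
lra.
Qed.

End lower_continuity.

Section usc_maximum.
Context {R : realType}.
Implicit Types (p q z : R * R).

Lemma nbhs_sqn q (d : R) : 0 < d -> \forall q' \near q, sqn (psub q' q) < d ^+ 2.
Proof.
move=> d0; apply/nbhs_ballP; exists (d / 2) => /=; first exact: divr_gt0.
move=> q' [] /=; rewrite /ball /= => h1 h2.
have n x : `|x| < d / 2 -> x ^+ 2 < (d / 2) ^+ 2.
  by move=> hx; rewrite -[ltLHS]real_normK ?num_real // ltr_pXn2r // nnegrE // ltW // divr_gt0.
rewrite /sqn /=; have := n _ h1; have := n _ h2; rewrite (_ : (d / 2) ^+ 2 = d ^+ 2 / 4); last by field.
rewrite -(sqrrN (q'.1 - _)) opprB -(sqrrN (q'.2 - _)) opprB.
have := exprn_gt0 2 d0; lra.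
Qed.

(** If the supremum were not attained, the relatively open sets where [f] is below levels [c n]
    approaching it would cover [K]; by compactness one level bounds [f] on all of [K], although it
    lies below the supremum. *)
Lemma usc_attains_max (K : set (R * R)) (f : R * R -> \bar R) : compact K -> K !=set0 ->
  (forall q (c : R), K q -> (f q < c%:E)%E -> exists2 d : R, 0 < d &
     forall q', K q' -> sqn (psub q' q) < d ^+ 2 -> (f q' < c%:E)%E) ->
  exists2 q, K q & forall q', K q' -> (f q' <= f q)%E.
Proof.
move=> cK [q0 Kq0] uscf; apply: contrapT => nomax.
pose S := ereal_sup (f @` K).
have fS q : K q -> (f q < S)%E.
  move=> Kq; rewrite lt_neqAle; apply/andP; split; last by apply: ereal_sup_ubound; exists q.
  apply/eqP => fqS; apply: nomax; exists q => // q' Kq'; rewrite fqS.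
  by apply: ereal_sup_ubound; exists q'.
have [c [cS cn]] : exists c : nat -> \bar R, (forall n, (c n < S)%E) /\
    forall x : R, (x%:E < S)%E -> \forall n \near \oo, (x%:E < c n)%E.
  have := fS _ Kq0; case: S fS => [s| |] fS _.
  - exists (fun n => (s - n.+1%:R^-1)%:E); split=> [n|x].
      by rewrite lte_fin ltrBlDr ltrDl invr_gt0.
    rewrite lte_fin => xs; have [n /= h] := ltr_add_invr xs.
    exists n => // m /= nm; rewrite lte_fin ltrBrDr; apply: le_lt_trans h.
    by rewrite lerD2l lef_pV2 ?posrE // ler_nat.
  - exists (fun n => n%:R%:E); split=> [n|x _]; first exact: ltry.
    exists (Num.bound `|x|) => // m /= h; rewrite lte_fin.
    apply: le_lt_trans (ler_norm _) (lt_le_trans (archi_boundP (normr_ge0 _)) _).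
    by rewrite ler_nat.
  - by have := fS _ Kq0; rewrite ltNge leNye.
have /compact_near_coveringP/(_ nat \oo (fun n q => K q -> (f q < c n)%E)) := cK.
case=> [q Kq|N _ hN].
  have [x fx xS] : exists2 x : R, (f q < x%:E)%E & (x%:E < S)%E.
    have := fS q Kq; case: (f q) => [a| |]; case: S {fS cS cn} => [s| |] //; rewrite ?lte_fin => h.
    - by exists ((a + s) / 2); rewrite lte_fin; lra.
    - by exists (a + 1); rewrite ?ltry // lte_fin ltrDl.
    - by exists (s - 1); rewrite ?ltNyr // lte_fin; lra.
    - by exists 0; rewrite ?ltNyr ?ltry.
  have [d d0 hd] := uscf q x Kq fx.
  exists ([set q' | sqn (psub q' q) < d ^+ 2], [set n | (x%:E < c n)%E]).
    by split; [exact: nbhs_sqn|exact: cn].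
  by move=> [q' n] /= [h1 h2] Kq'; apply: lt_trans h2; exact: hd.
have := cS N; rewrite ltNge => /negP; apply; apply: ge_ereal_sup => _ [q Kq <-].
by apply: ltW; exact: (hN N (leqnn N) q Kq Kq).
Qed.

Lemma sqn_continuous z : continuous (fun q => sqn (psub q z)).
Proof.
move=> q; rewrite /sqn /=.
have c1 : (fun q : R * R => q.1 - z.1) x @[x --> q] --> q.1 - z.1 by apply: cvgB; [exact: cvg_fst|exact: cvg_cst].
have c2 : (fun q : R * R => q.2 - z.2) x @[x --> q] --> q.2 - z.2 by apply: cvgB; [exact: cvg_snd|exact: cvg_cst].
have -> : (fun q : R * R => (q.1 - z.1) ^+ 2 + (q.2 - z.2) ^+ 2) =
  (fun q => (q.1 - z.1) * (q.1 - z.1) + (q.2 - z.2) * (q.2 - z.2)) by apply/funext => p; rewrite !expr2.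
by apply: cvgD; apply: cvgM.
Qed.

Lemma compact_annulus z (r s : R) : compact [set q | r <= sqn (psub q z) <= s ^+ 2].
Proof.
apply: (@subclosed_compact _ _ (`[z.1 - `|s|, z.1 + `|s|] `*` `[z.2 - `|s|, z.2 + `|s|])).
- have := @closed_comp _ _ _ `[r, s ^+ 2]%classic (fun q _ => @sqn_continuous z q) (@itv_closed _ R r (s ^+ 2)).
  by congr closed; apply/seteqP; split => q /=; rewrite in_itv.
- by apply: compact_setX; exact: segment_compact.
move=> q /= /andP[_ h].
have n x : x ^+ 2 <= s ^+ 2 -> `|x| <= `|s|.
  by move=> hx; rewrite -(ler_pXn2r (n := 2)) ?nnegrE // !real_normK ?num_real.
move: h; rewrite /sqn /= => h.
have h1 : `|q.1 - z.1| <= `|s| by apply: n; have := sqr_ge0 (q.2 - z.2); lra.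
have h2 : `|q.2 - z.2| <= `|s| by apply: n; have := sqr_ge0 (q.1 - z.1); lra.
move: h1 h2; rewrite !ler_norml => /andP[? ?] /andP[? ?].
by split; rewrite in_itv /=; apply/andP; split; lra.
Qed.

Lemma near_sqnP q (P : R * R -> Prop) : (\forall q' \near q, P q') ->
  exists2 d : R, 0 < d & forall q', sqn (psub q' q) < d ^+ 2 -> P q'.
Proof.
move=> /nbhs_ballP[d /= d0 hd]; exists d => // q' /(sqn_ltr_norm d0)[/= h1 h2].
by apply: hd; split; rewrite /ball /= distrC.
Qed.

End usc_maximum.

(** * Subharmonic functions on the plane and the maximum principle *)

Section subharmonic_plane.
Context {R : realType}.
Implicit Types (p q z : R * R).

(** The notion [subharmonic] transported to [R * R], where the planar measure and Tonelli are
    available. *)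
Definition subharmonic_plane (Phi : R * R -> \bar R) : Prop := [/\
  forall p, Phi p != +oo%E,
  forall z (c : R), (Phi z < c%:E)%E -> exists2 d : R, 0 < d &
     forall w, sqn (psub w z) < d ^+ 2 -> (Phi w < c%:E)%E,
  exists p, Phi p != -oo%E &
  forall z (r : R), 0 < r -> (Phi z <= ((2 * pi)^-1 : R)%:E *
    \int[@lebesgue_measure R]_(x in `[0%R, (2 * pi)%R]) Phi (z.1 + r * cos x, z.2 + r * sin x)%R)%E].

Variables (Phi : R * R -> \bar R) (PhiP : subharmonic_plane Phi).

Let Phiy p : Phi p != +oo%E. Proof. by case: PhiP. Qed.
Let Phiu z (c : R) : (Phi z < c%:E)%E -> exists2 d : R, 0 < d &
  forall w, sqn (psub w z) < d ^+ 2 -> (Phi w < c%:E)%E.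
Proof. by case: PhiP => _ h _ _; exact: h. Qed.
Let Phim z (r : R) : 0 < r -> (Phi z <= ((2 * pi)^-1 : R)%:E *
    \int[@lebesgue_measure R]_(x in `[0%R, (2 * pi)%R]) Phi (z.1 + r * cos x, z.2 + r * sin x)%R)%E.
Proof. by case: PhiP => _ _ _ h; exact: h. Qed.
Let pi20 : 0 < 2 * pi :> R. Proof. by rewrite mulr_gt0 // pi_gt0. Qed.

Lemma sqn_norm_lt p (d : R) : `|p.1| < d / 2 -> `|p.2| < d / 2 -> sqn p < d ^+ 2.
Proof.
move=> h1 h2; have d0 : 0 < d / 2 by apply: le_lt_trans h1.
have n x : `|x| < d / 2 -> x ^+ 2 < (d / 2) ^+ 2.
  by move=> hx; rewrite -[ltLHS]real_normK ?num_real // ltr_pXn2r // nnegrE // ltW.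
rewrite /sqn; have := n _ h1; have := n _ h2; rewrite (_ : (d / 2) ^+ 2 = d ^+ 2 / 4); last by field.
have : 0 < d ^+ 2 by rewrite exprn_gt0 //; lra.
lra.
Qed.

Lemma measurable_subharmonic_plane : measurable_fun setT Phi.
Proof.
apply: measurable_plane_usc => p c /Phiu[d d0 h].
by exists (d / 2); rewrite ?divr_gt0 // => q h1 h2; apply: h; exact: sqn_norm_lt.
Qed.

Lemma measurable_subharmonic_circle z (r : R) :
  measurable_fun setT (fun x : R => Phi (z.1 + r * cos x, z.2 + r * sin x)).
Proof.
have := measurable_circle z r 0 measurable_subharmonic_plane.
by apply: eq_measurable_fun => x _; rewrite addr0.
Qed.

Lemma le_circle_integral z (r : R) (T : R -> R) : measurable_fun setT T ->
  (forall x : R, (Phi (z.1 + r * cos x, z.2 + r * sin x)%R <= (T x)%:E)%E) ->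
  (\int[@lebesgue_measure R]_(x in `[0%R, (2 * pi)%R]) Phi (z.1 + r * cos x, z.2 + r * sin x)%R <=
   \int[@lebesgue_measure R]_(x in `[0%R, (2 * pi)%R]) (T x)%:E)%E.
Proof.
move=> mT h; have mf := measurable_subharmonic_circle z r.
have mg : measurable_fun setT (fun x => (T x)%:E) by apply/measurable_EFinP.
rewrite integralE [leRHS]integralE; apply: leeB.
  apply: ge0_le_integral => //.
  - by apply: measurable_funepos; apply: measurable_funTS.
  - by apply: measurable_funepos; apply: measurable_funTS.
  - by move=> x _; rewrite !funeposE ge_max !le_max h lexx orbT.
apply: ge0_le_integral => //.
- by apply: measurable_funeneg; apply: measurable_funTS.
- by apply: measurable_funeneg; apply: measurable_funTS.
- by move=> x _; rewrite !funenegE ge_max !le_max leeN2 h lexx orbT.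
Qed.

(** In the mean over a circle only the constant and half the trace of a trigonometric majorant
    survive. *)
Lemma le_trig_mean z (r a0 a b A B C : R) : 0 < r ->
  (forall c s : R, c ^+ 2 + s ^+ 2 = 1 -> (Phi (z.1 + r * c, z.2 + r * s)%R <=
     (a0 + a * c + b * s + A * c ^+ 2 + B * (c * s) + C * s ^+ 2)%:E)%E) ->
  (Phi z <= (a0 + (A + C) / 2)%:E)%E.
Proof.
move=> r0 h; apply: le_trans (Phim z r0) _.
rewrite muleC -lee_pdivlMr ?invr_gt0 // invrK.
apply: le_trans (@le_circle_integral z r (fun x => a0 + a * cos x + b * sin x + A * cos x ^+ 2 + B * (cos x * sin x) + C * sin x ^+ 2) _ _) _.
- have mc := @measurable_cos R; have ms := @measurable_sin R.
  repeat first [apply: measurable_funD|apply: measurable_funM|apply: measurable_funX|exact: mc|exact: ms|exact: measurable_cst].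
- by move=> x; apply: h; exact: cos2Dsin2.
- by rewrite integral_trig -EFinM mulrC lexx.
Qed.

(** A local maximum of [Phi - h] at [q] would transfer the second-order bound of [h] to [Phi]; the
    mean over a circle of radius [rho] then forces [0 <= K * rho ^ 3 + rho ^ 2 * T / 2], which fails
    for small [rho] as [T < 0]. *)
Lemma no_interior_max (h : R * R -> R) q (T d x0 : R) : quad_bound h q T -> T < 0 -> 0 < d ->
  Phi q = x0%:E ->
  (forall q', sqn (psub q' q) < d ^+ 2 -> (Phi q' <= (h q' - h q + x0)%:E)%E) -> False.
Proof.
move=> [a [b [A [B [C [K [r0 [r00 K0 AC hq]]]]]]]] T0 d0 E hmax.
have [rho [rho0 [rhor rhod rhoK]]] : exists rho : R, 0 < rho /\ [/\ rho < r0, rho < d & rho * (4 * (K + 1)) <= - T].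
  (* The last entry ensures [K * rho <= - T / 4], so that the quadratic term wins over the cubic
     one. *)
  exists (Num.min (r0 / 2) (Num.min (d / 2) (- T / (4 * (K + 1))))).
  have K1 : 0 < 4 * (K + 1) by lra.
  split; first by rewrite !lt_min !divr_gt0 //; lra.
  split; rewrite ?gt_min -?ler_pdivlMr // ?ge_min ?lexx ?orbT //; apply/orP.
    by left; lra.
  by right; apply/orP; left; lra.
have : forall c s : R, c ^+ 2 + s ^+ 2 = 1 ->
    (Phi (q.1 + rho * c, q.2 + rho * s)%R <= (x0 + K * rho ^+ 3 + rho * a * c + rho * b * s + rho ^+ 2 * A * c ^+ 2 +
         rho ^+ 2 * B * (c * s) + rho ^+ 2 * C * s ^+ 2)%:E)%E.
  move=> c s cs; apply: le_trans (hmax _ _) _.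
    rewrite (_ : sqn _ = rho ^+ 2 * (c ^+ 2 + s ^+ 2)); last by rewrite /sqn /=; ring.
    by rewrite cs mulr1 ltr_pXn2r // nnegrE ltW.
  by rewrite lee_fin; have := hq rho c s rho0 rhor cs; lra.
move=> hh; have := @le_trig_mean q rho (x0 + K * rho ^+ 3) (rho * a) (rho * b) (rho ^+ 2 * A) (rho ^+ 2 * B) (rho ^+ 2 * C) rho0 hh.
rewrite E lee_fin -mulrDr AC => h1.
have : 0 <= rho ^+ 2 * (K * rho + T / 2).
  by rewrite (_ : _ * _ = K * rho ^+ 3 + rho ^+ 2 * T / 2); [lra|field].
rewrite pmulr_rge0 ?exprn_gt0 //; nra.
Qed.

(** The region is an annulus about [z] with a disc about the pole [z0] of [h] removed; [r], [s2] and
    [eta] are squared radii, so a negative [r] or [eta] removes nothing. [Phi - h] attains its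
    maximum there, and a positive maximum is excluded on the boundary by assumption and inside by
    [no_interior_max]. *)
Lemma max_principle z z0 (r s2 eta : R) (h : R * R -> R) :
  (forall q, r <= sqn (psub q z) <= s2 -> eta <= sqn (psub q z0) -> lsc_at h q) ->
  (forall q, r < sqn (psub q z) < s2 -> eta < sqn (psub q z0) -> exists2 T, T < 0 & quad_bound h q T) ->
  (forall q, r <= sqn (psub q z) <= s2 -> eta <= sqn (psub q z0) ->
     [\/ sqn (psub q z) = r, sqn (psub q z) = s2 | sqn (psub q z0) = eta] -> (Phi q <= (h q)%:E)%E) ->
  forall q, r <= sqn (psub q z) <= s2 -> eta <= sqn (psub q z0) -> (Phi q <= (h q)%:E)%E.
Proof.
move=> hl hq hb q1 q1K q1e; rewrite leNgt; apply/negP => bad.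
pose K := [set q | r <= sqn (psub q z) <= s2] `&` [set q | eta <= sqn (psub q z0)].
have s20 : 0 <= s2 by case/andP: q1K => _; apply: le_trans; exact: sqn_ge0.
have cK : compact K.
  apply: (@subclosed_compact _ _ [set q | r <= sqn (psub q z) <= (Num.sqrt s2) ^+ 2]).
  - apply: closedI.
      apply: compact_closed; first exact: norm_hausdorff.
      by rewrite -{1}(sqr_sqrtr s20); exact: compact_annulus.
    have := @closed_comp _ _ _ [set x : R | eta <= x] (fun q _ => @sqn_continuous R z0 q) (@closed_ge R eta).
    by [].
  - exact: compact_annulus.
  - by move=> q [/= + _]; rewrite sqr_sqrtr.
have [|q2 [q2K q2e] hmax] := @usc_attains_max R K (fun q => Phi q - (h q)%:E)%E cK (ex_intro _ q1 (conj q1K q1e)).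
  move=> q c [qK qe]; rewrite lteBlDr // => hc.
  have [c' [hc' cc]] : exists c' : R, (Phi q < c'%:E)%E /\ c' < c + h q.
    move: hc; have := Phiy q; case: (Phi q) => [x _| //|_ _].
      by rewrite -EFinD lte_fin => hx; exists ((x + (c + h q)) / 2); rewrite lte_fin; split; lra.
    by exists (c + h q - 1); rewrite ltNyr; split=> //; lra.
  have [d d0 hd] := Phiu hc'; have [d' d0' hd'] := hl q qK qe (c + h q - c') ltac:(lra).
  exists (Num.min d d') => [|q' _ hm]; first by rewrite lt_min d0.
  have m0 : 0 <= Num.min d d' by rewrite le_min !ltW.
  have h1 : sqn (psub q' q) < d ^+ 2 by apply: lt_sqr_trans hm; rewrite // ge_min lexx.
  have h2 : sqn (psub q' q) < d' ^+ 2 by apply: lt_sqr_trans hm; rewrite // ge_min lexx orbT.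
  rewrite lteBlDr //; apply: lt_trans (hd _ h1) _.
  by rewrite -EFinD lte_fin; have := hd' _ h2; lra.
have f2 : (0 < Phi q2 - (h q2)%:E)%E.
  by apply: lt_le_trans (hmax q1 (conj q1K q1e)); rewrite sube_gt0.
have nb : ~ [\/ sqn (psub q2 z) = r, sqn (psub q2 z) = s2 | sqn (psub q2 z0) = eta].
  by move=> /(hb q2 q2K q2e); rewrite leNgt -sube_gt0 f2.
have q2i : r < sqn (psub q2 z) < s2 /\ eta < sqn (psub q2 z0).
  case/andP: q2K => h1 h2; rewrite !lt_neqAle h1 h2 q2e !andbT.
  split; [apply/andP; split|]; apply/eqP => E; apply: nb.
  - by apply: Or31.
  - by apply: Or32.
  - by apply: Or33.
have [T T0 hT] := hq q2 q2i.1 q2i.2.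
have [x0 E] : exists x0, Phi q2 = x0%:E.
  by move: f2; have := Phiy q2; case: (Phi q2) => [x| |] // _ _; exists x.
have [d d0 hd] : exists2 d : R, 0 < d & forall q', sqn (psub q' q2) < d ^+ 2 -> K q'.
  apply: near_sqnP; case: q2i => /andP[h1 h2] h3.
  have c1 := @sqn_continuous R z q2; have c2 := @sqn_continuous R z0 q2.
  have n1 : \forall q' \near q2, r < sqn (psub q' z) by exact: (cvgr_gt (sqn (psub q2 z)) c1).
  have n2 : \forall q' \near q2, sqn (psub q' z) < s2 by exact: (cvgr_lt (sqn (psub q2 z)) c1).
  have n3 : \forall q' \near q2, eta < sqn (psub q' z0) by exact: (cvgr_gt (sqn (psub q2 z0)) c2).
  by near=> q'; split => /=; [apply/andP; split|]; apply: ltW; near: q'.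
apply: (no_interior_max hT T0 d0 E) => q' /hd Kq'; have := hmax q' Kq'.
rewrite E leeBlDr // -EFinB -EFinD => /le_trans; apply; rewrite lee_fin; lra.
Unshelve. all: by end_near.
Qed.

Lemma circle_supermean (M : R) z (s : R) : 0 < s ->
  (forall c t : R, c ^+ 2 + t ^+ 2 = 1 -> (Phi (z.1 + s * c, z.2 + s * t)%R <= M%:E)%E) ->
  (\int[@lebesgue_measure R]_(x in `[0%R, (2 * pi)%R]) (M%:E - Phi (z.1 + s * cos x, z.2 + s * sin x)%R) <=
   (2 * pi)%:E * (M%:E - Phi z))%E.
Proof.
move=> s0 hM.
have hM' x : (Phi (z.1 + s * cos x, z.2 + s * sin x)%R <= M%:E)%E by apply: hM; exact: cos2Dsin2.
have mf := measurable_subharmonic_circle z s.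
have := Phim z s0; case E : (Phi z) => [x| |] hm; last 2 first.
- by have := Phiy z; rewrite E.
- by rewrite /=  gt0_muley ?lte_fin // leey.
pose g x := Phi (z.1 + s * cos x, z.2 + s * sin x).
have lI : lebesgue_measure (`[0%R, (2 * pi)%R]%classic : set R) = (2 * pi)%:E.
  by rewrite lebesgue_measure_itv /= lte_fin pi20 sube0.
have Ic (c : R) : (\int[@lebesgue_measure R]_(_ in `[0%R, (2 * pi)%R]) c%:E = (c * (2 * pi))%:E)%E.
  by rewrite integral_cst // EFinM -lI.
have iM : (@lebesgue_measure R).-integrable `[0%R, (2 * pi)%R]%classic (fun=> M%:E).
  by apply/integrableP; split=> //; rewrite integral_cst //; apply: le_lt_trans (_ : (`|M|%:E * (2 * pi)%:E)%E < +oo)%E; rewrite ?ltry // -lI lexx.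
have hm' : ((2 * pi * x)%:E <= \int[@lebesgue_measure R]_(x in `[0%R, (2 * pi)%R]) g x)%E.
  by move: hm; rewrite muleC -lee_pdivrMr ?invr_gt0 // invrK -EFinM mulrC.
have pf : (\int[@lebesgue_measure R]_(x in `[0%R, (2 * pi)%R]) g^\+ x < +oo)%E.
  apply: le_lt_trans (ltry (`|M| * (2 * pi))).
  apply: (@le_trans _ _ (\int[@lebesgue_measure R]_(x in `[0%R, (2 * pi)%R]) (`|M|)%:E)%E).
    apply: ge0_le_integral => //.
    - by apply: measurable_funepos; apply: measurable_funTS.
    - move=> t _; rewrite funeposE /g ge_max lee_fin normr_ge0 andbT.
      by apply: le_trans (hM' t) _; rewrite lee_fin ler_norm.
  by rewrite Ic.
have nf : (\int[@lebesgue_measure R]_(x in `[0%R, (2 * pi)%R]) g^\- x < +oo)%E.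
  rewrite ltey; apply/eqP => E'; move: hm'; rewrite integralE E'.
  have : (0 <= \int[@lebesgue_measure R]_(x in `[0%R, (2 * pi)%R]) g^\+ x)%E by apply: integral_ge0.
  by move: pf; case: (\int[_]_(_ in _) _)%E.
have ig : (@lebesgue_measure R).-integrable `[0%R, (2 * pi)%R]%classic g.
  apply/integrableP; split; first exact: measurable_funTS.
  have -> : (\int[@lebesgue_measure R]_(x in `[0%R, (2 * pi)%R]) `|g x| = \int[@lebesgue_measure R]_(x in `[0%R, (2 * pi)%R]) (g^\+ x + g^\- x))%E.
    by apply: eq_integral => t _; rewrite -/((abse \o g) t) fune_abse.
  rewrite ge0_integralD //; last 2 first.
  - by apply: measurable_funepos; apply: measurable_funTS.
  - by apply: measurable_funeneg; apply: measurable_funTS.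
  exact: lte_add_pinfty.
rewrite -/(g _) integralB // Ic -EFinB -!EFinM.
rewrite [X in (_ - X)%E](_ : _ = \int[@lebesgue_measure R]_(x in `[0%R, (2 * pi)%R]) g x)%E //.
rewrite leeBlDr; last exact: (integrable_fin_num _ ig).
rewrite -leeBlDl // -EFinB; apply: le_trans hm'; rewrite lee_fin; lra.
Qed.

Lemma avg_supermean (M : R) (A : set (R * R)) (r : R) z : 0 < r -> measurable A ->
  (forall p, sqn p < r ^+ 2 -> A (padd z p)) -> (forall q, A q -> (Phi q <= M%:E)%E) ->
  (avg r ((fun q => M%:E - Phi q) \_ A) z <= M%:E - Phi z)%E.
Proof.
move=> r0 mA zA AM; set v := _ \_ A.
have Az : A z by have := zA (0, 0); rewrite /padd /sqn /= !addr0 -surjective_pairing; apply; rewrite expr0n addr0 exprn_gt0.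
have vz : v z = (M%:E - Phi z)%E by rewrite /v patchE mem_set.
have mv : measurable_fun setT v.
  apply/(measurable_restrictT _ mA); apply: measurable_funTS; apply: emeasurable_funB => //.
  exact: measurable_subharmonic_plane.
have v0 p : (0 <= v p)%E.
  by rewrite /v patchE; case: ifPn => // /set_mem /AM h; rewrite sube_ge0 //; apply/orP; right.
(* The degenerate circle [s = 0] is settled directly, since the mean value inequality is stated for
   positive radii. *)
rewrite -vz; apply: avg_le_center => // s /andP[]; rewrite le_eqVlt => /predU1P[<- _|s0 sr].
  rewrite /circle_integral; under eq_integral do rewrite !mul0r !addr0 -surjective_pairing.
  rewrite integral_cst // muleC; apply: lee_wpmul2r => //.
  suff: (@lebesgue_measure R `[0%R, (pi *+ 2)%R[%classic <= (pi *+ 2)%:E)%E by [].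
  rewrite lebesgue_measure_itv /= lte_fin.
  by case: ifP => _; rewrite ?sube0 // lee_fin mulrn_wge0 // pi_ge0.
have cA (c t : R) : c ^+ 2 + t ^+ 2 = 1 -> A (z.1 + s * c, z.2 + s * t).
  move=> ct; apply: (zA (s * c, s * t)).
  rewrite (_ : sqn _ = s ^+ 2 * (c ^+ 2 + t ^+ 2)); last by rewrite /sqn /=; ring.
  by rewrite ct mulr1 ltr_pXn2r // nnegrE ltW.
have mvc : measurable_fun setT (fun x : R => v (z.1 + s * cos x, z.2 + s * sin x)).
  by have := measurable_circle z s 0 mv; apply: eq_measurable_fun => x _; rewrite addr0.
rewrite /circle_integral ge0_integral_leb //; last exact: measurable_funTS.
rewrite -mulr_natl vz.
apply: le_trans (circle_supermean s0 _); last by move=> c t /cA /AM.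
have -> : (\int[@lebesgue_measure R]_(x in `[0%R, (2 * pi)%R]) (M%:E - Phi (z.1 + s * cos x, z.2 + s * sin x)%R) =
   \int[@lebesgue_measure R]_(x in `[0%R, (2 * pi)%R]) v (z.1 + s * cos x, z.2 + s * sin x)%R)%E.
  apply: eq_integral => x _; rewrite /v patchE mem_set //; apply: cA; exact: cos2Dsin2.
apply: ge0_subset_integral => //; first exact: measurable_funTS.
by move=> x /=; rewrite !in_itv /= => /andP[-> /ltW].
Qed.

End subharmonic_plane.

(** * Comparison with sums of logarithms *)

Section comparison_principle.
Context {R : realType}.
Implicit Types (p q z : R * R).

(** Points where [k * logdist q z0] is not a junk value. *)
Definition off_pole (k : R) z0 q : Prop := k = 0 \/ 0 < sqn (psub q z0).

Lemma quad_bound_klog (k : R) z q : 0 <= k -> off_pole k z q ->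
  quad_bound (fun p => k * logdist p z) q 0.
Proof.
move=> k0 [->|D0].
  have -> : (fun p => 0 * logdist p z) = (fun=> 0) by apply/funext => p; rewrite mul0r.
  exact: quad_bound_cst.
by rewrite -(mulr0 k); apply: quad_bound_scale => //; exact: quad_bound_logdist.
Qed.

Lemma lsc_at_klog (k : R) z q : 0 <= k -> off_pole k z q -> lsc_at (fun p => k * logdist p z) q.
Proof.
move=> k0 [->|D0].
  have -> : (fun p => 0 * logdist p z) = (fun=> 0) by apply/funext => p; rewrite mul0r.
  exact: lsc_at_cst.
by apply: lsc_at_scale => //; exact: lsc_at_logdist.
Qed.

Lemma sqn_psub_le2 q z z0 : sqn (psub q z0) <= 2 * sqn (psub q z) + 2 * sqn (psub z z0).
Proof.
rewrite /sqn /=; have := sqr_ge0 (q.1 - 2 * z.1 + z0.1); have := sqr_ge0 (q.2 - 2 * z.2 + z0.2).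
by rewrite !expr2; lra.
Qed.

Lemma logdist_le q z (U : R) : sqn (psub q z) <= U -> logdist q z <= U.
Proof.
move=> h; rewrite /logdist; have := sqn_ge0 (psub q z).
rewrite le_eqVlt => /predU1P[<-|D0]; first by rewrite ln0 // mul0r; apply: le_trans h; exact: sqn_ge0.
by have := ln_sublinear D0; lra.
Qed.

Variables (Phi : R * R -> \bar R) (PhiP : subharmonic_plane Phi).

(** This upper bound makes the pole removable: [Phi - k log |. - z0|] stays bounded above near [z0],
    so [z0] is not seen by the maximum principle. *)
Definition log_bounded (k : R) z0 : Prop := 0 < k -> exists B d : R, 0 < d /\
  forall q, 0 < sqn (psub q z0) < d ^+ 2 -> (Phi q <= (k * logdist q z0 + B)%:E)%E.

(** The comparison function is only harmonic and tends to [-oo] at [z0] when [k > 0]. Subtracting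
    [ep * sqn (psub q z)] makes its Laplacian negative, and lowering [k] to [k * (1 - ep)] makes it
    exceed [Phi] on a small circle about [z0]. The maximum principle applies on the rest, and [ep]
    is small against [e]. The premise that [be] is zero or [r] positive keeps [z] itself out of the
    second logarithm. *)
Lemma comparison z z0 (k al be r s2 : R) : 0 <= k -> 0 <= be -> be = 0 \/ 0 < r -> log_bounded k z0 ->
  (forall q, sqn (psub q z) = r \/ sqn (psub q z) = s2 -> off_pole k z0 q ->
     (Phi q <= (k * logdist q z0 + al + be * logdist q z)%:E)%E) ->
  forall q, r <= sqn (psub q z) <= s2 -> off_pole k z0 q ->
     (Phi q <= (k * logdist q z0 + al + be * logdist q z)%:E)%E.
Proof.
move=> k0 be0 ber loc bd q1 q1K q1z0; apply/lee_addgt0Pr => e e0; rewrite -EFinD.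
have s20 : 0 <= s2 by case/andP: q1K => _; apply: le_trans; exact: sqn_ge0.
have [L [L0 HL]] : exists L : R, 0 <= L /\ forall q, sqn (psub q z) <= s2 -> logdist q z0 <= L.
  exists (2 * s2 + 2 * sqn (psub z z0)); split; first by rewrite addr_ge0 // mulr_ge0 // sqn_ge0.
  by move=> q h; apply: logdist_le; have := sqn_psub_le2 q z z0; lra.
have [l Hl] : exists l : R, forall q, r <= sqn (psub q z) -> l <= be * logdist q z.
  case: ber => [->|r0]; first by exists 0 => q _; rewrite mul0r.
  exists (be * (ln r / 2)) => q h; apply: ler_wpM2l => //.
  by rewrite ler_pM2r // ler_ln // posrE // (lt_le_trans r0).
have q1L : logdist q1 z0 <= L by apply: HL; case/andP: q1K.
(* At [q1] the perturbed function exceeds the original one by at most [ep * C1]. *)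
have [C1 CE] : exists C1 : R, C1 = k * (L - logdist q1 z0) + s2 by eexists.
have C10 : 0 <= C1 by rewrite CE addr_ge0 // mulr_ge0 // subr_ge0.
have [ep [ep0 ep1 epC]] : exists ep : R, [/\ 0 < ep, ep < 1 & ep * C1 <= e].
  exists (Num.min (1 / 2) (e / (C1 + 1))); split.
  - by rewrite lt_min !divr_gt0 //; lra.
  - by rewrite gt_min; apply/orP; left; lra.
  - apply: (@le_trans _ _ (e / (C1 + 1) * C1)); first by rewrite ler_wpM2r // ge_min lexx orbT.
    rewrite -mulrA ger_pMr // ler_pdivrMl; lra.
have kep0 : 0 <= k * (1 - ep) by rewrite mulr_ge0 // subr_ge0 ltW.
have [eta [etaq etap etab]] : exists eta : R, [/\ eta <= sqn (psub q1 z0),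
    (forall q, eta <= sqn (psub q z0) -> off_pole k z0 q) &
    (forall q, r <= sqn (psub q z) <= s2 -> sqn (psub q z0) = eta ->
      (Phi q <= (k * (1 - ep) * logdist q z0 + (al + k * ep * L + ep * s2) + be * logdist q z + - ep * sqn (psub q z))%:E)%E)].
  have [kE|kn0] := eqVneq k 0.
    (* Without a pole no disc has to be removed, and a negative squared radius removes none. *)
    exists (-1); split; first by apply: le_trans (sqn_ge0 _).
      by move=> q _; left.
    by move=> q _ E; exfalso; have := sqn_ge0 (psub q z0); rewrite E; lra.
  have kp : 0 < k by rewrite lt_neqAle eq_sym kn0.
  have [B [d [d0 hB]]] := loc kp.
  have q1p : 0 < sqn (psub q1 z0) by case: q1z0 => // /eqP; rewrite (negbTE kn0).
  have [eta [eta0 eta1 etad etae]] : exists eta : R, [/\ 0 < eta, eta <= sqn (psub q1 z0), eta < d ^+ 2 &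
      k * ep * (ln eta / 2) <= al + l - B].
    exists (Num.min (sqn (psub q1 z0)) (Num.min (d ^+ 2 / 2) (expR (2 * (al + l - B) / (k * ep))))).
    have eta0 : 0 < Num.min (sqn (psub q1 z0)) (Num.min (d ^+ 2 / 2) (expR (2 * (al + l - B) / (k * ep)))).
      by rewrite !lt_min q1p expR_gt0 divr_gt0 // exprn_gt0.
    split => //.
    - by rewrite ge_min lexx.
    - rewrite !gt_min; apply/orP; right; apply/orP; left.
      have := exprn_gt0 2 d0; lra.
    - have kep : 0 < k * ep by rewrite mulr_gt0.
      apply: (@le_trans _ _ (k * ep * (2 * (al + l - B) / (k * ep) / 2))).
        rewrite ler_pM2l // ler_pM2r // -[leRHS]expRK ler_ln ?posrE ?expR_gt0 //.
        by rewrite !ge_min lexx !orbT.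
      by rewrite le_eqVlt; apply/orP; left; apply/eqP; field; rewrite !gt_eqF.
  exists eta; split => // [q h|q /andP[rq qs] E]; first by right; exact: lt_le_trans h.
  apply: le_trans (hB q _) _; first by rewrite E eta0.
  rewrite lee_fin; have := Hl q rq.
  have : 0 <= ep * (s2 - sqn (psub q z)) by rewrite mulr_ge0 ?subr_ge0 // ltW.
  have : 0 <= k * ep * L by rewrite !mulr_ge0 // ltW.
  have EL : logdist q z0 = ln eta / 2 by rewrite /logdist E.
  rewrite -EL in etae; lra.
have := @max_principle R Phi PhiP z z0 r s2 eta
  (fun q => k * (1 - ep) * logdist q z0 + (al + k * ep * L + ep * s2) + be * logdist q z + - ep * sqn (psub q z)).
have op q : eta <= sqn (psub q z0) -> off_pole (k * (1 - ep)) z0 q.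
  by move=> /etap[->|]; [left; rewrite mul0r|right].
have op' q : r <= sqn (psub q z) -> off_pole be z q.
  by move=> h; case: ber => r0; [left|right; exact: lt_le_trans h].
move=> mp; apply: le_trans (mp _ _ _ q1 q1K etaq) _.
- move=> q /andP[rq qs] qe; apply: lsc_at_add; last by apply: lsc_at_oppsqn; exact: ltW.
  apply: lsc_at_add; last by apply: lsc_at_klog => //; exact: op'.
  by apply: lsc_at_add; [apply: lsc_at_klog => //; exact: op|exact: lsc_at_cst].
- move=> q /andP[/ltW rq qs] /ltW qe; exists (0 + 0 + 0 + (- 2 * ep)); first by lra.
  apply: quad_bound_add; last exact: quad_bound_oppsqn.
  apply: quad_bound_add; last by apply: quad_bound_klog => //; exact: op'.
  by apply: quad_bound_add; [apply: quad_bound_klog => //; exact: op|exact: quad_bound_cst].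
- move=> q qK qe hq.
  have [h|h] : (sqn (psub q z) = r \/ sqn (psub q z) = s2) \/ sqn (psub q z0) = eta.
    by case: hq => h; [left; left|left; right|right].
    apply: le_trans (bd q h (etap q qe)) _; rewrite lee_fin.
    case/andP: qK => _ qs.
    have : 0 <= ep * (s2 - sqn (psub q z)) by rewrite mulr_ge0 ?subr_ge0 // ltW.
    have : 0 <= k * ep * (L - logdist q z0) by rewrite !mulr_ge0 ?subr_ge0 ?HL // ltW.
    lra.
  exact: etab.
- rewrite lee_fin; have : 0 <= ep * sqn (psub q1 z) by rewrite mulr_ge0 ?sqn_ge0 // ltW.
  by move: epC; rewrite CE; lra.
Qed.

Lemma off_pole0 z0 q : off_pole 0 z0 q. Proof. by left. Qed.
Lemma log_bounded0 z0 : log_bounded 0 z0. Proof. by rewrite /log_bounded ltxx. Qed.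

Lemma subharmonic_bounded_disc z (r : R) : exists B : R,
  forall q, sqn (psub q z) <= r ^+ 2 -> (Phi q <= B%:E)%E.
Proof.
have [Phiy Phiu _ _] := PhiP.
have [||q0 _ h] := @usc_attains_max R [set q | 0 <= sqn (psub q z) <= r ^+ 2] Phi (@compact_annulus R z 0 r).
- by exists z => /=; rewrite sqn_ge0 /sqn /= !subrr expr0n addr0 sqr_ge0.
- by move=> q c _ /Phiu[d d0 hd]; exists d => // q' _ /hd.
exists (fine (Phi q0)) => q qz; have hq := h q ltac:(by rewrite /= sqn_ge0 qz).
apply: le_trans hq _; have := Phiy q0; case: (Phi q0) => //= _; exact: leNye.
Qed.

Lemma klog_bounded_disc z z0 (k r : R) : 0 <= k -> log_bounded k z0 -> exists B : R,
  forall q, sqn (psub q z) <= r ^+ 2 -> off_pole k z0 q -> (Phi q <= (k * logdist q z0 + B)%:E)%E.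
Proof.
move=> k0 loc; have [B hB] := subharmonic_bounded_disc z r.
have [kE|kn0] := eqVneq k 0.
  by exists B => q /hB h _; rewrite kE mul0r add0r.
have kp : 0 < k by rewrite lt_neqAle eq_sym kn0.
have [B' [d [d0 hB']]] := loc kp.
exists (Num.max B' (B - k * (ln (d ^+ 2) / 2))) => q qr [/eqP|qp]; first by rewrite (negbTE kn0).
have [qd|qd] := ltP (sqn (psub q z0)) (d ^+ 2).
  by apply: le_trans (hB' q _) _; rewrite ?qp // lee_fin lerD2l le_max lexx.
apply: le_trans (hB q qr) _; rewrite lee_fin -lerBlDl le_max; apply/orP; right.
rewrite lerD2l lerN2 ler_pM2l // ler_pM2r // ler_ln // posrE //; exact: exprn_gt0.
Qed.

(** This makes the infimum in [disc_sup] meaningful. If arbitrarily negative bounds held on the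
    disc, comparison on annuli reaching beyond any given point would push [Phi] to [-oo] everywhere
    off the pole, and then at the pole through the mean over a circle, contradicting that [Phi] is
    finite somewhere. *)
Lemma subharmonic_not_lower z z0 (k r : R) : 0 <= k -> 0 < r -> log_bounded k z0 ->
  exists c : R, forall B : R, (forall q, sqn (psub q z) <= r ^+ 2 -> off_pole k z0 q ->
    (Phi q <= (k * logdist q z0 + B)%:E)%E) -> c <= B.
Proof.
move=> k0 r0 loc; apply: contrapT => nc.
have [_ _ [p0 p0n] _] := PhiP.
have {}nc c : exists2 B : R, B < c & forall q, sqn (psub q z) <= r ^+ 2 -> off_pole k z0 q ->
    (Phi q <= (k * logdist q z0 + B)%:E)%E.
  apply: contrapT => h; apply: nc; exists c => B hB; rewrite leNgt; apply/negP => Bc.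
  by apply: h; exists B.
suff all q : off_pole k z0 q -> Phi q = -oo%E.
  have [//|np0] := EM (off_pole k z0 p0); first by move=> /all E; rewrite E in p0n.
  have [kE|kn0] := eqVneq k 0; first by apply: np0; left.
  have p0E : p0 = z0.
    apply: contrapT => ne; apply: np0; right; rewrite lt_neqAle sqn_ge0 andbT eq_sym.
    apply/eqP => E; apply: ne; apply/eqP; rewrite [p0]surjective_pairing [z0]surjective_pairing xpair_eqE.
    have : sqn (psub p0 z0) == 0 by rewrite E.
    rewrite /sqn /= paddr_eq0 ?sqr_ge0 // !sqrf_eq0 !subr_eq0; exact.
  suff : (Phi p0 <= -oo)%E by rewrite leeNy_eq (negbTE p0n).
  have [_ _ _ mean] := PhiP.
  apply: le_trans (mean p0 1 ltr01) _.
  have -> : (\int[@lebesgue_measure R]_(x in `[0%R, (2 * pi)%R]) Phi (p0.1 + 1 * cos x, p0.2 + 1 * sin x)%R =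
      \int[@lebesgue_measure R]_(x in `[0%R, (2 * pi)%R]) (cst -oo x))%E.
    apply: eq_integral => x _; apply: all; right; rewrite p0E.
    rewrite (_ : sqn _ = cos x ^+ 2 + sin x ^+ 2); last by rewrite /sqn /=; ring.
    by rewrite cos2Dsin2.
  have pi0 : 0 < 2 * pi :> R by rewrite mulr_gt0 // pi_gt0.
  have lI : lebesgue_measure (`[0%R, (2 * pi)%R]%classic : set R) = (2 * pi)%:E.
    by rewrite lebesgue_measure_itv /= lte_fin pi0 sube0.
  rewrite (_ : \int[_]_(_ in _) _ = -oo * (2 * pi)%:E)%E; last by rewrite -lI integral_cst.
  by rewrite gt0_mulNye ?lte_fin // gt0_muleNy // lte_fin invr_gt0.
move=> qp; apply: contrapT => /eqP qn.
have [Phiy _ _ _] := PhiP.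
have [x qx] : exists x : R, Phi q = x%:E by move: qn; have := Phiy q; case: (Phi q) => // x _ _; exists x.
pose s := Num.sqrt (Num.max (r ^+ 2) (sqn (psub q z)) + 1) : R.
have sE : s ^+ 2 = Num.max (r ^+ 2) (sqn (psub q z)) + 1.
  by rewrite sqr_sqrtr // addr_ge0 // le_max sqr_ge0.
have rs2 : r ^+ 2 < s ^+ 2 by rewrite sE; apply: (@le_lt_trans _ _ (Num.max (r ^+ 2) (sqn (psub q z)))); rewrite ?le_max ?lexx ?orbT // ltrDl.
have qs2 : sqn (psub q z) < s ^+ 2 by rewrite sE; apply: (@le_lt_trans _ _ (Num.max (r ^+ 2) (sqn (psub q z)))); rewrite ?le_max ?lexx ?orbT // ltrDl.
have [B hB _] : exists2 B : R, (forall q, sqn (psub q z) <= s ^+ 2 -> off_pole k z0 q -> (Phi q <= (k * logdist q z0 + B)%:E)%E) & True.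
  by have [B hB] := klog_bounded_disc z s k0 loc; exists B.
(* The weight of the inner circle in logarithmic interpolation at [q]; [N] is later taken so low
   that the interpolated bound at [q] falls below the finite value [x]. *)
pose lam := (ln (s ^+ 2) - ln (sqn (psub q z))) / (ln (s ^+ 2) - ln (r ^+ 2)).
have rp : 0 < r ^+ 2 by exact: exprn_gt0.
have [qr|qr] := leP (sqn (psub q z)) (r ^+ 2).
  have [B' hB1 hB2] := nc (x - k * logdist q z0).
  by have := hB2 q qr qp; rewrite qx lee_fin; lra.
have q0 : 0 < sqn (psub q z) by exact: lt_trans qr.
have lnrs : 0 < ln (s ^+ 2) - ln (r ^+ 2) by rewrite subr_gt0 ltr_ln ?posrE // (lt_trans rp).
have lam0 : 0 < lam by rewrite divr_gt0 // subr_gt0 ltr_ln ?posrE // (lt_trans q0).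
have [N hN1 hN2] := nc (Num.min B (B + (x - k * logdist q z0 - B) / lam)).
have NB : N <= B by apply: le_trans (ltW hN1) _; rewrite ge_min lexx.
have NB2 : (N - B) * lam < x - k * logdist q z0 - B.
  rewrite -ltr_pdivlMr // ltrBlDl; apply: lt_le_trans hN1 _; by rewrite ge_min lexx orbT.
pose be := 2 * (B - N) / (ln (s ^+ 2) - ln (r ^+ 2)); pose al := B - be * (ln (s ^+ 2) / 2).
have be0 : 0 <= be by apply: divr_ge0; [rewrite mulr_ge0 // subr_ge0|exact: ltW].
have qK : r ^+ 2 <= sqn (psub q z) <= s ^+ 2 by rewrite !ltW.
have h := @comparison z z0 k al be (r ^+ 2) (s ^+ 2) k0 be0 (or_intror rp) loc _ q qK qp.
suff : x <= k * logdist q z0 + al + be * logdist q z.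
  rewrite /al /be /logdist -/(logdist q z0).
  have -> : k * logdist q z0 + (B - 2 * (B - N) / (ln (s ^+ 2) - ln (r ^+ 2)) * (ln (s ^+ 2) / 2)) +
    2 * (B - N) / (ln (s ^+ 2) - ln (r ^+ 2)) * (ln (sqn (psub q z)) / 2) = k * logdist q z0 + B + (N - B) * lam.
    by rewrite /lam; field; rewrite gt_eqF.
  lra.
rewrite -lee_fin -qx; apply: h => p [pE|pE] pp.
  apply: le_trans (hN2 p _ pp) _; rewrite ?pE // lee_fin -addrA lerD2l /al /logdist pE.
  by rewrite le_eqVlt; apply/orP; left; apply/eqP; rewrite /be; field; rewrite gt_eqF.
apply: le_trans (hB p _ pp) _; rewrite ?pE // lee_fin -addrA lerD2l /al /logdist pE; lra.
Qed.

End comparison_principle.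

(** * Slopes of convex functions near minus infinity *)

Section convex_functions.
Context {R : realType}.
Variable f : R -> R.
Hypothesis fnd : forall x y, x <= y -> f x <= f y.
Hypothesis fcv : forall x y w, x < y -> y < w -> (f y - f x) * (w - y) <= (f w - f y) * (y - x).

Lemma convex_slope_le x y u v : x < y -> y <= u -> u < v -> (f y - f x) * (v - u) <= (f v - f u) * (y - x).
Proof.
move=> xy; rewrite le_eqVlt => /predU1P[<- yv|yu uv]; first exact: fcv.
have := fcv xy yu; have := fcv yu uv.
have p0 : 0 < y - x by lra.
have q0 : 0 < u - y by lra.
have r0 : 0 < v - u by lra.
move: (f y - f x) (f u - f y) (f v - f u) (y - x) (u - y) (v - u) p0 q0 r0 => a b c p q r p0 q0 r0 h1 h2.
rewrite -(ler_pM2r q0); have := ler_wpM2r (ltW r0) h2; have := ler_wpM2r (ltW p0) h1; lra.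
Qed.

(** [nu] is the infimum of all difference quotients. By convexity, a quotient below [m] somewhere
    bounds every quotient further to the left, so [nu] is the limiting slope at [-oo], and also the
    limit of [f x / x]. For maxima over circles of radius [expR x] this limit is the Lelong
    number. *)
Lemma convex_slope_limit : exists nu : R, [/\ 0 <= nu,
  forall x y, x < y -> nu * (y - x) <= f y - f x,
  forall m, nu < m -> exists X, forall x y, x < y -> y <= X -> f y - f x <= m * (y - x) &
  forall e, 0 < e -> exists X, forall x, x < X -> `|f x / x - nu| <= e].
Proof.
pose A := [set s | exists x y, x < y /\ s = (f y - f x) / (y - x)].
have A0 s : A s -> 0 <= s.
  by move=> [x [y [xy ->]]]; rewrite divr_ge0 // subr_ge0; [apply: fnd|]; exact: ltW.
have hA : has_inf A.
  split; first by exists ((f 1 - f 0) / (1 - 0)), 0, 1.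
  by exists 0 => s; exact: A0.
pose nu := inf A.
have h1 x y : x < y -> nu * (y - x) <= f y - f x.
  move=> xy; rewrite -ler_pdivlMr ?subr_gt0 //; apply: ge_inf; first exact: hA.2.
  by exists x, y.
have h2 m : nu < m -> exists X, forall x y, x < y -> y <= X -> f y - f x <= m * (y - x).
  move=> num; have [s [u [v [uv ->]]] sm] := inf_lt hA.1 num.
  exists u => x y xy yu; have := convex_slope_le xy yu uv.
  move: sm; rewrite ltr_pdivrMr ?subr_gt0 // => sm h.
  have yx : 0 < y - x by lra.
  have vu : 0 < v - u by lra.
  rewrite -(ler_pM2r vu); have := ler_wpM2r (ltW yx) (ltW sm); lra.
exists nu; split => //; first by apply: lb_le_inf; [exact: hA.1|exact: A0].
move=> e e0; have [X0 hX0] := h2 (nu + e / 2) ltac:(lra).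
(* Bounds the intercepts of the lines of slope [nu] and [nu + e / 2] through the point at [X0],
   between which [f] runs on the left; they are negligible once [- x] exceeds [2 * C / e]. *)
pose C := Num.max `|f X0 - nu * X0| `|f X0 - (nu + e / 2) * X0|.
have C0 : 0 <= C by rewrite le_max normr_ge0.
exists (Num.min X0 (Num.min (-1) (- (2 * C / e)))) => x.
rewrite !lt_min => /and3P[xX x1 xC].
have l1 := h1 _ _ xX; have l2 := hX0 _ _ xX (lexx _).
have x0 : 0 < - x by lra.
have hC1 : `|f X0 - nu * X0| <= C by rewrite le_max lexx.
have hC2 : `|f X0 - (nu + e / 2) * X0| <= C by rewrite le_max lexx orbT.
have Cx : C <= e / 2 * (- x).
  have : 2 * C / e < - x by lra.
  rewrite ltr_pdivrMr // => h; lra.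
have xn : x != 0 by rewrite lt_eqF //; lra.
rewrite -(ler_pM2r x0) -{1}(gtr0_norm x0) -normrM (_ : (f x / x - nu) * - x = nu * x - f x); last by field.
move: hC1 hC2; rewrite !ler_norml => /andP[a1 a2] /andP[b1 b2]; apply/andP; split; nra.
Qed.
End convex_functions.

(** * Suprema over discs and their growth in the logarithm of the radius *)

Section disc_supremum.
Context {R : realType}.
Implicit Types (p q z : R * R).

Lemma sqn_triangle (a b : R) p q z : 0 <= a -> 0 <= b ->
  sqn (psub p q) <= a ^+ 2 -> sqn (psub q z) <= b ^+ 2 -> sqn (psub p z) <= (a + b) ^+ 2.
Proof.
move=> a0 b0; rewrite /sqn /=.
have -> : p.1 - z.1 = (p.1 - q.1) + (q.1 - z.1) by ring.
have -> : p.2 - z.2 = (p.2 - q.2) + (q.2 - z.2) by ring.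
move: (p.1 - q.1) (p.2 - q.2) (q.1 - z.1) (q.2 - z.2) => x y u v h1 h2.
suff : x * u + y * v <= a * b by rewrite !expr2 in h1 h2 *; lra.
apply: le_trans (ler_norm _) _.
rewrite -(ler_pXn2r (n := 2)) ?nnegrE ?mulr_ge0 // real_normK ?num_real //.
apply: (@le_trans _ _ ((x ^+ 2 + y ^+ 2) * (u ^+ 2 + v ^+ 2))).
  by have := sqr_ge0 (x * v - y * u); rewrite !expr2; lra.
by rewrite exprMn ler_pM // addr_ge0 // sqr_ge0.
Qed.

Lemma sqn_psubC p q : sqn (psub p q) = sqn (psub q p).
Proof. by rewrite /sqn /=; ring. Qed.

Lemma logdistE p q (r : R) : 0 < r -> sqn (psub p q) = r ^+ 2 -> logdist p q = ln r.
Proof. by move=> r0 h; rewrite /logdist h lnXn // -mulr_natl; field. Qed.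

Lemma logdist_le_ln p q (r : R) : 0 < sqn (psub p q) -> 0 < r -> sqn (psub p q) <= r ^+ 2 -> logdist p q <= ln r.
Proof.
move=> D0 r0 h; have -> : ln r = ln (r ^+ 2) / 2 by rewrite lnXn // -mulr_natl; field.
by rewrite /logdist ler_pM2r // ler_ln // posrE // exprn_gt0.
Qed.

Lemma logdist_ge_ln p q (r : R) : 0 < r -> r ^+ 2 <= sqn (psub p q) -> ln r <= logdist p q.
Proof.
move=> r0 h; have -> : ln r = ln (r ^+ 2) / 2 by rewrite lnXn // -mulr_natl; field.
by rewrite /logdist ler_pM2r // ler_ln // posrE ?(lt_le_trans _ h) // exprn_gt0.
Qed.

Variables (Phi : R * R -> \bar R) (PhiP : subharmonic_plane Phi).

(** The supremum of [Phi - k log |. - z0|] on a closed disc, as the infimum of its upper bounds: this avoids the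
    value [-oo] of [Phi] and the junk value [ln 0]. *)
Definition disc_sup (k : R) z0 z (r : R) : R := inf [set B : R | forall q, sqn (psub q z) <= r ^+ 2 ->
  off_pole k z0 q -> (Phi q <= (k * logdist q z0 + B)%:E)%E].

Section fixed_pole.
Variables (k : R) (z0 : R * R).
Hypotheses (k0 : 0 <= k) (loc : log_bounded Phi k z0).
Local Notation S := (disc_sup k z0).

Lemma disc_sup_ub z (r : R) q : sqn (psub q z) <= r ^+ 2 -> off_pole k z0 q ->
  (Phi q <= (k * logdist q z0 + S z r)%:E)%E.
Proof.
move=> qr qp; apply/lee_addgt0Pr => e e0.
have [B0 hB0] := klog_bounded_disc PhiP z r k0 loc.
have [B hB Be] := @inf_lt R [set B : R | forall q, sqn (psub q z) <= r ^+ 2 -> off_pole k z0 q ->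
  (Phi q <= (k * logdist q z0 + B)%:E)%E] (S z r + e) (ex_intro _ B0 hB0) ltac:(by rewrite ltrDl).
by apply: le_trans (hB q qr qp) _; rewrite -EFinD lee_fin -addrA lerD2l ltW.
Qed.

Lemma disc_sup_le z (r B : R) : 0 < r -> (forall q, sqn (psub q z) <= r ^+ 2 -> off_pole k z0 q ->
  (Phi q <= (k * logdist q z0 + B)%:E)%E) -> S z r <= B.
Proof.
move=> r0 hB; apply: ge_inf => //.
by have [c hc] := subharmonic_not_lower PhiP z k0 r0 loc; exists c => B' hB'; exact: hc.
Qed.

Lemma disc_sup_sub z z' (r s d : R) : 0 < r -> 0 <= d -> sqn (psub z z') <= d ^+ 2 -> r + d <= s ->
  S z r <= S z' s.
Proof.
move=> r0 d0 zz rds; apply: disc_sup_le => // q qr qp; apply: disc_sup_ub => //.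
apply: le_trans (sqn_triangle (ltW r0) d0 qr zz) _.
by rewrite ler_pXn2r // nnegrE ?(le_trans _ rds) // addr_ge0 // ltW.
Qed.

Lemma sqn_psub_self z : sqn (psub z z) = 0.
Proof. by rewrite /sqn /= !subrr expr0n addr0. Qed.

Lemma disc_sup_homo z (r s : R) : 0 < r -> r <= s -> S z r <= S z s.
Proof.
by move=> r0 rs; apply: (@disc_sup_sub _ _ _ _ 0) => //; rewrite ?addr0 // sqn_psub_self sqr_ge0.
Qed.

(** The supremum may only be approached at the excluded pole; the loss of [1] replaces its
    attainment and reappears in the constant [C0]. *)
Lemma disc_sup_near_max z (r : R) : 0 < r -> exists q, [/\ sqn (psub q z) <= r ^+ 2,
  off_pole k z0 q & ((k * logdist q z0 + (S z r - 1))%:E <= Phi q)%E].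
Proof.
move=> r0; apply: contrapT => nq.
have : S z r <= S z r - 1.
  apply: disc_sup_le => // q qr qp; rewrite leNgt; apply/negP => h; apply: nq.
  by exists q; split => //; exact: ltW.
lra.
Qed.

(** Hadamard's three circles. On the annulus [Phi] is compared with the function
    [k * logdist q z0 + al + be * logdist q z] that interpolates the bounds on the two boundary
    circles; on the inner disc [be >= 0] suffices. *)
Lemma disc_sup_convex z x y w : x < y -> y < w ->
  (S z (expR y) - S z (expR x)) * (w - y) <= (S z (expR w) - S z (expR y)) * (y - x).
Proof.
move=> xy yw.
have xw : 0 < w - x by lra.
have e0 (t : R) : 0 < expR t by exact: expR_gt0.
have Sm : S z (expR x) <= S z (expR w) by apply: disc_sup_homo => //; rewrite ler_expR; lra.
pose be := (S z (expR w) - S z (expR x)) / (w - x).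
have be0 : 0 <= be by rewrite divr_ge0 ?subr_ge0 // ltW // -subr_gt0.
pose al := S z (expR x) - be * x.
have : S z (expR y) <= al + be * y.
  apply: disc_sup_le => // q qy qp.
  have [qx|qx] := leP (sqn (psub q z)) (expR x ^+ 2).
    apply: le_trans (disc_sup_ub qx qp) _; rewrite lee_fin lerD2l /al.
    have : 0 <= be * (y - x) by rewrite mulr_ge0 //; lra.
    lra.
  have q0 : 0 < sqn (psub q z) by apply: lt_trans qx; exact: exprn_gt0.
  have lq : logdist q z <= y by rewrite -[leRHS]expRK; exact: logdist_le_ln.
  apply: (@le_trans _ _ ((k * logdist q z0 + al + be * logdist q z)%:E)%E).
    apply: (comparison PhiP k0 be0 (r := expR x ^+ 2) (s2 := expR w ^+ 2)) => //.
    - by right; exact: exprn_gt0.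
    - move=> p [|] pE pp; rewrite (logdistE (e0 _) pE) expRK.
        by apply: le_trans (disc_sup_ub (z := z) (r := expR x) _ pp) _; rewrite ?pE // lee_fin -addrA lerD2l /al; lra.
      apply: le_trans (disc_sup_ub (z := z) (r := expR w) _ pp) _; rewrite ?pE // lee_fin -addrA lerD2l /al.
      rewrite le_eqVlt; apply/orP; left; apply/eqP; rewrite /be; field; by rewrite gt_eqF.
    - rewrite (ltW qx) /=; apply: le_trans qy _.
      by rewrite ler_pXn2r ?nnegrE ?(ltW (e0 _)) // ler_expR ltW.
  by rewrite lee_fin -addrA lerD2l lerD2l ler_wpM2l.
have bE : be * (w - x) = S z (expR w) - S z (expR x) by rewrite /be mulfVK // gt_eqF.
rewrite /al; clearbody be; move: (S z (expR y)) (S z (expR x)) (S z (expR w)) bE => sy sx sw bE h.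
nra.
Qed.

End fixed_pole.

Lemma disc_sup_circle_le z z0 (r B : R) : 0 < r -> (forall q, sqn (psub q z) = r ^+ 2 -> (Phi q <= B%:E)%E) ->
  disc_sup 0 z0 z r <= B.
Proof.
move=> r0 h; apply: disc_sup_le => //; first exact: log_bounded0.
move=> q qr _; rewrite mul0r add0r.
(* The inner squared radius [-1] turns the annulus into the full disc and leaves its inner boundary
   empty. *)
have := @comparison R Phi PhiP z z0 0 B 0 (-1) (r ^+ 2) (lexx _) (lexx _) (or_introl erefl) (log_bounded0 Phi z0) _ q _ (off_pole0 z0 q).
rewrite !mul0r add0r addr0; apply; last by rewrite qr andbT; apply: le_trans (sqn_ge0 _).
move=> p [pE|pE] _; rewrite !mul0r add0r addr0; last exact: h.
by exfalso; have := sqn_ge0 (psub p z); rewrite pE; lra.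
Qed.

Section lelong_slopes.
Variables (z0 : R * R) (nu k : R).
Hypothesis slope_ge : forall x y, x < y -> nu * (y - x) <= disc_sup 0 z0 z0 (expR y) - disc_sup 0 z0 z0 (expR x).
Hypothesis slope_le : forall m, nu < m -> exists X, forall x y, x < y -> y <= X ->
  disc_sup 0 z0 z0 (expR y) - disc_sup 0 z0 z0 (expR x) <= m * (y - x).
Hypotheses (k0 : 0 <= k) (knu : k <= nu) (nuk : nu < k + 1).

Lemma disc_sup_le_log q (s : R) : 0 < s -> 0 < sqn (psub q z0) -> sqn (psub q z0) <= s ^+ 2 ->
  (Phi q <= (disc_sup 0 z0 z0 s + k * (logdist q z0 - ln s))%:E)%E.
Proof.
move=> s0 q0 qs.
have lq := logdist_le_ln q0 s0 qs.
have qE : sqn (psub q z0) = expR (logdist q z0) ^+ 2.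
  by rewrite /logdist -expRM_natl (_ : _ * _ = ln (sqn (psub q z0))) ?lnK //; field.
have := @disc_sup_ub 0 z0 (lexx 0) (log_bounded0 _ _) z0 (expR (logdist q z0)) q.
rewrite qE lexx mul0r add0r => /(_ isT (off_pole0 z0 q)) /le_trans; apply; rewrite lee_fin.
move: lq; rewrite le_eqVlt => /predU1P[->|lq]; first by rewrite lnK ?posrE // subrr mulr0 addr0.
have := slope_ge lq; rewrite lnK ?posrE //.
have : k * (ln s - logdist q z0) <= nu * (ln s - logdist q z0) by rewrite ler_wpM2r // subr_ge0 ltW.
lra.
Qed.

Lemma lelong_log_bounded : log_bounded Phi k z0.
Proof.
move=> _; exists (disc_sup 0 z0 z0 1), 1; split => // q /andP[q0 q1].
by have := disc_sup_le_log ltr01 q0 (ltW q1); rewrite ln1 subr0 addrC.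
Qed.

(** On the circle of radius [s] about the pole the logarithm is the constant [ln s], and the maximum
    principle for [Phi] restores the disc. In the other direction [k <= nu]: inside the disc [Phi]
    falls at least as fast as [k] times the logarithm. *)
Lemma disc_sup_center (s : R) : 0 < s -> disc_sup k z0 z0 s = disc_sup 0 z0 z0 s - k * ln s.
Proof.
move=> s0; apply/eqP; rewrite eq_le; apply/andP; split.
  apply: disc_sup_le => //; first exact: lelong_log_bounded.
  move=> q qs [kE|q0].
    have := @disc_sup_ub 0 z0 (lexx 0) (log_bounded0 _ _) z0 s q qs (off_pole0 z0 q).
    by rewrite kE !mul0r !add0r subr0.
  apply: le_trans (disc_sup_le_log s0 q0 qs) _; rewrite lee_fin; lra.
rewrite lerBlDr; apply: disc_sup_circle_le => // q qE.
have q0 : 0 < sqn (psub q z0) by rewrite qE exprn_gt0.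
have := disc_sup_ub k0 lelong_log_bounded (z := z0) (r := s) (q := q).
by rewrite qE lexx (logdistE s0 qE) addrC; apply => //; right.
Qed.

(** The slope bound holds at [z0] by definition of the Lelong number and must be made uniform in
    nearby centres [z]. Convexity bounds slopes below radius [2 * d] by the slope over the long
    interval up to [2 * d * L], and the inclusions of [D(z, 2 d L)] in [D(z0, expR X)] and of
    [D(z0, d)] in [D(z, 2 d)] compare that one with [z0]. They lengthen the logarithmic interval by
    at most [ln 3], and [L] is so large that this only raises the slope from [m0] to [m]. *)
Lemma disc_sup_local_slope : exists d m : R, [/\ 0 < d, 0 <= m, m < 1 &
  forall z, sqn (psub z z0) <= d ^+ 2 -> forall r s, 0 < r -> r < s -> s <= 2 * d ->
    disc_sup k z0 z s - disc_sup k z0 z r <= m * (ln s - ln r)].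
Proof.
(* Successive midpoints with [1], so that [nu - k < m0 < m < 1]. *)
have [m0 m0E] : exists m0 : R, m0 = (nu - k + 1) / 2 by eexists.
have [m mE] : exists m : R, m = (m0 + 1) / 2 by eexists.
have kn := knu; have nk := nuk.
have m00 : 0 < m0 by lra.
have m01 : m0 < 1 by lra.
have [X hX] := @slope_le (m0 + k) ltac:(lra).
have loc := lelong_log_bounded.
pose lL := m0 * ln 3 / (m - m0).
have mm0 : 0 < m - m0 by lra.
have ln3 : 0 < ln 3 :> R by rewrite ln_gt0 //; lra.
have lL0 : 0 < lL by rewrite divr_gt0 // mulr_gt0.
have [L LE] : exists L : R, L = expR lL by eexists.
have L1 : 1 < L by rewrite LE -expR0 ltr_expR.
have L0 : 0 < L by lra.
have [d dE] : exists d : R, d = expR X / (2 * L + 1) by eexists.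
have d0 : 0 < d by rewrite dE divr_gt0 ?expR_gt0 //; lra.
exists d, m; split => //; try lra.
move=> z zd r s r0 rs sd.
have s0 : 0 < s by exact: lt_trans rs.
have Ld : 2 * d < 2 * d * L by rewrite ltr_pMr // mulr_gt0.
have := @convex_slope_le R (fun x => disc_sup k z0 z (expR x)) (disc_sup_convex k0 loc z)
  (ln r) (ln s) (ln (2 * d)) (ln (2 * d * L)).
rewrite !lnK ?posrE ?mulr_gt0 ?expR_gt0 //.
have lLE : ln (2 * d * L) - ln (2 * d) = lL by rewrite lnM ?posrE ?mulr_gt0 // LE expRK; ring.
rewrite lLE ltr_ln ?posrE // ler_ln ?posrE ?mulr_gt0 // ltr_ln ?posrE ?mulr_gt0 ?expR_gt0 // => /(_ rs sd Ld) H.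
have h1 : disc_sup k z0 z (2 * d * L) <= disc_sup k z0 z0 (expR X).
  apply: (disc_sup_sub k0 loc _ (ltW d0) zd); first by rewrite !mulr_gt0 ?expR_gt0.
  by rewrite dE le_eqVlt; apply/orP; left; apply/eqP; field; rewrite gt_eqF //; lra.
have h2 : disc_sup k z0 z0 d <= disc_sup k z0 z (2 * d).
  apply: (disc_sup_sub k0 loc d0 (ltW d0)); first by rewrite sqn_psubC.
  lra.
have dX : d < expR X by rewrite dE ltr_pdivrMr ?ltr_pMr ?expR_gt0 //; lra.
have h3 : disc_sup k z0 z0 (expR X) - disc_sup k z0 z0 d <= m0 * (X - ln d).
  rewrite !disc_sup_center ?expR_gt0 // expRK.
  have := hX (ln d) X; rewrite lnK ?posrE // => /(_ _ (lexx _)) h.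
  have : ln d < X by rewrite -(expRK X) ltr_ln ?posrE ?expR_gt0.
  move=> /h; lra.
have h4 : X - ln d <= lL + ln 3.
  rewrite dE lnM ?posrE ?invr_gt0 ?expR_gt0 //; last lra.
  rewrite lnV ?posrE; last lra.
  rewrite expRK -[lL](expRK) -LE -lnM ?posrE ?expR_gt0 //.
  have : ln (2 * L + 1) <= ln (L * 3) by rewrite ler_ln ?posrE ?mulr_gt0 ?expR_gt0 //; lra.
  lra.
have h5 : m0 * (lL + ln 3) = m * lL by rewrite /lL; field; rewrite gt_eqF.
rewrite -(ler_pM2r lL0); apply: le_trans H _.
rewrite [leRHS]mulrAC; apply: ler_wpM2r; first by rewrite subr_ge0 ler_ln ?posrE //; exact: ltW.
have : m0 * (X - ln d) <= m0 * (lL + ln 3) by rewrite ler_wpM2l // ltW.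
lra.
Qed.

End lelong_slopes.
End disc_supremum.

(** * Integrability of the weight along the graph *)

Section local_weight.
Context {R : realType}.
Implicit Types (p q z : R * R).
Local Notation mu := (@leb R).
Local Notation mu2 := (@leb2 R).
Variables (Phi : R * R -> \bar R) (PhiP : subharmonic_plane Phi).
Variables (k : R) (z0 : R * R) (d m : R).
Hypotheses (k0 : 0 <= k) (loc : log_bounded Phi k z0) (d0 : 0 < d) (m0 : 0 <= m) (m1 : m < 1).
Hypothesis slope : forall z, sqn (psub z z0) <= d ^+ 2 -> forall r s : R, 0 < r -> r < s -> s <= 2 * d ->
  disc_sup Phi k z0 z s - disc_sup Phi k z0 z r <= m * (ln s - ln r).
Local Notation S := (disc_sup Phi k z0).

Definition odisc z (r : R) : set (R * R) := [set q | sqn (psub q z) < r ^+ 2].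

Lemma measurable_odisc z r : measurable (odisc z r).
Proof.
have := (measurableT_comp (@measurable_sqn R) (measurable_psubr z)) measurableT _ (measurable_itv `]-oo, r ^+ 2[).
by rewrite setTI; congr measurable; apply/seteqP; split => p /=; rewrite in_itv.
Qed.

Let defect (M : R) (A : set (R * R)) : R * R -> \bar R := (fun q => M%:E - Phi q)%E \_ A.

Let measurable_defect M A : measurable A -> measurable_fun setT (defect M A).
Proof.
move=> mA; apply/(measurable_restrictT _ mA); apply: measurable_funTS; apply: emeasurable_funB => //.
exact: measurable_subharmonic_plane.
Qed.

Let defect_ge0 (M : R) A : (forall q, A q -> (Phi q <= M%:E)%E) -> forall q, (0 <= defect M A q)%E.
Proof.
move=> AM q; rewrite /defect patchE; case: ifPn => // /set_mem /AM h; rewrite sube_ge0 //.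
by apply/orP; right.
Qed.

(** An upper bound for [Phi] on the disc of radius [12 * r], obtained by replacing [k log |. - z0|]
    with its largest value when the pole is within [2 * D]. *)
Let top z (r D : R) := S z (12 * r) + k * ln (2 * D).
(** Three losses: [m * ln 12] for passing from radius [r] to [12 * r], [1] for a near maximum
    instead of a maximum, and [k * ln 4] for the oscillation of [k log |. - z0|] between distances
    [D / 2] and [2 * D]. *)
Let C0 := m * ln 12 + 1 + k * ln 4.

Let C00 : 0 <= C0.
Proof. by rewrite !addr_ge0 // mulr_ge0 // ln_ge0 //; lra. Qed.

Let le_top z (r D : R) q : 0 < D -> 0 < sqn (psub q z0) -> sqn (psub q z0) <= (2 * D) ^+ 2 ->
  sqn (psub q z) <= (12 * r) ^+ 2 -> (Phi q <= (top z r D)%:E)%E.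
Proof.
move=> D0 q0 qD qr; apply: le_trans (disc_sup_ub PhiP k0 loc qr _) _; first by right.
rewrite lee_fin addrC lerD2l ler_wpM2l // logdist_le_ln // mulr_gt0 //.
Qed.

(** At a near maximum [zs] within [2 * r] of [z] the defect is at most [C0], hence so is its average
    over the disc of radius [10 * r] about [zs]. That disc contains [D(z, 8 r)] and lies in
    [D(z, 12 r)]; its area is at most [4 * (10 * r) ^ 2], which gives the factor [20 * 20]. *)
Let disc_defect z (r D : R) : 0 < r -> 0 < D -> sqn (psub z z0) <= d ^+ 2 -> 12 * r <= 2 * d ->
  (forall q, sqn (psub q z) <= (12 * r) ^+ 2 -> (D / 2) ^+ 2 <= sqn (psub q z0) <= (2 * D) ^+ 2) ->
  (\int[mu2]_p defect (top z r D) (odisc z (8 * r)) p <= (20 * 20 * C0 * r ^+ 2)%:E)%E.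
Proof.
move=> r0 D0 zd rd hD.
have D20 : 0 < (D / 2) ^+ 2 by rewrite exprn_gt0 // divr_gt0.
have [zs [zsr zsp zsM]] := disc_sup_near_max PhiP k0 loc z r0.
have sub8 : odisc z (8 * r) `<=` odisc z (12 * r).
  by move=> q; apply: lt_sqr_trans; rewrite ?mulr_ge0 ?ler_pM2r // ?ler_nat // ltW.
have zsr2 : sqn (psub zs z) < (2 * r) ^+ 2.
  by apply: le_lt_trans zsr _; rewrite ltr_pXn2r ?nnegrE ?ltr_pMl ?mulr_ge0 ?(ltW r0) //; lra.
have AM q : odisc z (12 * r) q -> (Phi q <= (top z r D)%:E)%E.
  move=> /ltW qz; have /andP[h1 h2] := hD q qz.
  by apply: le_top => //; apply: lt_le_trans h1.
have r10 : 0 < 10 * r by rewrite mulr_gt0.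
have mA := measurable_odisc z (12 * r).
have h1 : (avg (10 * r) (defect (top z r D) (odisc z (12 * r))) zs <= C0%:E)%E.
  apply: le_trans (avg_supermean PhiP r10 mA _ AM) _ => [p hp|].
    rewrite /odisc /=; have -> : psub (padd zs p) z = padd (psub zs z) p.
      by rewrite /psub /padd /=; congr pair; ring.
    have r2 : 0 < 2 * r by rewrite mulr_gt0.
    by have := sqn_padd_lt r2 r10 zsr2 hp; rewrite -mulrDl -natrD.
  have ld : ln (D / 2) <= logdist zs z0.
    apply: logdist_ge_ln; first exact: divr_gt0.
    have zs12 : sqn (psub zs z) <= (12 * r) ^+ 2.
      by apply: le_trans (ltW zsr2) _; rewrite ler_pXn2r ?nnegrE ?ler_pM2r ?mulr_ge0 ?(ltW r0) // ler_nat.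
    by have /andP[] := hD zs zs12.
  have sl := slope zd r0 _ rd; have {}sl := sl ltac:(by rewrite ltr_pMl //; lra).
  move: sl; rewrite lnM ?posrE // => sl.
  move: ld; rewrite ln_div ?posrE // => ld.
  have ln4 : ln (4 : R) = ln 2 + ln 2 by rewrite -lnM ?posrE //; congr ln; ring.
  have [Phiy _ _ _] := PhiP; move: zsM; have := Phiy zs.
  case: (Phi zs) => [x _|//|_]; last by rewrite leeNy_eq.
  rewrite -EFinB !lee_fin => h.
  rewrite /top /C0 ln4 lnM ?posrE //.
  have : k * (ln D - ln 2) <= k * logdist zs z0 by rewrite ler_wpM2l.
  lra.
have h2 : (\int[mu2]_p defect (top z r D) (odisc z (8 * r)) p <=
    (darea (10 * r))%:E * avg (10 * r) (defect (top z r D) (odisc z (12 * r))) zs)%E.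
  have mD := measurable_defect (top z r D) mA; have D0' := defect_ge0 AM.
  have mk : measurable_fun setT (fun q => (kern (10 * r) (psub q zs))%:E).
    by apply/measurable_EFinP; apply: (measurableT_comp (measurable_kern _)); exact: measurable_psubr.
  have kq q : (0 <= (kern (10 * r) (psub q zs))%:E)%E by rewrite lee_fin kern_ge0.
  rewrite avgE_sub // -ge0_integralZl_EFin //; last 3 first.
  - by move=> q _; rewrite mule_ge0.
  - exact: emeasurable_funM.
  - by rewrite ltW // darea_gt0.
  apply: ge0_le_integral => //.
  - by move=> q _; apply: defect_ge0 => {}q /sub8 /AM.
  - exact: measurable_defect (measurable_odisc _ _).
  - by apply: measurable_funeM; exact: emeasurable_funM.
  move=> q _; rewrite {1}/defect patchE; case: ifPn => [/set_mem q8|_]; last first.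
    by rewrite !mule_ge0 // lee_fin ltW // darea_gt0.
  rewrite /defect patchE mem_set; last exact: sub8.
  rewrite kernE.
    rewrite muleCA -EFinM divff ?gt_eqF ?darea_gt0 // mule1 //.
  have -> : psub q zs = padd (psub q z) (psub z zs) by rewrite /psub /padd /=; congr pair; ring.
  have r8 : 0 < 8 * r by rewrite mulr_gt0.
  have r2 : 0 < 2 * r by rewrite mulr_gt0.
  rewrite sqn_psubC in zsr2.
  by have := sqn_padd_lt r8 r2 q8 zsr2; rewrite -mulrDl -natrD.
apply: le_trans h2 _; apply: (@le_trans _ _ ((darea (10 * r))%:E * C0%:E)%E).
  by apply: lee_wpmul2l => //; rewrite lee_fin ltW // darea_gt0.
rewrite -EFinM lee_fin (_ : 20 * 20 * C0 * r ^+ 2 = 4 * (10 * r) ^+ 2 * C0); last by ring.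
by apply: ler_wpM2r => //; exact: darea_le.
Qed.

Variables (y : R -> R) (my : measurable_fun setT y).

(** This is [|. - z0| ^ k] times [exp (- Phi)] along the graph, except that [ln 0 = 0] makes the
    first factor [1] at the pole. *)
Definition pole_weight (t : R) : \bar R :=
  ((expR (k * logdist (t, y t) z0))%:E * expeR (- Phi (t, y t)))%E.

Lemma measurable_pole_weight : measurable_fun setT pole_weight.
Proof.
have mg : measurable_fun setT (fun t => (t, y t)) by exact: measurable_fun_pair.
apply: emeasurable_funM.
  apply/measurable_EFinP; apply: measurableT_comp => //; apply: measurable_funM => //.
  apply: measurable_funM => //; apply: measurableT_comp => //.
  apply: (measurableT_comp (@measurable_sqn R)); exact: (measurableT_comp (measurable_psubr z0) mg).
apply: (measurableT_comp (@measurable_expeR R)); apply: measurableT_comp => //.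
exact: (measurableT_comp (measurable_subharmonic_plane PhiP) mg).
Qed.

Lemma pole_weight_ge0 t : (0 <= pole_weight t)%E.
Proof. by rewrite /pole_weight mule_ge0 ?expeR_ge0 // lee_fin expR_ge0. Qed.

(** [C1] adds to the mass bound of [disc_defect] the loss [m * ln 2] of [top_diff]; [C2] is the
    constant of [local_exp_bound_aux]; [K1] fixes the normalisation at the unit scale [d]. *)
Let C1 := 20 * 20 * C0 + m * ln 2.
Let C2 := 2 * expR C1 + C1 * expR C1 * expR (m * ln 2) / 3 / (1 - expR (m * ln 2) / 2).
Let K1 := expR (- S z0 (d / 2) + m * ln d).

Let ml2 : 0 <= m * ln 2.
Proof. by rewrite mulr_ge0 // ln_ge0 //; lra. Qed.

Let C10 : 0 <= C1.
Proof. by apply: addr_ge0 => //; apply: mulr_ge0; [rewrite mulr_ge0|exact: C00]. Qed.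

Let C20 : 0 <= C2.
Proof.
have el2 : expR (m * ln 2) < 2.
  rewrite -[ltRHS](@lnK R) ?posrE // ltr_expR gtr_pMl // ln_gt0 //; lra.
apply: addr_ge0; first by rewrite mulr_ge0 // expR_ge0.
apply: divr_ge0; last lra.
by apply: divr_ge0 => //; apply: mulr_ge0; [apply: mulr_ge0 => //|]; exact: expR_ge0.
Qed.

Section one_disc.
Variables (w0 : R * R) (rho D : R).
(** [28 * rho <= D] keeps all discs of radius [14 * rho] about [w0] at distance at least [D / 2]
    from the pole, and [2 * D <= d] keeps their centres where the slope bound holds. *)
Hypothesis small : [/\ 0 < rho, 0 < D, 28 * rho <= D & 2 * D <= d].
Hypothesis wD : sqn (psub w0 z0) = D ^+ 2.
Let B := odisc w0 (8 * rho).
Let M0 := top w0 rho D.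
Let v := defect M0 B.

Let zD z (r : R) : 0 <= r -> sqn (psub z w0) <= r ^+ 2 -> r <= D / 2 ->
  (D / 2) ^+ 2 <= sqn (psub z z0) <= (2 * D) ^+ 2.
Proof.
have [rho0 D0 rhoD Dd] := small; move=> r0 zw rD; apply/andP; split.
  rewrite leNgt; apply/negP => h.
  rewrite sqn_psubC in zw.
  have D20 : 0 <= D / 2 by lra.
  have [s [s0 sE sD]] : exists s : R, [/\ 0 <= s, sqn (psub z z0) = s ^+ 2 & s < D / 2].
    exists (Num.sqrt (sqn (psub z z0))); rewrite sqrtr_ge0 sqr_sqrtr ?sqn_ge0 //; split => //.
    by rewrite -(ger0_norm D20) -sqrtr_sqr ltr_sqrt // exprn_gt0 //; lra.
  have := sqn_triangle r0 s0 zw (eq_ind_r (fun x => x <= _) (lexx _) sE).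
  rewrite wD ler_pXn2r ?nnegrE ?(ltW D0) ?addr_ge0 //; lra.
have := sqn_triangle r0 (ltW D0) zw (eq_ind_r (fun x => x <= _) (lexx _) wD).
move=> /le_trans; apply; rewrite ler_pXn2r ?nnegrE ?addr_ge0 ?mulr_ge0 ?(ltW D0) //; lra.
Qed.

Let D24 : 0 < (D / 2) ^+ 2.
Proof. by have [_ D0 _ _] := small; rewrite exprn_gt0 // divr_gt0. Qed.

Let mB : measurable B. Proof. exact: measurable_odisc. Qed.

Let BM q : B q -> (Phi q <= M0%:E)%E.
Proof.
have [rho0 D0 rhoD Dd] := small; move=> Bq.
have r8 : 0 < 8 * rho by rewrite mulr_gt0.
have /andP[h1 h2] := zD (ltW r8) (ltW Bq) ltac:(lra).
apply: le_top => //; first exact: lt_le_trans h1.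
by apply: ltW; apply: lt_sqr_trans Bq; [exact: ltW|rewrite ler_pM2r // ler_nat].
Qed.

Let mv : measurable_fun setT v. Proof. exact: measurable_defect. Qed.
Let v0 q : (0 <= v q)%E. Proof. exact: defect_ge0. Qed.
Let vE q : B q -> v q = (M0%:E - Phi q)%E.
Proof. by move=> Bq; rewrite /v /defect patchE mem_set. Qed.

Let Dw : sqn (psub w0 z0) <= d ^+ 2.
Proof. by have [rho0 D0 rhoD Dd] := small; rewrite wD ler_pXn2r // ?nnegrE ?(ltW D0) ?(ltW d0) //; lra. Qed.

Let B_padd z p (r s : R) : 0 < r -> 0 < s -> r + s <= 8 * rho ->
  sqn (psub z w0) < r ^+ 2 -> sqn p < s ^+ 2 -> B (padd z p).
Proof.
move=> r0 s0 rs zw hp; rewrite /B /odisc /=.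
have -> : psub (padd z p) w0 = padd (psub z w0) p by rewrite /psub /padd /=; congr pair; ring.
by apply: lt_sqr_trans (sqn_padd_lt r0 s0 zw hp) => //; rewrite addr_ge0 // ltW.
Qed.

Let vint : (\int[mu2]_p v p <= (C1 * rho ^+ 2)%:E)%E.
Proof.
have [rho0 D0 rhoD Dd] := small.
apply: le_trans (disc_defect rho0 D0 Dw _ _) _; first lra.
  move=> q hq; apply: zD hq _; first by rewrite mulr_ge0 // ltW.
  lra.
by rewrite lee_fin ler_wpM2r ?sqr_ge0 // /C1; have := ml2; lra.
Qed.

Let vlsc z (c : R) : sqn (psub z w0) < rho ^+ 2 -> (c%:E < v z)%E ->
  exists2 e : R, 0 < e & forall p, sqn p < e ^+ 2 -> (c%:E <= v (padd z p))%E.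
Proof.
have [rho0 D0 rhoD Dd] := small; have [Phiy Phiu _ _] := PhiP.
move=> zw; have Bz : B z by apply: lt_sqr_trans zw; [exact: ltW|rewrite ler_peMl ?(ltW rho0) //; lra].
rewrite vE // => cv; have : (Phi z < (M0 - c)%:E)%E.
  move: cv; have := Phiy z; case: (Phi z) => [x| |] //; rewrite -?EFinB ?lte_fin ?ltNyr //; lra.
move=> /Phiu[e e0 he]; exists (Num.min e rho) => [|p hp]; first by rewrite lt_min e0.
have mn0 : 0 <= Num.min e rho by rewrite le_min !ltW.
have psE : psub (padd z p) z = p by rewrite /psub /padd /= [RHS]surjective_pairing; congr pair; ring.
have hp1 : sqn p < e ^+ 2 by apply: lt_sqr_trans hp; rewrite // ge_min lexx.
have hp2 : sqn p < rho ^+ 2 by apply: lt_sqr_trans hp; rewrite // ge_min lexx orbT.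
have := he (padd z p); rewrite psE => /(_ hp1) {}he.
have rr : rho + rho <= 8 * rho by lra.
rewrite vE; last exact: (B_padd rho0 rho0 rr zw hp2).
move: he; have := Phiy (padd z p); case: (Phi _) => [x| |] //; rewrite -?EFinB ?lte_fin ?lee_fin //=; last by rewrite leey.
lra.
Qed.

Let vsm z (r : R) : sqn (psub z w0) < (4 * rho) ^+ 2 -> 0 < r <= rho -> (avg r v z <= v z)%E.
Proof.
have [rho0 D0 rhoD Dd] := small; move=> zw /andP[r0 rr].
have r4 : 0 < 4 * rho by rewrite mulr_gt0.
rewrite vE; last by apply: lt_sqr_trans zw; rewrite ?ler_pM2r ?ler_nat // ltW.
apply: (avg_supermean PhiP r0 mB _ BM) => p hp.
have rs : 4 * rho + r <= 8 * rho by lra.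
exact: B_padd r4 r0 rs zw hp.
Qed.

(** [D(w0, 12 rho)] lies in [D(z, 14 rho)], and the slope bound descends from [14 * rho] to
    [12 * r]; the ratio [14 / 12] is absorbed in [ln 2]. *)
Let top_diff z (r : R) : sqn (psub z w0) < (2 * rho) ^+ 2 -> sqn (psub z z0) <= d ^+ 2 -> 0 < r -> r <= rho ->
  M0 - top z r D <= m * ln 2 + m * ln (rho / r).
Proof.
have [rho0 D0 rhoD Dd] := small; move=> zw zd r0 rr.
have hw : S w0 (12 * rho) <= S z (14 * rho).
  apply: (disc_sup_sub PhiP k0 loc (d := 2 * rho)); rewrite ?mulr_gt0 //.
  - by rewrite mulr_ge0 // ltW.
  - by rewrite sqn_psubC ltW.
  - lra.
have h1 : 0 < 12 * r by lra.
have h2 : 12 * r < 14 * rho by lra.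
have h3 : 14 * rho <= 2 * d by lra.
have := slope zd h1 h2 h3.
have : ln (14 * rho) - ln (12 * r) <= ln 2 + ln (rho / r).
  have q0 : 0 < rho / r by exact: divr_gt0.
  have r14 : 0 < 14 * rho by rewrite mulr_gt0.
  rewrite -ln_div ?posrE // -lnM ?posrE // ler_ln ?posrE ?mulr_gt0 ?invr_gt0 //.
  rewrite ler_pdivrMr // (_ : 2 * (rho / r) * (12 * r) = 24 * rho); last by field; rewrite gt_eqF.
  by rewrite ler_pM2r // ler_nat.
by move=> /(ler_wpM2l m0); rewrite /M0 /top => h4 h5; move: h4 h5 hw; lra.
Qed.

(** Near [z] the function [v] is at most [M0 - top z r D] plus the defect adapted to scale [r]. The
    first is controlled by [top_diff], the average of the second by its mass over an area of at
    least [r ^ 2]. *)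
Let vbd z (r : R) : sqn (psub z w0) < (2 * rho) ^+ 2 -> 0 < r <= rho ->
  (avg r v z <= (C1 + m * ln (rho / r))%:E)%E.
Proof.
have [rho0 D0 rhoD Dd] := small; move=> zw /andP[r0 rr].
have r2 : 0 < 2 * rho by rewrite mulr_gt0.
have hD q : sqn (psub q z) <= (12 * r) ^+ 2 -> (D / 2) ^+ 2 <= sqn (psub q z0) <= (2 * D) ^+ 2.
  move=> qz; have r12 : 0 <= 12 * r by rewrite mulr_ge0 // ltW.
  have h := sqn_triangle r12 (ltW r2) qz (ltW zw).
  by apply: zD h _; [rewrite addr_ge0 // ltW|lra].
have zd : sqn (psub z z0) <= d ^+ 2.
  have /andP[_ h] := hD z ltac:(by rewrite sqn_psub_self sqr_ge0).
  by apply: le_trans h _; rewrite ler_pXn2r ?nnegrE // ?mulr_ge0 // ltW.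
pose vr := defect (top z r D) (odisc z (8 * r)).
have rd : 12 * r <= 2 * d by lra.
have dd := disc_defect r0 D0 zd rd hD.
have mvr : measurable_fun setT vr by exact: measurable_defect (measurable_odisc _ _).
have vr0 q : (0 <= vr q)%E.
  apply: defect_ge0 => {}q qz.
  have qz12 : sqn (psub q z) <= (12 * r) ^+ 2.
    by apply: ltW; apply: lt_sqr_trans qz; rewrite ?ler_pM2r ?mulr_ge0 ?ler_nat // ltW.
  have /andP[h1 h2] := hD q qz12.
  by apply: le_top => //; exact: lt_le_trans h1.
have lr0 : 0 <= ln (rho / r) by rewrite ln_ge0 // ler_pdivlMr // mul1r.
have [C' C'E] : exists C' : R, C' = m * ln 2 + m * ln (rho / r) by eexists.
have C'0 : 0 <= C' by rewrite C'E addr_ge0 // mulr_ge0.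
have topC : M0 - top z r D <= C' by rewrite C'E; exact: top_diff.
apply: (@le_trans _ _ (avg r (fun q => C'%:E + vr q)%E z)).
  apply: le_avg => //; first by apply: emeasurable_funD.
  move=> p hp; rewrite vE.
    rewrite /vr /defect patchE mem_set; last first.
      rewrite /odisc /= (_ : psub _ _ = p); last by rewrite /psub /padd /= [RHS]surjective_pairing; congr pair; ring.
      by apply: lt_sqr_trans hp; [exact: ltW|rewrite ler_peMl ?(ltW r0) //; lra].
    have [Phiy _ _ _] := PhiP.
    by move: (Phiy (padd z p)) topC; case: (Phi _) => [x| |] //= _ h; rewrite -?EFinB -?EFinD ?lee_fin ?leey //; lra.
  have rs : 2 * rho + r <= 8 * rho by lra.
  exact: B_padd r2 r0 rs zw hp.
rewrite avg_add // avg_cst // (_ : C1 + m * ln (rho / r) = C' + 20 * 20 * C0); last by rewrite /C1 C'E; ring.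
rewrite [leRHS]EFinD; apply: leeD => //.
apply: le_trans (avg_le_integral r0 z mvr vr0) _.
have da := darea_ge r0; have da0 := darea_gt0 r0.
apply: (@le_trans _ _ (((darea r)^-1)%:E * (20 * 20 * C0 * r ^+ 2)%:E)%E).
  by apply: lee_wpmul2l => //; rewrite lee_fin invr_ge0 ltW.
rewrite -EFinM lee_fin mulrC ler_pdivrMr //; apply: ler_wpM2l => //.
by apply: mulr_ge0; [rewrite mulr_ge0|exact: C00].
Qed.

Let c := expR (- S w0 (12 * rho)).

(** On the disc [|. - z0| <= 2 * D], so the power of the distance is cancelled by the term
    [k * ln (2 * D)] of [M0]. *)
Let pole_weight_le t : graph_disc y w0 rho t -> (pole_weight t <= c%:E * expeR (v (t, y t)))%E.
Proof.
have [rho0 D0 rhoD Dd] := small; move=> gt; have Bt : B (t, y t).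
  by apply: lt_sqr_trans gt; [exact: ltW|rewrite ler_peMl ?(ltW rho0) //; lra].
have /andP[h1 h2] := zD (ltW rho0) (ltW gt) ltac:(lra).
have q0 : 0 < sqn (psub (t, y t) z0) by exact: lt_le_trans h1.
have D2 : 0 < 2 * D by rewrite mulr_gt0.
have lt := logdist_le_ln q0 D2 h2.
rewrite vE // /pole_weight.
have -> : expeR (- Phi (t, y t)) = ((expR (- M0))%:E * expeR (M0%:E - Phi (t, y t)))%E.
  have [Phiy _ _ _] := PhiP.
  have := Phiy (t, y t); case: (Phi _) => [x| |] //= _.
    by rewrite -EFinM -expRD; congr (expR _)%:E; ring.
  by rewrite gt0_muley // lte_fin expR_gt0.
rewrite muleA -EFinM -expRD; apply: lee_wpmul2r; first exact: expeR_ge0.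
rewrite lee_fin ler_expR /M0 /top.
by have := ler_wpM2l k0 lt; lra.
Qed.

(** Between radii [12 * rho] and [d] the supremum drops by at most [m] times the logarithm of the
    ratio, so [c] grows at most like [rho ^ (- m)]. Multiplied by [C2 * rho] this gives a positive
    power of [rho], which is what makes the discs summable. *)
Let c_le : c <= K1 * expR (- m * ln rho).
Proof.
have [rho0 D0 rhoD Dd] := small; rewrite /c /K1 -expRD ler_expR.
have h1 : S z0 (d / 2) <= S w0 d.
  apply: (disc_sup_sub PhiP k0 loc (d := D)); rewrite ?(ltW D0) ?divr_gt0 //; last lra.
  by rewrite sqn_psubC wD.
have g1 : 0 < 12 * rho by lra.
have g2 : 12 * rho < d by lra.
have g3 : d <= 2 * d by lra.
have := slope Dw g1 g2 g3; rewrite lnM ?posrE // => h2.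
have h3 : 0 <= m * ln 12 by rewrite mulr_ge0 // ln_ge0 //; lra.
by move: h1 h2 h3; lra.
Qed.

Lemma pole_weight_one_disc :
  (\int[mu]_(t in graph_disc y w0 rho) pole_weight t <= (K1 * C2 * expR ((1 - m) * ln rho))%:E)%E.
Proof.
have [rho0 D0 rhoD Dd] := small.
have key := local_exp_bound_aux my mv v0 rho0 m1 C10 vlsc vsm vint vbd.
have mg : measurable (graph_disc y w0 rho) by exact: measurable_graph_disc.
have mve : measurable_fun setT (fun t => expeR (v (t, y t))).
  apply: (measurableT_comp (@measurable_expeR R)); apply: (measurableT_comp mv).
  exact: measurable_fun_pair.
apply: (@le_trans _ _ (\int[mu]_(t in graph_disc y w0 rho) (c%:E * expeR (v (t, y t))))%E).
  apply: ge0_le_integral => //.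
  - by move=> t _; exact: pole_weight_ge0.
  - by apply: measurable_funTS; exact: measurable_pole_weight.
  - by apply: measurable_funeM; exact: measurable_funTS.
rewrite ge0_integralZl_EFin //; last 3 first.
- by move=> t _; exact: expeR_ge0.
- exact: measurable_funTS.
- exact: expR_ge0.
apply: (@le_trans _ _ (c%:E * (C2 * rho)%:E)%E).
  by apply: lee_wpmul2l => //; rewrite lee_fin expR_ge0.
rewrite -EFinM lee_fin.
have -> : K1 * C2 * expR ((1 - m) * ln rho) = K1 * expR (- m * ln rho) * (C2 * rho).
  have -> : (1 - m) * ln rho = - m * ln rho + ln rho by ring.
  by rewrite expRD lnK ?posrE //; ring.
by apply: ler_wpM2r c_le; rewrite mulr_ge0 // ltW.
Qed.

End one_disc.

Lemma pole_weight_disc : exists K : R, 0 <= K /\ forall w0 (rho D : R), 0 < rho -> 0 < D ->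
  sqn (psub w0 z0) = D ^+ 2 -> 28 * rho <= D -> 2 * D <= d ->
  (\int[mu]_(t in graph_disc y w0 rho) pole_weight t <= (K * expR ((1 - m) * ln rho))%:E)%E.
Proof.
exists (K1 * C2); split; first by apply: mulr_ge0; [exact: expR_ge0|exact: C20].
by move=> w0 rho D rho0 D0 wD rhoD Dd; apply: (@pole_weight_one_disc w0 rho D).
Qed.

End local_weight.

(** * Finiteness of integrals from coverings *)

Section finite_integrals.
Context {R : realType}.
Local Notation mu := (@leb R).
Variables (F : R -> \bar R) (mF : measurable_fun setT F) (F0 : forall t, (0 <= F t)%E).

Lemma integral_leb_set1 (a : R) : (\int[mu]_(t in [set a]) F t = 0)%E.
Proof.
have -> := @ge0_integral_leb R [set a] F (measurable_set1 a) (measurable_funTS mF) (fun t _ => F0 t).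
exact: integral_set1.
Qed.

Lemma integral_setU_lty (A B : set R) : measurable A -> measurable B ->
  (\int[mu]_(t in A) F t < +oo -> \int[mu]_(t in B) F t < +oo -> \int[mu]_(t in A `|` B) F t < +oo)%E.
Proof.
move=> mA mB hA hB; have -> : A `|` B = A `|` (B `\` A) by rewrite setDE setUIr setUv setIT.
have mBA : measurable (B `\` A) by exact: measurableD.
rewrite ge0_integral_setU //; last 2 first.
- exact: measurable_funTS.
- by apply/disj_setPS => t [At [_ /(_ At)]].
apply: lte_add_pinfty => //; apply: le_lt_trans hB; apply: ge0_subset_integral => //.
exact: measurable_funTS.
Qed.

Lemma integral_subset_lty (A B : set R) : measurable A -> measurable B -> A `<=` B ->
  (\int[mu]_(t in B) F t < +oo -> \int[mu]_(t in A) F t < +oo)%E.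
Proof.
move=> mA mB AB hB; apply: le_lt_trans hB; apply: ge0_subset_integral => //.
exact: measurable_funTS.
Qed.

Lemma integral_geometric_cover (A : set R) (G : nat -> set R) (c q : R) : measurable A ->
  (forall n, measurable (G n)) -> A `<=` \bigcup_n G n -> 0 <= c -> 0 <= q -> q < 1 ->
  (forall n, (\int[mu]_(t in G n) F t <= (c * q ^+ n)%:E)%E) -> (\int[mu]_(t in A) F t < +oo)%E.
Proof.
move=> mA mG AG c0 q0 q1 hG.
have mFG n : measurable_fun setT (F \_ (G n)).
  by apply/(measurable_restrictT _ (mG n)); exact: measurable_funTS.
have FG0 n t : (0 <= (F \_ (G n)) t)%E by rewrite patchE; case: ifP.
apply: (@le_lt_trans _ _ (\int[mu]_t \sum_(n <oo) (F \_ (G n)) t)%E).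
  rewrite integral_mkcond; apply: ge0_le_integral => //.
  - by move=> t _; rewrite patchE; case: ifP.
  - by apply/(measurable_restrictT _ mA); exact: measurable_funTS.
  - by apply: ge0_emeasurable_sum.
  move=> t _; rewrite patchE; case: ifPn => [/set_mem /AG [n _ Gn]|_]; last exact: nneseries_ge0.
  apply: le_trans (nneseries_lim_ge n.+1 _) => //.
  rewrite big_nat_recr //= [(F \_ (G n)) t]patchE mem_set // leeDr //.
  exact: sume_ge0.
rewrite integral_nneseries //.
apply: (@le_lt_trans _ _ (c / (1 - q))%:E); last exact: ltry.
apply: lime_le; first by apply: is_cvg_nneseries => n _ _; exact: integral_ge0.
near=> N; rewrite big_mkord.
apply: (@le_trans _ _ (\sum_(i < N) (c * q ^+ i)%:E)%E).
  by apply: lee_sum => i _; rewrite -integral_mkcond.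
rewrite sumEFin lee_fin -mulr_sumr; apply: ler_wpM2l => //; rewrite -div1r ler_pdivlMr ?subr_gt0 //.
have := subrX1 q N; have := exprn_ge0 N q0; rewrite mulrC; lra.
Unshelve. all: by end_near.
Qed.

(** Continuous induction: local finiteness at the supremum of the points reached with finite
    integral pushes it further, unless [b] is already reached. *)
Lemma integral_segment_lty (a b : R) : a < b ->
  (forall t0, a <= t0 <= b -> exists2 d : R, 0 < d &
     (\int[mu]_(t in `[a, b]%classic `&` `](t0 - d)%R, (t0 + d)%R[%classic) F t < +oo)%E) ->
  (\int[mu]_(t in `[a, b]) F t < +oo)%E.
Proof.
move=> ab hloc.
pose U := [set x : R | a <= x <= b /\ (\int[mu]_(t in `[a, x]) F t < +oo)%E].
have Ua : U a.
  split; first by rewrite lexx ltW.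
  by rewrite set_itv1 integral_leb_set1 ltry.
have hU : has_sup U by split; [exists a|exists b => x [/andP[]]].
pose c := sup U.
have ac : a <= c by apply: sup_upper_bound.
have cb : c <= b by apply: ge_sup; [exists a|move=> x [/andP[]]].
have [d d0 hd] := hloc c ltac:(by rewrite ac cb).
have [x Ux cx] := @sup_adherent R U d d0 hU.
have xc : x <= c by apply: sup_upper_bound.
case: Ux => /andP[ax xb] fx.
have step z : a <= z -> z <= b -> z < c + d -> U z.
  move=> az zb zc; split; first by rewrite az zb.
  have mI : measurable (`[a, b]%classic `&` `]c - d, c + d[%classic : set R) by exact: measurableI.
  apply: (integral_subset_lty _ _ _ (integral_setU_lty _ mI fx hd)) => //.
    by apply: measurableU.
  move=> t /=; rewrite !in_itv /= => /andP[h1 h2].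
  have [tx|tx] := leP t x; first by left; rewrite h1.
  right; split; first by rewrite h1 (le_trans h2).
  apply/andP; split; last exact: le_lt_trans zc.
  by apply: le_lt_trans tx; rewrite -/c in cx; lra.
have [bc|cb'] := leP b (c + d / 2).
  by case: (step b (ltW ab) (lexx _) ltac:(lra)).
have := @sup_upper_bound R U hU (c + d / 2) (step (c + d / 2) ltac:(lra) (ltW cb') ltac:(lra)).
by move=> h; exfalso; move: h; rewrite -/c; lra.
Qed.

End finite_integrals.

Section weight_near_pole.
Context {R : realType}.
Local Notation mu := (@leb R).
Variables (Phi : R * R -> \bar R) (PhiP : subharmonic_plane Phi).
Variables (y : R -> R) (my : measurable_fun setT y) (L : R).
Hypothesis ylip : forall s t, `|y s - y t| <= L * `|s - t|.

Let L0 : 0 <= L.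
Proof. by have := ylip 1 0; rewrite subr0 normr1 mulr1; apply: le_trans. Qed.

Let sqn_lip (s t h : R) : `|s - t| <= h -> sqn (psub (s, y s) (t, y t)) <= ((1 + L) * h) ^+ 2.
Proof.
move=> sh; have h0 : 0 <= h by apply: le_trans sh.
have yh : `|y s - y t| <= L * h by apply: le_trans (ylip s t) _; rewrite ler_wpM2l.
have h1 : (s - t) ^+ 2 <= h ^+ 2 by rewrite -real_normK ?num_real // ler_pXn2r // nnegrE.
have h2 : (y s - y t) ^+ 2 <= (L * h) ^+ 2.
  by rewrite -[leLHS]real_normK ?num_real // ler_pXn2r // nnegrE // mulr_ge0.
rewrite /sqn /=; have : 0 <= L * h ^+ 2 by rewrite mulr_ge0 // sqr_ge0.
rewrite exprMn in h2; rewrite exprMn !expr2 in h1 h2 *; lra.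
Qed.

Variables (t0 k d m : R).
Let z0 := (t0, y t0).
Hypotheses (k0 : 0 <= k) (loc : log_bounded Phi k z0) (d0 : 0 < d) (m0 : 0 <= m) (m1 : m < 1).
Hypothesis slope : forall z, sqn (psub z z0) <= d ^+ 2 -> forall r s : R, 0 < r -> r < s -> s <= 2 * d ->
  disc_sup Phi k z0 z s - disc_sup Phi k z0 z r <= m * (ln s - ln r).

(** Centres are taken at parameters [del * lam ^ n] from [t0], with radius [1 / 28] of that.
    Consecutive parameters differ by a fraction [1 / (56 * (1 + L))], hence the graph in between
    moves by at most half a radius. [del] keeps the centres within [d / 2] of the pole. *)
Let del := d / (2 * (1 + L)).
Let lam := 1 - (56 * (1 + L))^-1.
Let L10 : 0 < 1 + L. Proof. by have := L0; lra. Qed.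
Let del0 : 0 < del. Proof. by rewrite divr_gt0 // mulr_gt0. Qed.
Let lam0 : 0 < lam.
Proof.
rewrite subr_gt0 invf_lt1 ?mulr_gt0 //; have := L0; lra.
Qed.
Let lam1 : lam < 1.
Proof. by rewrite /lam ltrBlDr ltrDl invr_gt0 mulr_gt0. Qed.

(** The sign [sg] treats both sides of [t0] at once; the n-th disc contributes a multiple of the
    power [1 - m] of its radius, a geometric sequence. *)
Let side (sg : R) (A : set R) : sg = 1 \/ sg = -1 -> measurable A ->
  A `<=` [set t | 0 < sg * (t - t0) < del] ->
  (\int[mu]_(t in A) pole_weight Phi k z0 y t < +oo)%E.
Proof.
move=> sgE mA AS.
have [K [K0 hK]] := pole_weight_disc PhiP k0 loc d0 m0 m1 slope my.
have sg2 x : sg * (sg * x) = x by case: sgE => ->; rewrite ?mul1r ?mulN1r ?opprK.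
have sgn x : `|sg * x| = `|x| by case: sgE => ->; rewrite ?mul1r ?mulN1r ?normrN.
pose h n := del * lam ^+ n.
have h0 n : 0 < h n by rewrite mulr_gt0 // exprn_gt0.
pose w n := (t0 + sg * h n, y (t0 + sg * h n)).
have dw n : `|t0 + sg * h n - t0| = h n by rewrite addrC addKr sgn gtr0_norm.
have cov := (@integral_geometric_cover _ _ (measurable_pole_weight PhiP k z0 my) (pole_weight_ge0 Phi k z0 y) A
   (fun n => graph_disc y (w n) (h n / 28)) (K * expR ((1 - m) * ln (del / 28))) (expR ((1 - m) * ln lam))).
apply: cov => //.
- by move=> n; exact: measurable_graph_disc.
- move=> t /AS /andP[s0 sd]; set s := sg * (t - t0) in s0 sd.
  have [N hN] : exists N, h N < s.
    have : (GRing.exp lam : R ^nat) @ \oo --> 0 by apply: cvg_expr; rewrite gtr0_norm.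
    move=> /cvgr0_norm_lt /(_ (s / del) (divr_gt0 s0 del0)) [N _ HN].
    exists N; have := HN N (leqnn N); rewrite /= gtr0_norm ?exprn_gt0 // ltr_pdivlMr //.
    by rewrite mulrC.
  have exN : exists N, h N < s by exists N.
  (* The first index with [h N < s] is positive, since [h 0 = del > s]; its predecessor [n]
     satisfies [h n.+1 < s <= h n]. *)
  case: (ex_minnP exN) => [[|n] hn minN].
    by exfalso; move: hn; rewrite /h expr0 mulr1; lra.
  have sn : s <= h n.
    by rewrite leNgt; apply/negP => /minN; rewrite ltnn.
  exists n => //; rewrite /graph_disc /=.
  have tE : t = t0 + sg * s by rewrite /s sg2; ring.
  apply: (@le_lt_trans _ _ (((1 + L) * (h n - s)) ^+ 2)).
    apply: sqn_lip; rewrite tE (_ : _ - _ = sg * (s - h n)); last by ring.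
    by rewrite sgn distrC ger0_norm ?subr_ge0.
  have hs : h n - s < h n * (56 * (1 + L))^-1.
    have : h n.+1 = h n - h n * (56 * (1 + L))^-1 by rewrite /h exprSr /lam; ring.
    lra.
  have e1 : (1 + L) * (h n - s) < h n / 56.
    have := ltr_pM2l L10 (h n - s) (h n * (56 * (1 + L))^-1); rewrite hs => /esym.
    have -> : (1 + L) * (h n * (56 * (1 + L))^-1) = h n / 56 by field; rewrite gt_eqF.
    by [].
  have := h0 n => hn0; rewrite ltr_pXn2r ?nnegrE ?divr_ge0 ?(ltW hn0) //; first by lra.
  by rewrite mulr_ge0 ?subr_ge0 // ltW.
- by rewrite mulr_ge0 // expR_ge0.
- rewrite -[ltRHS]expR0 ltr_expR pmulr_rlt0 ?subr_gt0 // ln_lt0 //; by rewrite lam0.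
move=> n; have hn0 := h0 n.
pose D := Num.sqrt (sqn (psub (w n) z0)).
have DE : sqn (psub (w n) z0) = D ^+ 2 by rewrite sqr_sqrtr ?sqn_ge0.
have D1 : h n <= D.
  rewrite -[leLHS](ger0_norm (ltW hn0)) -sqrtr_sqr ler_sqrt ?sqn_ge0 // -(real_normK (num_real (h n))).
  by rewrite gtr0_norm // -{1}(dw n) real_normK ?num_real // /sqn /= lerDl sqr_ge0.
have hdel : h n <= del.
  by rewrite /h ger_pMr // exprn_ile1 // ltW.
have D2 : D <= (1 + L) * h n.
  have p0 : 0 <= (1 + L) * h n by rewrite mulr_ge0 // ltW.
  rewrite -[leRHS](ger0_norm p0) -sqrtr_sqr ler_sqrt ?sqr_ge0 //.
  by apply: sqn_lip; rewrite dw.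
have D3 : (1 + L) * h n <= d / 2.
  apply: (@le_trans _ _ ((1 + L) * del)); first by rewrite ler_pM2l.
  by rewrite /del le_eqVlt; apply/orP; left; apply/eqP; field; rewrite gt_eqF.
clearbody D; have r0 : 0 < h n / 28 by exact: divr_gt0.
have D0 : 0 < D by exact: lt_le_trans D1.
have hD : 28 * (h n / 28) <= D by lra.
have Dd : 2 * D <= d by lra.
apply: le_trans (hK (w n) (h n / 28) D r0 D0 DE hD Dd) _.
rewrite lee_fin -mulrA ler_wpM2l // -expRM_natl -expRD ler_expR.
have -> : ln (h n / 28) = ln (del / 28) + n%:R * ln lam.
  have -> : h n / 28 = del / 28 * lam ^+ n by rewrite /h; ring.
  have dp : 0 < del / 28 by exact: divr_gt0.
  have lp : 0 < lam ^+ n by exact: exprn_gt0.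
  by rewrite (lnM dp lp) lnXn ?posrE // mulr_natl.
by rewrite le_eqVlt; apply/orP; left; apply/eqP; ring.
Qed.

Lemma pole_weight_locally_integrable : exists2 e : R, 0 < e &
  (\int[mu]_(t in `](t0 - e)%R, (t0 + e)%R[) pole_weight Phi k z0 y t < +oo)%E.
Proof.
exists del; first exact: del0.
have mF := measurable_pole_weight PhiP k z0 my; have F0 := pole_weight_ge0 Phi k z0 y.
have h1 : (\int[mu]_(t in `]t0, (t0 + del)%R[) pole_weight Phi k z0 y t < +oo)%E.
  apply: (side (sg := 1)) => //; first by left.
  by move=> t /=; rewrite in_itv /= mul1r => /andP[? ?]; apply/andP; split; lra.
have h2 : (\int[mu]_(t in `](t0 - del)%R, t0[) pole_weight Phi k z0 y t < +oo)%E.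
  apply: (side (sg := -1)) => //; first by right.
  by move=> t /=; rewrite in_itv /= mulN1r => /andP[? ?]; apply/andP; split; lra.
have h3 : (\int[mu]_(t in [set t0]) pole_weight Phi k z0 y t < +oo)%E.
  by rewrite integral_leb_set1 // ltry.
apply: (integral_subset_lty mF F0 _ _ _ (integral_setU_lty mF F0 _ _ (integral_setU_lty mF F0 _ _ h1 h2) h3)) => //.
- by apply: measurableU => //; exact: measurableU.
- move=> t /=; rewrite !in_itv /= => /andP[ta tb].
  case: (ltrgtP t t0) => h; [left; right|left; left|by right].
    by rewrite ta.
  by rewrite tb.
- exact: measurableU.
Qed.

End weight_near_pole.

(** * Polynomial density on Lipschitz graphs *)

Import Normc.
Section complex_abs.
Context {R : realType}.
Implicit Types (z w : R[i]).

Lemma cabsE z : cabs z = normc z. Proof. by case: z. Qed.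
Lemma cabs_ge0 z : 0 <= cabs z. Proof. exact: sqrtr_ge0. Qed.
Lemma cabs_sqr z : cabs z ^+ 2 = complex.Re z ^+ 2 + complex.Im z ^+ 2.
Proof. by rewrite sqr_sqrtr // addr_ge0 // sqr_ge0. Qed.
Lemma cabs0 : cabs (0 : R[i]) = 0. Proof. by rewrite cabsE normc0. Qed.
Lemma cabs1 : cabs (1 : R[i]) = 1. Proof. by rewrite cabsE normc1. Qed.
Lemma cabsM z w : cabs (z * w) = cabs z * cabs w. Proof. by rewrite !cabsE normcM. Qed.
Lemma cabsN z : cabs (- z) = cabs z. Proof. by rewrite !cabsE normcN. Qed.
Lemma cabsB z w : cabs (z - w) = cabs (w - z). Proof. by rewrite -cabsN opprB. Qed.
Lemma cabsV z : cabs z^-1 = (cabs z)^-1. Proof. by rewrite !cabsE normcV. Qed.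
Lemma cabsD z w : cabs (z + w) <= cabs z + cabs w. Proof. by rewrite !cabsE le_normcD. Qed.
Lemma cabsX z n : cabs (z ^+ n) = cabs z ^+ n.
Proof. by elim: n => [|n IH]; rewrite ?expr0 ?cabs1 // !exprS cabsM IH. Qed.
Lemma cabs_real (x : R) : cabs (Complex x 0) = `|x|.
Proof. by rewrite /cabs /= expr0n addr0 sqrtr_sqr. Qed.
Lemma cabs_eq0 z : (cabs z == 0) = (z == 0).
Proof. by apply/eqP/eqP => [|->]; [rewrite cabsE => /eq0_normc|exact: cabs0]. Qed.
Lemma cabs_Re z : `|complex.Re z| <= cabs z.
Proof. by rewrite -sqrtr_sqr ler_sqrt ?addr_ge0 ?sqr_ge0 // lerDl sqr_ge0. Qed.
Lemma cabs_Im z : `|complex.Im z| <= cabs z.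
Proof. by rewrite -sqrtr_sqr ler_sqrt ?addr_ge0 ?sqr_ge0 // lerDr sqr_ge0. Qed.
Lemma cabs_triangle z w u : cabs (z - u) <= cabs (z - w) + cabs (w - u).
Proof. by apply: le_trans (cabsD _ _); rewrite addrA subrK. Qed.
Lemma cabs_lower z : 1 - cabs z <= cabs (1 - z).
Proof. by rewrite lerBlDr -{1}cabs1; have := cabsD (1 - z) z; rewrite subrK. Qed.

End complex_abs.

(** * Uniform polynomial limits and pole pushing *)

Section uniform_polynomials.
Context {R : realType}.
Variables (D : set R) (gm : R -> R[i]) (M : R).
Hypothesis gmM : forall t, D t -> cabs (gm t) <= M.
Implicit Types (f g h : R -> R[i]).

Definition unif_poly f : Prop := forall e : R, 0 < e ->
  exists p : {poly R[i]}, forall t, D t -> cabs (f t - p.[gm t]) <= e.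

Lemma unif_polyP (p : {poly R[i]}) : unif_poly (fun t => p.[gm t]).
Proof. by move=> e e0; exists p => t _; rewrite subrr cabs0 ltW. Qed.

Lemma unif_poly_ext f g : (forall t, D t -> f t = g t) -> unif_poly f -> unif_poly g.
Proof. by move=> fg hf e /hf[p hp]; exists p => t Dt; rewrite -fg // hp. Qed.

Lemma unif_poly_cst c : unif_poly (fun=> c).
Proof. by apply: unif_poly_ext (unif_polyP c%:P) => t _; rewrite hornerC. Qed.

Lemma unif_poly_id : unif_poly gm.
Proof. by apply: unif_poly_ext (unif_polyP 'X) => t _; rewrite hornerX. Qed.

Lemma unif_poly_limit f : (forall e : R, 0 < e -> exists2 g, unif_poly g & forall t, D t -> cabs (f t - g t) <= e) ->
  unif_poly f.
Proof.
move=> h e e0; have e2 : 0 < e / 2 by rewrite divr_gt0.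
have [g hg fg] := h _ e2; have [p hp] := hg _ e2; exists p => t Dt.
apply: le_trans (cabs_triangle _ (g t) _) _; have := fg t Dt; have := hp t Dt; lra.
Qed.

Lemma unif_poly_add f g : unif_poly f -> unif_poly g -> unif_poly (fun t => f t + g t).
Proof.
move=> hf hg e e0; have e2 : 0 < e / 2 by rewrite divr_gt0.
have [p hp] := hf _ e2; have [q hq] := hg _ e2; exists (p + q) => t Dt.
rewrite hornerD (_ : _ - _ = (f t - p.[gm t]) + (g t - q.[gm t])); last by ring.
apply: le_trans (cabsD _ _) _; have := hp t Dt; have := hq t Dt; lra.
Qed.

Lemma horner_bounded (p : {poly R[i]}) : exists2 B : R, 0 <= B & forall t, D t -> cabs p.[gm t] <= B.
Proof.
elim/poly_ind: p => [|p c [B B0 hB]]; first by exists 0 => // t _; rewrite horner0 cabs0.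
exists (B * `|M| + cabs c); first by rewrite addr_ge0 ?cabs_ge0 // mulr_ge0.
move=> t Dt; rewrite hornerMXaddC; apply: le_trans (cabsD _ _) _; rewrite lerD2r cabsM.
apply: ler_pM; rewrite ?cabs_ge0 ?hB //; apply: le_trans (gmM Dt) _; exact: ler_norm.
Qed.

Lemma unif_poly_bounded f : unif_poly f -> exists2 B : R, 0 <= B & forall t, D t -> cabs (f t) <= B.
Proof.
move=> /(_ 1 ltr01)[p hp]; have [B B0 hB] := horner_bounded p.
exists (B + 1); first by rewrite addr_ge0.
move=> t Dt; rewrite -[f t](subrK p.[gm t]); apply: le_trans (cabsD _ _) _.
have := hp t Dt; have := hB t Dt; lra.
Qed.

Lemma unif_poly_mul f g : unif_poly f -> unif_poly g -> unif_poly (fun t => f t * g t).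
Proof.
move=> hf hg e e0.
have [B B0 hB] := unif_poly_bounded hg.
have [p hp] := hf (e / (2 * (B + 1))) ltac:(by rewrite divr_gt0 // mulr_gt0 // ltr_wpDl).
have [C C0 hC] := horner_bounded p.
have [q hq] := hg (e / (2 * (C + 1))) ltac:(by rewrite divr_gt0 // mulr_gt0 // ltr_wpDl).
exists (p * q) => t Dt; rewrite hornerM.
rewrite (_ : _ - _ = (f t - p.[gm t]) * g t + p.[gm t] * (g t - q.[gm t])); last by ring.
apply: le_trans (cabsD _ _) _; rewrite !cabsM.
have h1 : cabs (f t - p.[gm t]) * cabs (g t) <= e / (2 * (B + 1)) * (B + 1).
  by apply: ler_pM; rewrite ?cabs_ge0 ?hp //; apply: le_trans (hB t Dt) _; rewrite lerDl.
have h2 : cabs p.[gm t] * cabs (g t - q.[gm t]) <= (C + 1) * (e / (2 * (C + 1))).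
  by apply: ler_pM; rewrite ?cabs_ge0 ?hq //; apply: le_trans (hC t Dt) _; rewrite lerDl.
have E1 : e / (2 * (B + 1)) * (B + 1) = e / 2 by field; rewrite gt_eqF // ltr_wpDl.
have E2 : (C + 1) * (e / (2 * (C + 1))) = e / 2 by field; rewrite gt_eqF // ltr_wpDl.
lra.
Qed.

Lemma unif_poly_scale c f : unif_poly f -> unif_poly (fun t => c * f t).
Proof. by move=> hf; apply: unif_poly_mul => //; exact: unif_poly_cst. Qed.

(** Partial sums of the geometric series have remainder [h ^ n / (1 - h)], at most [2 * 2^-1 ^ n] in
    absolute value. *)
Lemma unif_poly_geometric h : unif_poly h -> (forall t, D t -> cabs (h t) <= 2^-1) ->
  unif_poly (fun t => (1 - h t)^-1).
Proof.
move=> hh h2; have sums n : unif_poly (fun t => \sum_(i < n) h t ^+ i).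
  elim: n => [|n IH].
    by apply: unif_poly_ext (unif_poly_cst 0) => t _; rewrite big_ord0.
  apply: (unif_poly_ext (f := fun t => 1 + h t * \sum_(i < n) h t ^+ i)).
    by move=> t _; rewrite big_ord_recl expr0 mulr_sumr; congr (_ + _); apply: eq_bigr => i _; rewrite exprS.
  by apply: unif_poly_add; [exact: unif_poly_cst|exact: unif_poly_mul].
apply: unif_poly_limit => e e0.
have [n hn] : exists n, 2 * (2^-1 : R) ^+ n <= e.
  have : (GRing.exp (2^-1) : R ^nat) @ \oo --> 0 by apply: cvg_expr; rewrite gtr0_norm //; lra.
  move=> /cvgr0_norm_lt /(_ (e / 2) (divr_gt0 e0 (ltr0n _ 2))) [N _ HN].
  exists N; have := HN N (leqnn N); rewrite /= ger0_norm ?exprn_ge0 // => hN; lra.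
exists (fun t => \sum_(i < n) h t ^+ i) => // t Dt.
have l2 : 2^-1 <= cabs (1 - h t) by have := cabs_lower (h t); have := h2 t Dt; lra.
have n0 : 1 - h t != 0 by rewrite -cabs_eq0 gt_eqF //; apply: lt_le_trans l2; rewrite invr_gt0.
have -> : (1 - h t)^-1 - \sum_(i < n) h t ^+ i = h t ^+ n / (1 - h t).
  apply: (mulIf n0); rewrite mulrBl mulVf // mulfVK //.
  have := subrX1 (h t) n => E.
  have -> : (\sum_(i < n) h t ^+ i) * (1 - h t) = - ((h t - 1) * \sum_(i < n) h t ^+ i) by ring.
  by rewrite -E; ring.
rewrite cabsM cabsV cabsX; apply: le_trans hn; rewrite mulrC; apply: ler_pM.
- by rewrite invr_ge0 cabs_ge0.
- by rewrite exprn_ge0 // cabs_ge0.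
- by rewrite -[leRHS]invrK lef_pV2 // ?posrE ?invr_gt0 //; apply: lt_le_trans l2; rewrite invr_gt0.
- by apply: lerXn2r; rewrite ?nnegrE ?cabs_ge0 ?h2.
Qed.

Section cone.
Variables (g : R -> R[i]) (L : R).
Hypotheses (L0 : 0 <= L) (gcone : forall t, D t -> `|complex.Im (g t)| <= L * `|complex.Re (g t)|).
Hypothesis hg : unif_poly g.

(** Either the real part alone is at least [|tau| / (1 + L)], or the cone condition keeps the
    imaginary part so small that it stays that far from [tau]. *)
Lemma cone_dist (z : R[i]) (tau : R) : `|complex.Im z| <= L * `|complex.Re z| ->
  `|tau| / (1 + L) <= cabs (z - Complex 0 tau).
Proof.
move=> hz; have L10 : 0 < 1 + L by have := L0; lra.
have [h|h] := leP (`|tau| / (1 + L)) `|complex.Re z|.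
  by apply: le_trans h _; have := cabs_Re (z - Complex 0 tau); case: z {hz} => x v /=; rewrite oppr0 addr0.
have := cabs_Im (z - Complex 0 tau); have -> : complex.Im (z - Complex 0 tau) = complex.Im z - tau by case: z {hz h}.
apply: le_trans.
have h1 : L * `|complex.Re z| <= L * (`|tau| / (1 + L)) by rewrite ler_wpM2l // ltW.
have : `|tau| = `|tau| / (1 + L) + L * (`|tau| / (1 + L)) by field; rewrite gt_eqF.
have := ler_normD (tau - complex.Im z) (complex.Im z); rewrite subrK (distrC tau); lra.
Qed.

(** Pole pushing along the imaginary axis, which meets the cone only at [0]. *)
Lemma unif_poly_resolvent (tau : R) : tau != 0 -> unif_poly (fun t => (g t - Complex 0 tau)^-1).
Proof.
have L10 : 0 < 1 + L by have := L0; lra.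
pose th := 1 - (2 * (1 + L))^-1.
have th0 : 0 < th.
  by rewrite subr_gt0 invf_lt1 ?mulr_gt0 //; have := L0; lra.
have th1 : th < 1 by rewrite ltrBlDr ltrDl invr_gt0 mulr_gt0.
have [B B0 hB] := unif_poly_bounded hg.
have i0 (s : R) : s != 0 -> Complex 0 s != 0 by move=> s0; rewrite eq_complex /= negb_and s0 orbT.
have ci (s : R) : cabs (Complex 0 s) = `|s| by rewrite /cabs /= expr0n add0r sqrtr_sqr.
have gn0 (s t : R) : s != 0 -> D t -> g t - Complex 0 s != 0.
  move=> s0 Dt; rewrite -cabs_eq0 gt_eqF //; apply: lt_le_trans (cone_dist s (gcone Dt)).
  by rewrite divr_gt0 // normr_gt0.
(* Induction on how far the pole lies from the values of [g]. For [|s| >= 2 * B + 1] a geometric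
   series in [g / s] works. Passing from [s / th] to [s] moves the pole by at most half its distance
   to the cone, by the choice of [th], so a geometric series works again. *)
have main n : forall s : R, s != 0 -> (2 * B + 1) * th ^+ n <= `|s| -> unif_poly (fun t => (g t - Complex 0 s)^-1).
  elim: n => [|n IH] s s0 hs.
    apply: (unif_poly_ext (f := fun t => - (Complex 0 s)^-1 * (1 - (Complex 0 s)^-1 * g t)^-1)).
      move=> t Dt; have := gn0 s t s0 Dt; have := i0 s s0; move: (Complex 0 s) (g t) => a b a0 b0.
      have h3 : 1 - a^-1 * b != 0.
        rewrite (_ : 1 - a^-1 * b = - (a^-1 * (b - a))); last by rewrite mulrBr mulVf // opprB.
        by rewrite oppr_eq0 mulf_neq0 // invr_neq0.
      apply: (mulIf b0); rewrite mulVf //; apply: (mulfI h3); rewrite mulr1.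
      rewrite mulrA [X in X * _]mulrC mulfVK //.
      by rewrite mulNr mulrBr mulVf // opprB.
    apply: unif_poly_scale; apply: unif_poly_geometric; first exact: unif_poly_scale.
    move=> t Dt; rewrite cabsM cabsV ci; move: hs; rewrite expr0 mulr1 => hs.
    rewrite mulrC ler_pdivrMr ?normr_gt0 //; have := hB t Dt; lra.
  have s'0 : s / th != 0 by rewrite mulf_neq0 // invr_neq0 // gt_eqF.
  have /IH : s / th != 0 by [].
  move=> /(_ _)/wrap[]; first by rewrite normrM normfV (gtr0_norm th0) ler_pdivlMr // -mulrA -exprSr.
  move=> hs'; pose dl : R[i] := Complex 0 (s - s / th).
  apply: (unif_poly_ext (f := fun t => (g t - Complex 0 (s / th))^-1 * (1 - dl * (g t - Complex 0 (s / th))^-1)^-1)).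
    move=> t Dt; have := gn0 _ t s'0 Dt; have := gn0 _ t s0 Dt.
    have -> : g t - Complex 0 s = (g t - Complex 0 (s / th)) - dl.
      by rewrite /dl; case: (g t) => x v; congr Complex => /=; ring.
    move: (g t - _) dl => a b ab0 a0.
    by rewrite -invfM; congr (_^-1); rewrite mulrBr mulr1 mulrCA mulfV // mulr1.
  apply: unif_poly_mul => //; apply: unif_poly_geometric; first exact: unif_poly_scale.
  move=> t Dt; rewrite cabsM cabsV ci.
  have := cone_dist (s / th) (gcone Dt) => h.
  have sp : 0 < `|s / th| by rewrite normr_gt0.
  have cp : 0 < cabs (g t - Complex 0 (s / th)).
    by apply: lt_le_trans h; rewrite divr_gt0.
  rewrite ler_pdivrMr //.
  have -> : s - s / th = - (s / th * (2 * (1 + L))^-1).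
    have : s = s / th * th by rewrite mulfVK // gt_eqF.
    by rewrite {2}/th; move: (s / th) => u ->; ring.
  rewrite normrN normrM [X in _ * X]gtr0_norm ?invr_gt0 ?mulr_gt0 // invfM.
  have : 2^-1 * (`|s / th| / (1 + L)) <= 2^-1 * cabs (g t - Complex 0 (s / th)) by rewrite ler_pM2l ?invr_gt0.
  by apply: le_trans; rewrite le_eqVlt; apply/orP; left; apply/eqP; ring.
move=> t0; have [n hn] : exists n, (2 * B + 1) * th ^+ n <= `|tau|.
  have : (GRing.exp th : R ^nat) @ \oo --> 0 by apply: cvg_expr; rewrite gtr0_norm.
  have B1 : 0 < 2 * B + 1 by lra.
  move=> /cvgr0_norm_lt /(_ (`|tau| / (2 * B + 1))) [|N _ HN]; first by rewrite divr_gt0 // normr_gt0.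
  exists N; have := HN N (leqnn N); rewrite /= gtr0_norm ?exprn_gt0 // ltr_pdivlMr // mulrC => /ltW.
  by [].
exact: (main n).
Qed.

End cone.

(** The partial fraction form of [2 z / (1 + z ^ 2)], the doubling formula of the hyperbolic
    tangent; it exhibits two resolvents with poles on the imaginary axis. *)
Definition dbl (z : R[i]) : R[i] := (z - Complex 0 1)^-1 + (z - Complex 0 (-1))^-1.

Lemma unif_poly_dbl g (L : R) : 0 <= L -> (forall t, D t -> `|complex.Im (g t)| <= L * `|complex.Re (g t)|) ->
  unif_poly g -> unif_poly (fun t => dbl (g t)).
Proof.
move=> L0 gc hg; apply: unif_poly_add; apply: (unif_poly_resolvent L0 gc hg); by rewrite ?oppr_eq0 oner_eq0.
Qed.

End uniform_polynomials.

(** * Dynamics of the doubling map on a cone *)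

Section doubling.
Context {R : realType}.
Implicit Types z u : R[i].
Local Notation iu := (Complex 0 1 : R[i]).

Lemma iu_sqr : iu * iu = -1.
Proof. by apply/eqP; rewrite eq_complex /=; apply/andP; split; apply/eqP; ring. Qed.

Lemma dbl_Complex (x v : R) : x ^+ 2 + (v - 1) ^+ 2 != 0 -> x ^+ 2 + (v + 1) ^+ 2 != 0 ->
  let P := (x ^+ 2 + (v - 1) ^+ 2) * (x ^+ 2 + (v + 1) ^+ 2) in
  dbl (Complex x v) = Complex (2 * x * (x ^+ 2 + v ^+ 2 + 1) / P) (- (2 * v * (x ^+ 2 + v ^+ 2 - 1)) / P).
Proof.
move=> A0 B0 P; rewrite /P /dbl; apply/eqP; rewrite eq_complex /= oppr0 addr0 opprK.
by apply/andP; split; apply/eqP; field; rewrite A0 B0.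
Qed.

Variable L : R.
Hypothesis L0 : 0 <= L.
Definition in_cone z := `|complex.Im z| <= L * `|complex.Re z|.

Lemma in_cone_neq z (tau : R) : in_cone z -> tau != 0 -> z - Complex 0 tau != 0.
Proof.
move=> zc t0; rewrite -cabs_eq0 gt_eqF //; apply: lt_le_trans (cone_dist L0 tau zc).
by rewrite divr_gt0 ?normr_gt0 //; have := L0; lra.
Qed.

Lemma cone_sqr_neq0 z (tau : R) : in_cone z -> tau != 0 ->
  0 < complex.Re z ^+ 2 + (complex.Im z - tau) ^+ 2.
Proof.
move=> zc t0; rewrite lt_neqAle addr_ge0 ?sqr_ge0 // andbT eq_sym.
have := in_cone_neq zc t0; apply: contra; case: z {zc} => x v /= h.
by rewrite -cabs_eq0 /cabs /= oppr0 addr0 (eqP h) sqrtr0.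
Qed.

(** Up to a common positive factor the map multiplies the real part by [|z| ^ 2 + 1] and the
    imaginary part by [1 - |z| ^ 2], which is no larger in absolute value. *)
Lemma in_cone_dbl z : in_cone z -> in_cone (dbl z).
Proof.
case: z => x v zc; have A0 : 0 < x ^+ 2 + (v - 1) ^+ 2 := cone_sqr_neq0 zc (oner_neq0 R).
have B0 : 0 < x ^+ 2 + (v + 1) ^+ 2.
  by have := cone_sqr_neq0 zc (tau := -1); rewrite /= opprK oppr_eq0 oner_neq0; apply.
rewrite /in_cone in zc *.
rewrite dbl_Complex ?gt_eqF //=; rewrite /= in zc; rewrite !normrM normfV mulrA ler_pM2r ?invr_gt0; last first.
  by rewrite normr_gt0 mulf_neq0 // gt_eqF.
rewrite normrN !normrM (ger0_norm (ler0n _ 2)) [X in _ <= _ * (_ * X)]ger0_norm; last first.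
  by rewrite !addr_ge0 // sqr_ge0.
have h1 : `|x ^+ 2 + v ^+ 2 - 1| <= x ^+ 2 + v ^+ 2 + 1.
  have h1 := sqr_ge0 x; have h2 := sqr_ge0 v; rewrite ler_norml; apply/andP; split; lra.
have -> : L * (2 * `|x| * (x ^+ 2 + v ^+ 2 + 1)) = 2 * (L * `|x|) * (x ^+ 2 + v ^+ 2 + 1) by ring.
by apply: ler_pM => //; rewrite ler_pM2l.
Qed.

Lemma cabs_dbl z : in_cone z -> cabs (dbl z) <= 2 * (1 + L).
Proof.
move=> zc; apply: le_trans (cabsD _ _) _; rewrite !cabsV.
have L10 : 0 < 1 + L by have := L0; lra.
have h (tau : R) : `|tau| = 1 -> (cabs (z - Complex 0 tau))^-1 <= 1 + L.
  move=> t1; have := cone_dist L0 tau zc; rewrite t1 => hz.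
  have c0 : 0 < cabs (z - Complex 0 tau) by apply: lt_le_trans hz; rewrite divr_gt0.
  by rewrite -div1r ler_pdivrMr // mulrC -ler_pdivrMr.
have := h 1 (normr1 _); have := h (-1) (normrN1 _); lra.
Qed.

Lemma dbl_opp z : dbl (- z) = - dbl z.
Proof.
rewrite /dbl.
have -> : - z - Complex 0 1 = - (z - Complex 0 (-1)).
  by case: z => x v; apply/eqP; rewrite eq_complex /=; apply/andP; split; apply/eqP; ring.
have -> : - z - Complex 0 (-1) = - (z - Complex 0 1).
  by case: z => x v; apply/eqP; rewrite eq_complex /=; apply/andP; split; apply/eqP; ring.
by rewrite !invrN -opprD addrC.
Qed.

Lemma in_cone_opp z : in_cone z -> in_cone (- z).
Proof. by case: z => x v; rewrite /in_cone /= !normrN. Qed.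

Lemma Re_dbl_gt0 z : in_cone z -> 0 < complex.Re z -> 0 < complex.Re (dbl z).
Proof.
case: z => x v zc x0; have A0 : 0 < x ^+ 2 + (v - 1) ^+ 2 := cone_sqr_neq0 zc (oner_neq0 R).
have B0 : 0 < x ^+ 2 + (v + 1) ^+ 2.
  by have := cone_sqr_neq0 zc (tau := -1); rewrite /= opprK oppr_eq0 oner_neq0; apply.
rewrite /= in x0; rewrite dbl_Complex ?gt_eqF //= divr_gt0 ?mulr_gt0 //.
have := sqr_ge0 x; have := sqr_ge0 v; lra.
Qed.

(** The Cayley transform takes the right half-plane into the unit disc and [1] to [0], and it
    conjugates [dbl] to squaring. *)
Let u z := (1 - z) / (1 + z).

Lemma Re_gt0_neq0 z : 0 < complex.Re z -> 1 + z != 0.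
Proof.
case: z => x v /= x0; rewrite eq_complex /= negb_and; apply/orP; left.
by rewrite gt_eqF // addr_gt0.
Qed.

Let u_dbl z : in_cone z -> 0 < complex.Re z -> u (dbl z) = u z ^+ 2.
Proof.
move=> zc z0; have h1 := in_cone_neq zc (oner_neq0 R).
have h2 : z - Complex 0 (-1) != 0 by apply: in_cone_neq => //; rewrite oppr_eq0 oner_neq0.
have h3 := Re_gt0_neq0 z0; have h4 := Re_gt0_neq0 (Re_dbl_gt0 zc z0).
have m1 : Complex 0 (-1) = - iu by apply/eqP; rewrite eq_complex /= oppr0 !eqxx.
have fac : 1 + z ^+ 2 = (z - iu) * (z + iu).
  by rewrite (_ : (z - iu) * (z + iu) = z ^+ 2 - iu * iu); [rewrite iu_sqr opprK addrC|ring].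
have E : dbl z = 2 * z / (1 + z ^+ 2).
  rewrite /dbl m1 opprK in h2 *.
  by rewrite fac; field; rewrite h1 h2.
have h5 : 1 + z ^+ 2 != 0.
  by rewrite fac mulf_neq0 // -[iu]opprK -m1.
rewrite /u E; field; rewrite h3 h5 /=.
have -> : 1 + z ^+ 2 + 2 * z = (1 + z) ^+ 2 by ring.
by rewrite expf_neq0.
Qed.

Let u_lt1 z : 0 < complex.Re z -> cabs (u z) < 1.
Proof.
move=> z0; have h3 := Re_gt0_neq0 z0.
rewrite /u cabsM cabsV ltr_pdivrMr ?mul1r; last by rewrite lt_neqAle eq_sym cabs_eq0 h3 cabs_ge0.
rewrite -(ltr_pXn2r (n := 2)) ?nnegrE ?cabs_ge0 // !cabs_sqr.
case: z z0 {h3} => x v /= x0; rewrite sub0r add0r sqrrN ltrD2r !expr2; lra.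
Qed.

Lemma iter_in_cone z n : in_cone z -> in_cone (iter n dbl z).
Proof. by move=> zc; elim: n => [//|n IH] /=; exact: in_cone_dbl. Qed.

Let iter_pos z n : in_cone z -> 0 < complex.Re z ->
  0 < complex.Re (iter n dbl z) /\ cabs (u (iter n dbl z)) <= cabs (u z) ^+ n.+1.
Proof.
move=> zc z0; elim: n => [|n [IH1 IH2]]; first by rewrite expr1.
have ic := iter_in_cone n zc; split; first exact: Re_dbl_gt0.
rewrite /= u_dbl // cabsX expr2 [leRHS]exprS.
have l1 := ltW (u_lt1 z0).
apply: ler_pM; rewrite ?cabs_ge0 //; apply: le_trans IH2 _.
by rewrite exprS ler_piMr ?cabs_ge0 // exprn_ile1 // cabs_ge0.
Qed.

Lemma iter_dbl_cvg1 z : in_cone z -> 0 < complex.Re z -> forall e : R, 0 < e ->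
  exists N, forall n, (N <= n)%N -> cabs (iter n dbl z - 1) <= e.
Proof.
move=> zc z0 e e0; have l1 := u_lt1 z0.
(* Inverting the transform gives [w - 1 = - 2 u / (1 + u)], hence [|w - 1| <= 4 |u|] as soon as
   [|u| <= 1 / 2]. *)
pose e' := Num.min (1 / 2) (e / 4).
have e'0 : 0 < e' by rewrite lt_min !divr_gt0.
have : (GRing.exp (cabs (u z)) : R ^nat) @ \oo --> 0 by apply: cvg_expr; rewrite ger0_norm ?cabs_ge0.
move=> /cvgr0_norm_lt /(_ e' e'0) [N _ HN]; exists N => n Nn.
have := HN n.+1 (leqW Nn); rewrite /= ger0_norm ?exprn_ge0 ?cabs_ge0 // => hn.
have [p0 pn] := iter_pos n zc z0; set w := iter n dbl z in p0 pn *.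
have uw : cabs (u w) < e' by exact: le_lt_trans hn.
have h3 := Re_gt0_neq0 p0.
have E : (w - 1) * (1 + u w) = - 2 * u w by rewrite /u; field.
move: (u w) E uw => uu E uw {pn}; have := congr1 (@cabs R) E; rewrite !cabsM cabsN.
have -> : cabs (2 : R[i]) = 2.
  by rewrite /cabs /= addr0 expr0n addr0 sqrtr_sqr ger0_norm.
have := cabs_lower (- uu); rewrite cabsN opprK.
have : e' <= 1 / 2 by rewrite ge_min lexx.
have : e' <= e / 4 by rewrite ge_min lexx orbT.
have := cabs_ge0 uu; have := cabs_ge0 (w - 1).
move: (cabs (w - 1)) (cabs uu) (cabs (1 + uu)) uw => X U Y uw; clearbody e'; nra.
Qed.

Definition csg (x : R) : R[i] := Complex (Num.sg x) 0.

Lemma iter_dbl_cvg z : in_cone z -> forall e : R, 0 < e ->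
  exists N, forall n, (N <= n)%N -> cabs (iter n dbl z - csg (complex.Re z)) <= e.
Proof.
move=> zc e e0; rewrite /csg; have [z0|z0|z0] := ltrgtP 0 (complex.Re z).
- by have [N hN] := iter_dbl_cvg1 zc z0 e0; exists N => n /hN; rewrite gtr0_sg.
- have z0' : 0 < complex.Re (- z) by case: z z0 {zc} => x v /=; rewrite oppr_gt0.
  have [N hN] := iter_dbl_cvg1 (in_cone_opp zc) z0' e0; exists N => n /hN.
  have -> : iter n dbl (- z) = - iter n dbl z by elim: n => //= n ->; exact: dbl_opp.
  rewrite ltr0_sg // -cabsN opprB opprK addrC; congr (cabs (_ + _) <= _).
  by apply/eqP; rewrite eq_complex /= oppr0 opprK !eqxx.
exists 0%N => n _; have zE : z = 0.
  move: zc; case: z z0 => x v /= <-; rewrite /in_cone /= normr0 mulr0 normr_le0 => /eqP ->.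
  by [].
have -> : iter n dbl z = 0.
  elim: n => //= n ->; rewrite /dbl !sub0r !invrN -opprD.
  have -> : Complex 0 (-1) = - iu by apply/eqP; rewrite eq_complex /= oppr0 !eqxx.
  by rewrite invrN subrr oppr0.
by rewrite -z0 sgr0 subrr cabs0 ltW.
Qed.

Lemma cabs_csg (x : R) : cabs (csg x) <= 1.
Proof.
rewrite /csg /cabs /= expr0n addr0 sqrtr_sqr; case: (sgrP x) => _; rewrite ?normr0 ?normr1 ?normrN1 //.
Qed.

End doubling.

(** * Polynomial density for an integrable weight on the graph *)

Section weighted_density.
Context {R : realType}.
Local Notation mu := (@leb R).
Variables (a b : R) (y w : R -> R).
Hypotheses (my : measurable_fun setT y) (mw : measurable_fun setT w) (w0 : forall t, 0 <= w t).
Hypothesis wfin : (\int[mu]_(t in `[a, b]) (w t)%:E < +oo)%E.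
Implicit Types (f g : R -> R[i]).

Definition cmeas f := measurable_fun setT (fun t => complex.Re (f t)) /\
  measurable_fun setT (fun t => complex.Im (f t)).

Lemma cmeas_cst c : cmeas (fun=> c). Proof. by split; exact: measurable_cst. Qed.

Lemma cmeas_add f g : cmeas f -> cmeas g -> cmeas (fun t => f t + g t).
Proof.
move=> [f1 f2] [g1 g2]; split; [have := measurable_funD f1 g1|have := measurable_funD f2 g2].
  by congr measurable_fun; apply/funext => t /=; case: (f t) (g t) => ? ? [].
by congr measurable_fun; apply/funext => t /=; case: (f t) (g t) => ? ? [].
Qed.

Lemma cmeas_mul f g : cmeas f -> cmeas g -> cmeas (fun t => f t * g t).
Proof.
move=> [f1 f2] [g1 g2]; split.
  have := measurable_funB (measurable_funM f1 g1) (measurable_funM f2 g2).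
  by congr measurable_fun; apply/funext => t /=; case: (f t) (g t) => ? ? [].
have := measurable_funD (measurable_funM f1 g2) (measurable_funM f2 g1).
by congr measurable_fun; apply/funext => t /=; case: (f t) (g t) => ? ? [].
Qed.

Lemma cmeas_opp f : cmeas f -> cmeas (fun t => - f t).
Proof.
move=> hf; have := cmeas_mul (cmeas_cst (-1)) hf.
by have -> : (fun t => -1 * f t) = (fun t => - f t) by apply/funext => t; rewrite mulN1r.
Qed.

Lemma cmeas_sub f g : cmeas f -> cmeas g -> cmeas (fun t => f t - g t).
Proof. by move=> hf /cmeas_opp; exact: cmeas_add. Qed.

Lemma cmeas_real (r : R -> R) : measurable_fun setT r -> cmeas (fun t => Complex (r t) 0).
Proof. by move=> mr; split => //; exact: measurable_cst. Qed.

Definition graph (t : R) : R[i] := Complex t (y t).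

Lemma cmeas_poly (p : {poly R[i]}) : cmeas (fun t => p.[graph t]).
Proof.
elim/poly_ind: p => [|p c IH].
  by have -> : (fun t => (0 : {poly R[i]}).[graph t]) = (fun=> 0) by [apply/funext => t; rewrite horner0|]; exact: cmeas_cst.
have -> : (fun t => (p * 'X + c%:P).[graph t]) = (fun t => p.[graph t] * graph t + c).
  by apply/funext => t; rewrite hornerMXaddC.
apply: cmeas_add; last exact: cmeas_cst.
by apply: cmeas_mul => //; split; [exact: measurable_id|exact: my].
Qed.

Lemma measurable_cabs_sqr f : cmeas f -> measurable_fun setT (fun t => cabs (f t) ^+ 2).
Proof.
move=> [f1 f2]; under eq_fun do rewrite cabs_sqr.
by apply: measurable_funD; apply: measurable_funX.
Qed.

Definition wnorm2 f : \bar R := (\int[mu]_(t in `[a, b]) (cabs (f t) ^+ 2 * w t)%:E)%E.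

Let mN f : cmeas f -> measurable_fun setT (fun t => (cabs (f t) ^+ 2 * w t)%:E).
Proof. by move=> hf; apply/measurable_EFinP; apply: measurable_funM => //; exact: measurable_cabs_sqr. Qed.

Let N0 (z : R[i]) t : (0 <= (cabs z ^+ 2 * w t)%:E)%E.
Proof. by rewrite lee_fin mulr_ge0 // sqr_ge0. Qed.

Lemma wnorm2_ge0 f : (0 <= wnorm2 f)%E.
Proof. by apply: integral_ge0 => t _; exact: N0. Qed.

Lemma cabs_sqr_add (z z' : R[i]) : cabs (z + z') ^+ 2 <= 2 * cabs z ^+ 2 + 2 * cabs z' ^+ 2.
Proof.
apply: (@le_trans _ _ ((cabs z + cabs z') ^+ 2)).
  by rewrite ler_pXn2r ?nnegrE ?addr_ge0 ?cabs_ge0 // cabsD.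
by have := sqr_ge0 (cabs z - cabs z'); rewrite !expr2; lra.
Qed.

Lemma wnorm2_add f g : cmeas f -> cmeas g ->
  (wnorm2 (fun t => f t + g t)%R <= 2%:E * wnorm2 f + 2%:E * wnorm2 g)%E.
Proof.
move=> hf hg; rewrite /wnorm2 -!ge0_integralZl_EFin //; last 2 first.
- by apply: measurable_funTS; exact: mN.
- by apply: measurable_funTS; exact: mN.
rewrite -ge0_integralD //; last 4 first.
- by move=> t _; rewrite mule_ge0.
- by apply: measurable_funeM; apply: measurable_funTS; exact: mN.
- by move=> t _; rewrite mule_ge0.
- by apply: measurable_funeM; apply: measurable_funTS; exact: mN.
apply: ge0_le_integral => //.
- by apply: measurable_funTS; apply: mN; exact: cmeas_add.
- by apply: emeasurable_funD; apply: measurable_funeM; apply: measurable_funTS; exact: mN.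
move=> t _; rewrite -!EFinM -EFinD lee_fin.
have := ler_wpM2r (w0 t) (cabs_sqr_add (f t) (g t)); lra.
Qed.

Definition poly_appr f := forall e : R, 0 < e -> exists p : {poly R[i]},
  (wnorm2 (fun t => f t - p.[graph t])%R < e%:E)%E.

Let lt_half (x z : \bar R) (e : R) : (x < (e / 4)%:E)%E -> (z < (e / 4)%:E)%E -> (2%:E * x + 2%:E * z < e%:E)%E.
Proof.
move=> h1 h2; have := lteD h1 h2; rewrite -EFinD => h3.
have -> : (2%:E * x + 2%:E * z = 2%:E * (x + z))%E by rewrite muleDr // ; move: x z h1 h2 {h3} => [?| |] [?| |].
have -> : e%:E = (2%:E * (e / 4 + e / 4)%:E)%E by rewrite -EFinM; congr EFin; field.
by rewrite lte_pmul2l.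
Qed.

Lemma poly_appr_limit f : cmeas f -> (forall e : R, 0 < e -> exists g, [/\ cmeas g, poly_appr g &
  (wnorm2 (fun t => f t - g t)%R < e%:E)%E]) -> poly_appr f.
Proof.
move=> hf h e e0; have e4 : 0 < e / 4 by rewrite divr_gt0.
have [g [hg ag fg]] := h _ e4; have [p hp] := ag _ e4; exists p.
have -> : (fun t => f t - p.[graph t]) = (fun t => (f t - g t) + (g t - p.[graph t])).
  by apply/funext => t; rewrite addrA subrK.
apply: le_lt_trans (wnorm2_add _ _) (lt_half fg hp); first exact: cmeas_sub.
by apply: cmeas_sub => //; exact: cmeas_poly.
Qed.

Lemma poly_appr_add f g : cmeas f -> cmeas g -> poly_appr f -> poly_appr g -> poly_appr (fun t => f t + g t).
Proof.
move=> mf mg hf hg e e0; have e4 : 0 < e / 4 by rewrite divr_gt0.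
have [p hp] := hf _ e4; have [q hq] := hg _ e4; exists (p + q).
have -> : (fun t => f t + g t - (p + q).[graph t]) = (fun t => (f t - p.[graph t]) + (g t - q.[graph t])).
  by apply/funext => t; rewrite hornerD; ring.
by apply: le_lt_trans (wnorm2_add _ _) (lt_half hp hq); apply: cmeas_sub => //; exact: cmeas_poly.
Qed.

Lemma wnorm2_scale c f : cmeas f -> wnorm2 (fun t => c * f t) = ((cabs c ^+ 2)%:E * wnorm2 f)%E.
Proof.
move=> hf; rewrite /wnorm2 -ge0_integralZl_EFin //; last 2 first.
- by apply: measurable_funTS; exact: mN.
- exact: sqr_ge0.
by apply: eq_integral => t _; rewrite -EFinM; congr EFin; rewrite cabsM; ring.
Qed.

Lemma poly_appr_scale c f : cmeas f -> poly_appr f -> poly_appr (fun t => c * f t).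
Proof.
move=> mf hf e e0.
have c0 : 0 < cabs c ^+ 2 + 1 by rewrite ltr_wpDl // sqr_ge0.
have [p hp] := hf (e / (cabs c ^+ 2 + 1)) ltac:(by rewrite divr_gt0).
exists (c *: p).
have -> : (fun t => c * f t - (c *: p).[graph t]) = (fun t => c * (f t - p.[graph t])).
  by apply/funext => t; rewrite hornerZ mulrBr.
rewrite wnorm2_scale; last by apply: cmeas_sub => //; exact: cmeas_poly.
apply: (@le_lt_trans _ _ ((cabs c ^+ 2 + 1)%:E * wnorm2 (fun t => f t - p.[graph t])%R)%E).
  by apply: lee_wpmul2r; rewrite ?wnorm2_ge0 // lee_fin lerDl.
have -> : e%:E = ((cabs c ^+ 2 + 1)%:E * (e / (cabs c ^+ 2 + 1))%:E)%E.
  by rewrite -EFinM mulrC mulfVK // gt_eqF.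
by rewrite lte_pmul2l.
Qed.

Lemma poly_appr_poly (p : {poly R[i]}) : poly_appr (fun t => p.[graph t]).
Proof.
move=> e e0; exists p; rewrite /wnorm2 (_ : \int[_]_(_ in _) _ = 0)%E ?lte_fin //.
by apply: integral0_eq => t _; rewrite subrr cabs0 expr0n mul0r.
Qed.

Lemma integral_dominated0 (h : nat -> R -> R) (H : R -> R) :
  (forall n, measurable_fun setT (h n)) -> measurable_fun setT H ->
  (forall n t, a <= t <= b -> 0 <= h n t <= H t) ->
  (\int[mu]_(t in `[a, b]) (H t)%:E < +oo)%E ->
  (forall t, a <= t <= b -> forall e : R, 0 < e -> exists N, forall n, (N <= n)%N -> h n t <= e) ->
  forall e : R, 0 < e -> exists n, (\int[mu]_(t in `[a, b]) (h n t)%:E < e%:E)%E.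
Proof.
move=> mh mH hH Hfin h0 e e0.
have Hge t : a <= t <= b -> 0 <= H t by move=> /(hH 0%N) /andP[h1 h2]; exact: le_trans h2.
have iH : mu.-integrable `[a, b]%classic (EFin \o H).
  apply/integrableP; split; first by apply/measurable_EFinP; exact: measurable_funTS.
  rewrite (_ : \int[_]_(_ in _) _ = \int[mu]_(t in `[a, b]) (H t)%:E)%E //.
  apply: eq_integral => t; rewrite inE /= in_itv /= => tab.
  by rewrite ger0_norm // Hge.
have cv : (\int[mu]_(t in `[a, b]) (h n t)%:E @[n --> \oo] --> \int[mu]_(t in `[a, b]) (cst 0 t))%E.
  apply: (@dominated_cvg _ _ _ mu `[a, b]%classic (measurable_itv _) (fun n t => (h n t)%:E) (cst 0)%E (fun t => (H t)%:E)) => //.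
  - by move=> n; apply/measurable_EFinP; exact: measurable_funTS.
  - move=> t /=; rewrite in_itv /= => tab; apply: cvg_EFin; first by near=> n.
    apply/cvgr0Pnorm_le => e' e'0; have [N hN] := h0 t tab e' e'0.
    exists N => // n /= /hN hn; rewrite ger0_norm //; by have /andP[] := hH n t tab.
  - move=> n t /=; rewrite in_itv /= => tab; have /andP[h1 h2] := hH n t tab.
    by rewrite lee_fin ger0_norm.
rewrite integral0 in cv.
have /cv : nbhs (0%E : \bar R) [set x | (x < e%:E)%E].
  by apply: open_nbhs_nbhs; split; [exact: open_ereal_lt_ereal|rewrite /= lte_fin].
by move=> [N _ hN]; exists N; exact: (hN N (leqnn N)).
Unshelve. all: by end_near.
Qed.

Lemma poly_appr_dominated (F : nat -> R -> R[i]) f (H : R -> R) : (forall n, cmeas (F n)) -> cmeas f ->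
  (forall n, poly_appr (F n)) -> measurable_fun setT H -> (\int[mu]_(t in `[a, b]) (H t)%:E < +oo)%E ->
  (forall n t, a <= t <= b -> cabs (f t - F n t) ^+ 2 * w t <= H t) ->
  (forall t, a <= t <= b -> forall e : R, 0 < e -> exists N, forall n, (N <= n)%N -> cabs (f t - F n t) <= e) ->
  poly_appr f.
Proof.
move=> mF mf aF mH Hfin dom cvF; apply: poly_appr_limit => // e e0.
have [|||n hn] := @integral_dominated0 (fun n t => cabs (f t - F n t) ^+ 2 * w t) H _ mH _ Hfin _ e e0; last first.
- by exists (F n).
- move=> t tab e' e'0; have w1 : 0 < w t + 1 by rewrite ltr_wpDl.
  have [N hN] := cvF t tab (Num.min 1 (e' / (w t + 1))) ltac:(by rewrite lt_min ltr01 divr_gt0).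
  exists N => n /hN hn; have c0 := cabs_ge0 (f t - F n t).
  have h1 : cabs (f t - F n t) <= 1 by apply: le_trans hn _; rewrite ge_min lexx.
  have h2 : cabs (f t - F n t) * (w t + 1) <= e'.
    by rewrite -ler_pdivlMr //; apply: le_trans hn _; rewrite ge_min lexx orbT.
  have := w0 t; move: (cabs _) (w t) c0 h1 h2 {hn w1} => X W X0 X1 h2 W0.
  rewrite expr2; nra.
- by move=> n t tab; rewrite dom // andbT mulr_ge0 // sqr_ge0.
- move=> n; apply: measurable_funM => //; apply: measurable_cabs_sqr; exact: cmeas_sub.
Qed.

Lemma poly_appr_bounded (F : nat -> R -> R[i]) f (C : R) : (forall n, cmeas (F n)) -> cmeas f ->
  (forall n, poly_appr (F n)) -> (forall n t, a <= t <= b -> cabs (F n t) <= C) ->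
  (forall t, a <= t <= b -> cabs (f t) <= C) ->
  (forall t, a <= t <= b -> forall e : R, 0 < e -> exists N, forall n, (N <= n)%N -> cabs (f t - F n t) <= e) ->
  poly_appr f.
Proof.
move=> mF mf aF bF bf cvF.
apply: (@poly_appr_dominated F f (fun t => (2 * C) ^+ 2 * w t)) => //.
- exact: measurable_funM.
- under eq_integral do rewrite EFinM.
  rewrite ge0_integralZl_EFin ?sqr_ge0 //; last 2 first.
  + by move=> t _; rewrite lee_fin.
  + by apply/measurable_EFinP; exact: measurable_funTS.
  apply: lte_mul_pinfty => //; by rewrite lee_fin sqr_ge0.
move=> n t tab; rewrite ler_wpM2r // ler_pXn2r ?nnegrE ?cabs_ge0 //.
  by apply: le_trans (cabsD _ _) _; rewrite cabsN; have := bF n t tab; have := bf t tab; lra.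
by rewrite mulr_ge0 // (le_trans (cabs_ge0 _) (bf t tab)).
Qed.

Lemma poly_appr_point f g (s : R) : cmeas f -> cmeas g -> poly_appr f -> (forall t, t != s -> f t = g t) -> poly_appr g.
Proof.
move=> mf mg hf fg; apply: poly_appr_limit => // e e0; exists f; split => //.
rewrite (_ : wnorm2 _ = 0)%E ?lte_fin //; apply/eqP; rewrite eq_le wnorm2_ge0 andbT.
pose h t := (cabs (g t - f t) ^+ 2 * w t)%:E.
have mh : measurable_fun setT h by apply: mN; exact: cmeas_sub.
apply: (@le_trans _ _ (\int[mu]_(t in [set s]) h t)%E); last by rewrite (integral_leb_set1 mh (fun t => N0 _ t)).
rewrite /wnorm2 integral_mkcond [leRHS]integral_mkcond.
apply: ge0_le_integral => //.
- by move=> t _; rewrite patchE; case: ifP => // _; exact: N0.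
- by apply/(measurable_restrictT _ (measurable_itv _)); apply: measurable_funTS; exact: mh.
- by apply/(measurable_restrictT _ (measurable_set1 s)); exact: measurable_funTS.
move=> t _; rewrite !patchE; have [->|ts] := eqVneq t s.
  rewrite [s \in [set s]]mem_set //; case: ifP => // _; exact: N0.
rewrite -fg // subrr cabs0 expr0n mul0r; case: ifP => _; case: ifP => // _; exact: N0.
Qed.

Variable L : R.
Hypothesis ylip : forall s t, `|y s - y t| <= L * `|s - t|.

Let L0 : 0 <= L.
Proof. by have := ylip 1 0; rewrite subr0 normr1 mulr1; apply: le_trans. Qed.

Lemma graph_bounded : exists M : R, forall t, `[a, b]%classic t -> cabs (graph t) <= M.
Proof.
exists (`|a| + `|b| + (`|y a| + L * (`|a| + `|b|))) => t /=; rewrite in_itv /= => /andP[ta tb].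
have tn : `|t| <= `|a| + `|b|.
  rewrite ler_norml; have := ler_norm b; have := ler_norm (- a); rewrite normrN.
  have := normr_ge0 a; have := normr_ge0 b; move=> ? ? ? ?; apply/andP; split; lra.
have yn : `|y t| <= `|y a| + L * (`|a| + `|b|).
  have := ler_normD (y t - y a) (y a); rewrite subrK.
  have : L * `|t - a| <= L * (`|a| + `|b|).
    apply: ler_wpM2l; first exact: L0.
    rewrite ger0_norm ?subr_ge0 //; have := ler_norm b; have := ler_norm (- a); rewrite normrN; lra.
  have := ylip t a; lra.
have -> : graph t = Complex t 0 + Complex 0 (y t) by apply/eqP; rewrite eq_complex /= addr0 add0r !eqxx.
apply: le_trans (cabsD _ _) _; apply: lerD; first by rewrite cabs_real.
by rewrite /cabs /= expr0n add0r sqrtr_sqr.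
Qed.

Lemma cmeas_csg (s : R) : cmeas (fun t => csg (t - s)).
Proof.
apply: cmeas_real; have -> : (fun t => Num.sg (t - s)) =
    (fun t => \1_(`]s, +oo[%classic : set R) t - \1_(`]-oo, s[%classic : set R) t).
  apply/funext => t; rewrite !indicE !mem_setE !in_itv /= andbT.
  have [ts|ts|->] := ltrgtP t s.
  - by rewrite sub0r ltr0_sg // subr_lt0.
  - by rewrite subr0 gtr0_sg // subr_gt0.
  - by rewrite !subrr sgr0.
by apply: measurable_funB; apply: measurable_indic.
Qed.

(** By the Lipschitz condition the chords [graph t - graph s] lie in the cone. The iterates of [dbl]
    along them are bounded uniform limits of polynomials converging pointwise to the sign, and the
    weight is integrable, so dominated convergence applies. *)
Lemma poly_appr_sign (s : R) : poly_appr (fun t => csg (t - s)).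
Proof.
have [M gM] := graph_bounded.
pose g t := graph t - graph s.
have gc t : in_cone L (g t) by rewrite /in_cone /g /= ylip.
have ug n : unif_poly `[a, b]%classic graph (fun t => iter n (@dbl R) (g t)).
  elim: n => [|n IH] /=.
    by apply: unif_poly_add; [exact: unif_poly_id|exact: unif_poly_cst].
  apply: (unif_poly_dbl gM L0) => // t _; exact: iter_in_cone.
(* The index is shifted by one because the uniform bound [2 * (1 + L)] holds only after [dbl] has
   been applied at least once. *)
pose ph n := projT1 (cid (ug n.+1 (n.+1%:R^-1) ltac:(by rewrite invr_gt0))).
have hph n t : a <= t <= b -> cabs (iter n.+1 (@dbl R) (g t) - (ph n).[graph t]) <= n.+1%:R^-1.
  by move=> tab; rewrite /ph; case: cid => p /=; apply; rewrite /= in_itv.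
apply: (@poly_appr_bounded (fun n t => (ph n).[graph t]) _ (2 * (1 + L) + 1)).
- by move=> n; exact: cmeas_poly.
- exact: cmeas_csg.
- by move=> n; exact: poly_appr_poly.
- move=> n t tab; have h1 := hph n t tab.
  have h2 : cabs (iter n.+1 (@dbl R) (g t)) <= 2 * (1 + L) := cabs_dbl L0 (iter_in_cone L0 n (gc t)).
  have h3 : n.+1%:R^-1 <= 1 :> R by rewrite invf_le1 ?ler1n.
  rewrite -[X in cabs X](subKr (iter n.+1 (@dbl R) (g t))); apply: le_trans (cabsD _ _) _.
  rewrite cabsN; move: (n.+1%:R^-1) h1 h3 => X h1 h3; lra.
- by move=> t _; apply: le_trans (cabs_csg _) _; have := L0; lra.
move=> t tab e e0; have e2 : 0 < e / 2 by rewrite divr_gt0.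
have [N hN] := iter_dbl_cvg L0 (gc t) e2.
have [N' hN'] : exists N', forall n, (N' <= n)%N -> n.+1%:R^-1 <= e / 2.
  exists (Num.bound (e / 2)^-1) => n hn; rewrite -[leRHS]invrK lef_pV2 ?posrE ?invr_gt0 //.
  apply: ltW; apply: lt_le_trans (archi_boundP _) _; first by rewrite invr_ge0 ltW.
  by rewrite ler_nat (leq_trans hn).
exists (maxn N N') => n; rewrite geq_max => /andP[n1 n2].
have gE : complex.Re (g t) = t - s by [].
apply: le_trans (cabs_triangle _ (iter n.+1 (@dbl R) (g t)) _) _.
have := hN n.+1 (leqW n1); rewrite gE cabsB; have := hph n t tab; have := hN' n n2.
by move: (n.+1%:R^-1) => X; lra.
Qed.

Let cmeas_ind (B : set R) : measurable B -> cmeas (fun t => Complex (\1_B t) 0).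
Proof. by move=> mB; apply: cmeas_real; exact: measurable_indic. Qed.

Lemma poly_appr_ray (s : R) : poly_appr (fun t => Complex (\1_(`]s, +oo[%classic : set R) t) 0).
Proof.
have msg := cmeas_csg s.
have m1 : cmeas (fun t => 1 + csg (t - s)) by apply: cmeas_add => //; exact: cmeas_cst.
(* Half of [1 + sign] agrees with the indicator of the ray except at [s], where it is [1 / 2]. *)
apply: (@poly_appr_point (fun t => Complex 2^-1 0 * (1 + csg (t - s))) _ s).
- by apply: cmeas_mul => //; exact: cmeas_cst.
- exact: cmeas_ind.
- apply: poly_appr_scale => //; apply: poly_appr_add => //.
  + have := poly_appr_poly 1%:P.
    by have -> : (fun t => (1%:P : {poly R[i]}).[graph t]) = (fun=> 1) by apply/funext => t; rewrite hornerC.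
  + exact: poly_appr_sign.
move=> t ts; rewrite /csg indicE mem_setE in_itv /= andbT.
apply/eqP; rewrite eq_complex /=; apply/andP; split; apply/eqP; last by ring.
have [h|h|h] := ltrgtP t s; last by rewrite h eqxx in ts.
  by rewrite ltr0_sg ?subr_lt0 //=; ring.
by rewrite gtr0_sg ?subr_gt0 //=; field.
Qed.

(** Rays generate the measurable sets and are stable under intersection, while approximable sets are
    stable under complements and, by domination, under countable disjoint unions; the Dynkin theorem
    concludes. *)
Lemma poly_appr_indic (B : set R) : measurable B -> poly_appr (fun t => Complex (\1_B t) 0).
Proof.
move=> mB.
suff : forall S, <<s @RGenOInfty.G R >> S -> measurable S /\ poly_appr (fun t => Complex (\1_S t) 0).
  have mB' : (@RGenOInfty.G R).-sigma.-measurable B by rewrite -RGenOInfty.measurableE.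
  by move=> h; exact: (h B mB').2.
apply: (@dynkin_induction _ (measurableTypeR R) (@RGenOInfty.G R)
  (fun S => measurable S /\ poly_appr (fun t => Complex (\1_S t) 0))).
- exact: RGenOInfty.measurableE.
- move=> _ _ [s ->] [s' ->]; exists (Num.max s s'); apply/seteqP; split => t /=;
    rewrite !in_itv /= !andbT gt_max; first by move=> [-> ->].
  by move=> /andP.
- split => //; have := poly_appr_poly 1%:P.
  have -> : (fun t => (1%:P : {poly R[i]}).[graph t]) = (fun t => Complex (\1_[set: R] t) 0) => //.
  by apply/funext => t; rewrite hornerC indicT.
- by move=> _ [s ->]; split; [exact: measurable_itv|exact: poly_appr_ray].
- move=> S _ [mS aS]; split; first exact: measurableC.
  have -> : (fun t => Complex (\1_(~` S) t) 0) = (fun t => 1%:P.[graph t] + (-1) * Complex (\1_S t) 0).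
    apply/funext => t; rewrite hornerC !indicE in_setC.
    by apply/eqP; rewrite eq_complex /=; apply/andP; split; apply/eqP; case: (t \in S) => /=; ring.
  apply: poly_appr_add; [exact: cmeas_poly| |exact: poly_appr_poly|].
    by apply: cmeas_mul; [exact: cmeas_cst|exact: cmeas_ind].
  by apply: poly_appr_scale => //; exact: cmeas_ind.
move=> F _ tF aF.
have mF n : measurable (F n) by exact: (aF n).1.
split; first exact: bigcup_measurable.
pose C n := \bigcup_(k in `I_n) F k.
have mC n : measurable (C n) by exact: bigcup_measurable.
have CS n : C n.+1 = C n `|` F n by rewrite /C IIS bigcup_setU bigcup_set1.
have dC n : C n `&` F n = set0.
  apply/seteqP; split => t // -[[k /= kn Fk] Fn].
  have := tF k n I I (ex_intro _ t (conj Fk Fn)) => kE.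
  by rewrite kE ltnn in kn.
have aC n : poly_appr (fun t => Complex (\1_(C n) t) 0).
  elim: n => [|n IH].
    have -> : (fun t => Complex (\1_(C 0%N) t) 0) = (fun t => (0 : {poly R[i]}).[graph t]).
      apply/funext => t; rewrite horner0 /C II0 bigcup_set0 indicE in_set0 //.
    exact: poly_appr_poly.
  have -> : (fun t : R => Complex (\1_(C n.+1) t : R) 0) =
      (fun t : R => Complex (\1_(C n) t : R) 0 + Complex (\1_(F n) t : R) 0).
    apply/funext => t; rewrite !indicE CS in_setU.
    apply/eqP; rewrite eq_complex /= addr0 eqxx andbT; apply/eqP.
    have [tC|tC] := boolP (t \in C n); have [tN|tN] := boolP (t \in F n); rewrite ?addr0 ?add0r //.
    exfalso; have : (C n `&` F n) t by split; exact: set_mem.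
    by rewrite dC.
  apply: poly_appr_add; [apply: cmeas_ind; exact: mC|apply: cmeas_ind; exact: mF|exact: IH|exact: (aF n).2].
apply: (@poly_appr_bounded (fun n t => Complex (\1_(C n) t) 0) _ 1) => //.
- by move=> n; apply: cmeas_ind; exact: mC.
- apply: cmeas_ind; apply: bigcup_measurable => k _; exact: mF.
- by move=> n t _; rewrite cabs_real indicE; case: (t \in _); rewrite ?normr1 ?normr0.
- by move=> t _; rewrite cabs_real indicE; case: (t \in _); rewrite ?normr1 ?normr0.
move=> t _ e e0; have [/set_mem [N _ FN]|tF'] := boolP (t \in \bigcup_k F k).
  exists N.+1 => n Nn; rewrite !indicE mem_set; last by exists N.
  rewrite mem_set; last by exists N.
  by rewrite subrr cabs0 ltW.
exists 0%N => n _; rewrite !indicE (negbTE tF') memNset.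
  by rewrite subrr cabs0 ltW.
by move=> [k _ Fk]; move: tF'; rewrite mem_set //; exists k.
Qed.

(** A layer-cake step function: below [n * d] it rounds [x] up to a multiple of [d], and it is a
    finite combination of indicators of superlevel sets. *)
Let layer (d : R) (n : nat) (x : R) : R := \sum_(k < n) d * ((k%:R * d < x)%R%:R : R).

Let layerP (d : R) n x : 0 < d -> 0 <= x ->
  (n%:R * d <= x -> layer d n x = n%:R * d) /\ (x < n%:R * d -> x <= layer d n x <= x + d).
Proof.
move=> d0 x0; rewrite /layer; elim: n => [|n [IH1 IH2]].
  by rewrite big_ord0 mul0r; split => // /(le_lt_trans x0); rewrite ltxx.
rewrite big_ord_recr /=; have nS : n.+1%:R * d = n%:R * d + d by rewrite -natr1 mulrDl mul1r.
split => h.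
  have nx : n%:R * d < x by lra.
  by rewrite IH1 ?(ltW nx) // nx mulr1 nS.
have [h1|h1|h1] := ltrgtP (n%:R * d) x.
- rewrite IH1 ?(ltW h1) // mulr1; apply/andP; split; lra.
- by rewrite mulr0 addr0; exact: IH2.
- by rewrite mulr0 addr0 IH1 ?h1 // lexx /= lerDl ltW.
Qed.

Lemma poly_appr_ge0_bounded (r : R -> R) (C : R) : measurable_fun setT r -> (forall t, 0 <= r t < C) ->
  poly_appr (fun t => Complex (r t) 0).
Proof.
move=> mr rC; have C0 : 0 < C by have /andP[h1 h2] := rC 0; exact: le_lt_trans h2.
pose F (n : nat) t := Complex (layer (C / n.+1%:R) n.+1 (r t)) 0.
have mS (c : R) : measurable [set t | c < r t].
  have := mr measurableT _ (measurable_itv `]c, +oo[); rewrite setTI.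
  by congr measurable; apply/seteqP; split => t /=; rewrite in_itv /= andbT.
have dn (n : nat) : n.+1%:R * (C / n.+1%:R) = C by rewrite mulrC mulfVK // pnatr_eq0.
have hF n t : r t <= layer (C / n.+1%:R) n.+1 (r t) <= r t + C / n.+1%:R.
  have /andP[h1 h2] := rC t; have := layerP n.+1 (divr_gt0 C0 (ltr0Sn R n)) h1.
  by rewrite dn => -[_ /(_ h2)].
have pF (d : R) n : cmeas (fun t => Complex (layer d n (r t)) 0) /\ poly_appr (fun t => Complex (layer d n (r t)) 0).
  elim: n => [|n [IH1 IH2]].
    have -> : (fun t => Complex (layer d 0 (r t)) 0) = (fun t => (0 : {poly R[i]}).[graph t]).
      by apply/funext => t; rewrite horner0 /layer big_ord0.
    by split; [exact: cmeas_poly|exact: poly_appr_poly].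
  have -> : (fun t => Complex (layer d n.+1 (r t)) 0) =
      (fun t => Complex (layer d n (r t)) 0 + Complex d 0 * Complex (\1_[set t | n%:R * d < r t] t) 0).
    apply/funext => t; rewrite /layer big_ord_recr /= indicE.
    apply/eqP; rewrite eq_complex /=; apply/andP; split; apply/eqP; last by ring.
    have -> : (t \in [set t | n%:R * d < r t]) = (n%:R * d < r t) by apply/idP/idP => [/set_mem|h]; [|exact: mem_set].
    by ring.
  have mi := cmeas_ind (mS (n%:R * d)).
  have mm : cmeas (fun t => Complex d 0 * Complex (\1_[set t | n%:R * d < r t] t) 0).
    by apply: cmeas_mul => //; exact: cmeas_cst.
  split; first exact: cmeas_add.
  by apply: poly_appr_add => //; apply: poly_appr_scale => //; exact: poly_appr_indic.
have real_sub (x z : R) : Complex x 0 - Complex z 0 = Complex (x - z) 0.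
  by apply/eqP; rewrite eq_complex /= subrr !eqxx.
apply: (@poly_appr_bounded F _ (2 * C)).
- by move=> n; exact: (pF _ _).1.
- exact: cmeas_real.
- by move=> n; exact: (pF _ _).2.
- move=> n t _; rewrite cabs_real; have /andP[h1 h2] := hF n t; have /andP[h3 h4] := rC t.
  rewrite ger0_norm; last exact: le_trans h1.
  have h5 : C / n.+1%:R <= C by rewrite ler_pdivrMr ?ltr0Sn // ler_peMr ?(ltW C0) // ler1n.
  apply: le_trans h2 _; move: (C / n.+1%:R) h5 => X h5; lra.
- by move=> t _; rewrite cabs_real; have /andP[h3 h4] := rC t; rewrite ger0_norm //; lra.
move=> t _ e e0; exists (Num.bound (C / e)) => n hn.
rewrite /F real_sub cabs_real distrC; have /andP[h1 h2] := hF n t.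
rewrite ger0_norm ?subr_ge0 //; apply: (@le_trans _ _ (C / n.+1%:R)); first by rewrite lerBlDl.
rewrite ler_pdivrMr // mulrC -ler_pdivrMr //.
apply: ltW; apply: lt_le_trans (archi_boundP _) _; first by rewrite divr_ge0 // ltW.
by rewrite ler_nat (leq_trans hn).
Qed.

Lemma poly_appr_ge0 (r : R -> R) : measurable_fun setT r -> (forall t, 0 <= r t) ->
  (wnorm2 (fun t => Complex (r t) 0%R) < +oo)%E -> poly_appr (fun t => Complex (r t) 0).
Proof.
move=> mr r0 rfin.
have real_sub (x z : R) : Complex x 0 - Complex z 0 = Complex (x - z) 0.
  by apply/eqP; rewrite eq_complex /= subrr !eqxx.
have mm n : measurable_fun setT (fun t => Num.min (r t) n%:R) by apply: measurable_minr.
have mn n t : 0 <= r t - Num.min (r t) n%:R <= r t.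
  have [h|h] := leP (r t) n%:R; first by rewrite subrr lexx r0.
  by rewrite subr_ge0 ltW //= lerBlDr lerDl.
apply: (@poly_appr_dominated (fun n t => Complex (Num.min (r t) n%:R) 0) _ (fun t => cabs (Complex (r t) 0) ^+ 2 * w t)).
- by move=> n; exact: cmeas_real.
- exact: cmeas_real.
- move=> n; apply: (@poly_appr_ge0_bounded _ (n%:R + 1)) => // t.
  by rewrite le_min r0 ler0n /= gt_min; apply/orP; right; rewrite ltrDl.
- by apply: measurable_funM => //; apply: measurable_cabs_sqr; exact: cmeas_real.
- exact: rfin.
- move=> n t _; rewrite ler_wpM2r // real_sub !cabs_real; have /andP[h1 h2] := mn n t.
  by rewrite ler_pXn2r ?nnegrE // !ger0_norm.
move=> t _ e e0; exists (Num.bound (r t)) => n hn; rewrite real_sub (_ : Num.min _ _ = r t).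
  by rewrite subrr cabs_real normr0 ltW.
apply/min_idPl; apply: ltW; apply: lt_le_trans (archi_boundP (r0 t)) _.
by rewrite ler_nat.
Qed.

Lemma poly_appr_L2 f : cmeas f -> (wnorm2 f < +oo)%E -> poly_appr f.
Proof.
move=> [f1 f2] ffin.
have pos (r : R -> R) : measurable_fun setT r -> (forall t, `|r t| <= cabs (f t)) ->
    poly_appr (fun t => Complex (r t) 0).
  move=> mr rf.
  have sub (s : R -> R) : measurable_fun setT s -> (forall t, 0 <= s t <= `|r t|) -> poly_appr (fun t => Complex (s t) 0).
    move=> ms hs; apply: poly_appr_ge0 => //; first by move=> t; have /andP[] := hs t.
    apply: le_lt_trans ffin; apply: ge0_le_integral => //.
    - by apply: measurable_funTS; apply: mN; exact: cmeas_real.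
    - by apply: measurable_funTS; apply: mN.
    move=> t _; rewrite lee_fin ler_wpM2r // cabs_real; have /andP[h1 h2] := hs t.
    by rewrite ler_pXn2r ?nnegrE ?cabs_ge0 // ger0_norm // (le_trans h2).
  have mp : measurable_fun setT (fun t => Num.max (r t) 0) by apply: measurable_maxr.
  have mq : measurable_fun setT (fun t => Num.max (- r t) 0).
    by apply: measurable_maxr => //; exact: measurableT_comp.
  have -> : (fun t => Complex (r t) 0) = (fun t => Complex (Num.max (r t) 0) 0 + (-1) * Complex (Num.max (- r t) 0) 0).
    apply/funext => t; apply/eqP; rewrite eq_complex /=; apply/andP; split; apply/eqP; last by ring.
    by have [h|h] := leP (r t) 0; have [h'|h'] := leP (- r t) 0; lra.
  have cq : cmeas (fun t => Complex (Num.max (- r t) 0) 0) by exact: cmeas_real.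
  apply: poly_appr_add; first exact: cmeas_real.
  - by apply: cmeas_mul => //; exact: cmeas_cst.
  - apply: sub => // t; rewrite le_max lexx orbT ge_max normr_ge0 andbT; exact: ler_norm.
  - apply: poly_appr_scale => //; apply: sub => // t.
    by rewrite le_max lexx orbT ge_max normr_ge0 andbT -normrN; exact: ler_norm.
have -> : f = (fun t => Complex (complex.Re (f t)) 0 + Complex 0 1 * Complex (complex.Im (f t)) 0).
  by apply/funext => t; case: (f t) => u v; apply/eqP; rewrite eq_complex /=; apply/andP; split; apply/eqP; ring.
have cI : cmeas (fun t => Complex (complex.Im (f t)) 0) by exact: cmeas_real.
apply: poly_appr_add; first exact: cmeas_real.
- by apply: cmeas_mul => //; exact: cmeas_cst.
- by apply: pos => // t; exact: cabs_Re.
- by apply: poly_appr_scale => //; apply: pos => // t; exact: cabs_Im.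
Qed.

End weighted_density.

(** * Lelong numbers and the theorem *)

Section lelong_number.
Context {R : realType}.
Variables (phi : R[i] -> \bar R) (phiP : subharmonic phi).

Definition plane_fun (f : R[i] -> \bar R) (p : R * R) : \bar R := f (Complex p.1 p.2).
Local Notation Phi := (plane_fun phi).

Lemma sqn_lt_cabs (w z : R[i]) (d : R) : 0 < d ->
  (sqn (psub (complex.Re w, complex.Im w) (complex.Re z, complex.Im z)) < d ^+ 2) = (cabs (w - z) < d).
Proof.
move=> d0; rewrite -[RHS](ltr_pXn2r (n := 2)) ?nnegrE ?cabs_ge0 ?(ltW d0) // cabs_sqr.
by case: w z => ? ? [].
Qed.

Lemma subharmonic_planeP : subharmonic_plane Phi.
Proof.
have [h1 h2 [z0 h3] h4] := phiP; split.
- by move=> p; exact: h1.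
- move=> z c /h2[d d0 hd]; exists d => // w hw; apply: hd.
  by rewrite -sqn_lt_cabs //= -!surjective_pairing.
- by exists (complex.Re z0, complex.Im z0); rewrite /plane_fun /=; case: z0 h3.
- by move=> z r r0; exact: (h4 (Complex z.1 z.2) r r0).
Qed.

Variable z : R[i].
Let z0 : R * R := (complex.Re z, complex.Im z).
Let M := disc_sup Phi 0 z0 z0.

(** The maximum principle identifies the supremum over the circle, which defines the Lelong number,
    with the supremum over the disc, which is convex in the logarithm of the radius. *)
Lemma circle_sup (r : R) : 0 < r -> ereal_sup (range (fun theta => phi (circ z r theta))) = (M r)%:E.
Proof.
move=> r0; have PhiP := subharmonic_planeP.
have ub theta : (phi (circ z r theta) <= (M r)%:E)%E.
  have := @disc_sup_ub _ Phi PhiP 0 z0 (lexx 0) (log_bounded0 Phi z0) z0 r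
    (complex.Re z + r * cos theta, complex.Im z + r * sin theta).
  rewrite mul0r add0r; apply; last exact: off_pole0.
  rewrite (_ : sqn _ = r ^+ 2 * (cos theta ^+ 2 + sin theta ^+ 2)); last by rewrite /sqn /=; ring.
  by rewrite cos2Dsin2 mulr1.
have lb (B : R) : (ereal_sup (range (fun theta => phi (circ z r theta))) <= B%:E)%E -> M r <= B.
  move=> hB; apply: (disc_sup_circle_le PhiP) => // q qr.
  have [s [c [s0 _ qE sE]]] := polar_form (psub q z0).
  have sr : s = r.
    by apply/eqP; rewrite -(eqrXn2 (n := 2)) // ?(ltW r0) // -sE qr.
  apply: le_trans hB; apply: ereal_sup_ubound; exists c => //; rewrite /circ -sr /plane_fun.
  by case: qE => <- <- /=; congr (phi (Complex _ _)); ring.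
apply/eqP; rewrite eq_le; apply/andP; split.
  by apply: ge_ereal_sup => _ [theta _ <-].
case E : (ereal_sup _) => [B| |]; rewrite ?leey //.
  by rewrite lee_fin; apply: lb; rewrite E.
by exfalso; have := lb (M r - 1); rewrite E leNye => /(_ isT); lra.
Qed.

(** With [r = expR x], the limit defining the Lelong number is that of a nondecreasing convex
    function divided by [x] as [x] tends to [-oo]. *)
Lemma lelong_slope : exists nu : R, [/\ 0 <= nu, lelong phi z = nu%:E,
  forall x y, x < y -> nu * (y - x) <= M (expR y) - M (expR x) &
  forall m, nu < m -> exists X, forall x y, x < y -> y <= X -> M (expR y) - M (expR x) <= m * (y - x)].
Proof.
have PhiP := subharmonic_planeP; have loc := log_bounded0 Phi z0.
have fnd x y : x <= y -> M (expR x) <= M (expR y).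
  move=> xy; apply: (disc_sup_homo PhiP (lexx 0) loc); first exact: expR_gt0.
  by rewrite ler_expR.
have [nu [nu0 h1 h2 h3]] := convex_slope_limit fnd (disc_sup_convex PhiP (lexx 0) loc z0).
exists nu; split => //; rewrite /lelong; apply: cvg_lim => //.
have : M r / ln r @[r --> 0^'+] --> nu.
  apply/cvgrPdist_le => e e0; have [X hX] := h3 e e0.
  near=> r; have r0 : 0 < r by near: r; exact: nbhs_right_gt.
  rewrite distrC -{1}(@lnK _ r) ?posrE //; apply: hX.
  rewrite -(expRK X) ltr_ln ?posrE ?expR_gt0 //.
  by near: r; apply: nbhs_right_lt; exact: expR_gt0.
move=> h; apply: cvg_EFin.
  by near=> r; rewrite circle_sup //; near: r; exact: nbhs_right_gt.
apply: cvg_trans h; apply: near_eq_cvg; near=> r.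
have r0 : 0 < r by near: r; exact: nbhs_right_gt.
by rewrite /= circle_sup.
Unshelve. all: by end_near.
Qed.

Variables (y : R -> R) (L t0 : R).
Hypothesis ylip : forall s t, `|y s - y t| <= L * `|s - t|.
Hypothesis my : measurable_fun setT y.
Hypothesis zE : z = Complex t0 (y t0).

Lemma lelong_weight_integrable : exists2 e : R, 0 < e &
  (\int[@leb R]_(t in `](t0 - e)%R, (t0 + e)%R[)
    pole_weight Phi (Num.truncn (fine (lelong phi z)))%:R z0 y t < +oo)%E.
Proof.
have PhiP := subharmonic_planeP.
have [nu [nu0 -> h1 h2]] := lelong_slope; rewrite /=.
have /andP[k1 k2] := truncn_itv nu0; set k := (Num.truncn nu)%:R : R.
have k0 : 0 <= k by exact: ler0n.
have k2' : nu < k + 1 by rewrite /k natr1.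
have loc := lelong_log_bounded PhiP h1 k1.
have [d [m [d0 m0 m1 slope]]] := disc_sup_local_slope PhiP h1 h2 k0 k1 k2'.
have z0E : z0 = (t0, y t0) by rewrite /z0 zE.
rewrite z0E in loc slope *.
exact: (pole_weight_locally_integrable PhiP my ylip k0 loc d0 m0 m1 slope).
Qed.

End lelong_number.

(** The integral of a nonnegative function is a supremum over simple functions below it, hence
    monotone even without measurability. It is used for integrands containing [arcdens], whose
    measurability is not established. *)
Lemma integral_le_unmeasured (R : realType) (D : set R) (F G : R -> \bar R) :
  (forall t, D t -> (0 <= F t)%E) -> (forall t, D t -> (F t <= G t)%E) ->
  (\int[@lebesgue_measure R]_(t in D) F t <= \int[@lebesgue_measure R]_(t in D) G t)%E.
Proof.
move=> F0 FG; rewrite integral_mkcond [leRHS]integral_mkcond.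
have r0 (H : R -> \bar R) : (forall t, D t -> (0 <= H t)%E) -> forall t, (0 <= (H \_ D) t)%E.
  by move=> H0 t; rewrite patchE; case: ifPn => // /set_mem /H0.
rewrite !ge0_integralTE; last 2 first.
- by apply: r0 => t Dt; apply: le_trans (F0 t Dt) (FG t Dt).
- exact: r0.
apply: le_ereal_sup => _ [h hF <-]; exists h => // t; apply: le_trans (hF t) _.
by rewrite !patchE; case: ifPn => // /set_mem /FG.
Qed.

(** * Extension of the graph to the line and bounds on the arc length density *)

Section clamped_lipschitz.
Context {R : realType}.
Variables (a b L : R) (y : R -> R).
Hypotheses (ab : a < b) (ylip : forall s t, a <= s <= b -> a <= t <= b -> `|y s - y t| <= L * `|s - t|).

(** Nothing is assumed about [y] outside [[a, b]]; composing it with this projection gives a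
    Lipschitz function on the line with the same constant and the same graph over [[a, b]]. *)
Definition clamp (t : R) : R := Num.min b (Num.max a t).

Lemma clamp_itv t : a <= clamp t <= b.
Proof. by rewrite /clamp ge_min lexx /= le_min (ltW ab) le_max lexx. Qed.

Lemma clamp_id t : a <= t <= b -> clamp t = t.
Proof. by move=> /andP[ta tb]; rewrite /clamp; apply: etrans (_ : Num.min b t = t); [congr Num.min; exact/max_idPr|exact/min_idPr]. Qed.

Lemma lipschitz_ge0 : 0 <= L.
Proof.
have := ylip (s := b) (t := a); rewrite !lexx (ltW ab) => /(_ isT isT).
have ba : 0 < b - a by rewrite subr_gt0.
by rewrite (gtr0_norm ba) => /(le_trans (normr_ge0 _)); rewrite pmulr_lge0.
Qed.

Lemma clamp_lip s t : `|y (clamp s) - y (clamp t)| <= L * `|s - t|.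
Proof.
apply: le_trans (ylip (clamp_itv s) (clamp_itv t)) _; apply: ler_wpM2l; first exact: lipschitz_ge0.
rewrite /clamp; apply: (@le_trans _ _ `|Num.max a s - Num.max a t|).
  move: (Num.max a s) (Num.max a t) => u v; rewrite /Num.min.
  have := ler_norm (u - v); have := ler_norm (v - u); rewrite (distrC v u) => h1 h2.
  by case: ltP => h3; case: ltP => h4; rewrite ler_norml; apply/andP; split; lra.
rewrite /Num.max; have := ler_norm (s - t); have := ler_norm (t - s); rewrite (distrC t s) => h1 h2.
by case: ltP => h3; case: ltP => h4; rewrite ler_norml; apply/andP; split; lra.
Qed.

Lemma measurable_clamped : measurable_fun setT (fun t => y (clamp t)).
Proof.
apply: continuous_measurable_fun => t; apply/cvgrPdist_le => e e0.
have L1 : 0 < L + 1 by have := lipschitz_ge0; lra.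
near=> s; apply: le_trans (clamp_lip t s) _.
apply: (@le_trans _ _ ((L + 1) * `|t - s|)); first by rewrite ler_wpM2r // lerDl.
rewrite mulrC -ler_pdivlMr //; near: s.
by apply: cvgr_dist_le => //; rewrite divr_gt0.
Unshelve. all: by end_near.
Qed.

(** The endpoints are left out because difference quotients there involve values of [y] outside
    [[a, b]]. *)
Lemma derive1_lip_bound t : a < t < b -> `|derive1 y t| <= L.
Proof.
move=> /andP[ta tb]; rewrite /derive1.
set q := (fun h : R => _).
(* Where the difference quotient has no limit, [derive1] takes the default value [0]. *)
have [cq|ncq] := pselect (cvg (q @ 0^')); last by rewrite (dvgP ncq) normr0 lipschitz_ge0.
have near_q : \forall h \near 0^', `|q h| <= L.
  near=> h; have h0 : h != 0 by near: h; exact: nbhs_dnbhs_neq.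
  have hs : `|h| < Num.min (t - a) (b - t).
    near: h; apply: dnbhs0_lt; by rewrite lt_min !subr_gt0 ta.
  move: hs; rewrite lt_min !ltr_norml => /andP[/andP[h1 h2] /andP[h3 h4]].
  rewrite /q normrZ normfV mulrC ler_pdivrMr ?normr_gt0 //.
  have := ylip (s := h + t) (t := t); rewrite addrK; apply; apply/andP; split; lra.
rewrite ler_norml; apply/andP; split.
  apply: limr_ge => //; apply: filterS near_q => h.
  by rewrite ler_norml => /andP[].
apply: limr_le => //; apply: filterS near_q => h.
by rewrite ler_norml => /andP[].
Unshelve. all: by end_near.
Qed.

Lemma arcdens_ge1 t : 1 <= arcdens y t.
Proof. by rewrite /arcdens -[leLHS]sqrtr1 ler_sqrt ?lerDl ?sqr_ge0 // addr_ge0 // sqr_ge0. Qed.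

Lemma arcdens_le t : a < t < b -> arcdens y t <= Num.sqrt (1 + L ^+ 2).
Proof.
move=> /derive1_lip_bound h; rewrite /arcdens ler_sqrt ?addr_ge0 ?sqr_ge0 // lerD2l.
by rewrite -real_normK ?num_real // ler_pXn2r ?nnegrE // lipschitz_ge0.
Qed.

End clamped_lipschitz.

Lemma weightE (R : realType) (phi : R[i] -> \bar R) z : weight phi z = expeR (- phi z).
Proof. by rewrite /weight; case: (phi z). Qed.

Section cmeas_more.
Context {R : realType}.

Lemma cmeas_restrict (a b : R) (f : R -> R[i]) : measurable_fun `[a, b] (fun t => complex.Re (f t)) ->
  measurable_fun `[a, b] (fun t => complex.Im (f t)) ->
  cmeas (fun t => if a <= t <= b then f t else 0).
Proof.
move=> m1 m2; split.
  have := (measurable_restrictT _ (measurable_itv `[a, b])).1 m1.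
  congr measurable_fun; apply/funext => t; rewrite patchE mem_setE in_itv /=; by case: ifP.
have := (measurable_restrictT _ (measurable_itv `[a, b])).1 m2.
congr measurable_fun; apply/funext => t; rewrite patchE mem_setE in_itv /=; by case: ifP.
Qed.

Lemma measurable_invr : measurable_fun setT (fun x : R => x^-1).
Proof.
have -> : (fun x : R => x^-1) = (fun x => if x == 0 then 0 else x^-1).
  by apply/funext => x; case: eqP => // ->; rewrite invr0.
apply: (measurability _ (RGenOInfty.measurableE R)) => _ [_ [c ->]] <-; rewrite setTI.
rewrite (_ : _ @^-1` _ = (`]0, +oo[%classic `&` [set x | c * x < 1]) `|`
   (`]-oo, 0[%classic `&` [set x | 1 < c * x]) `|` (if c < 0 then [set 0] else set0)).
  have m1 : measurable_fun setT (fun x : R => c * x) by exact: measurable_funM.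
  have := m1 measurableT _ (measurable_itv `]-oo, 1[); have := m1 measurableT _ (measurable_itv `]1, +oo[).
  rewrite !setTI => h1 h2; apply: measurableU; last by case: ifP.
  apply: measurableU; apply: measurableI => //.
  by move: h1; congr measurable; apply/seteqP; split => x /=; rewrite in_itv /= andbT.
apply/seteqP; split => x /=; rewrite !in_itv /= ?andbT.
  have [x0|x0|->] := ltrgtP x 0; rewrite ?(gt_eqF x0) ?(lt_eqF x0).
  - by rewrite -[x^-1]mul1r ltr_ndivlMr // => h; left; right.
  - by rewrite -[x^-1]mul1r ltr_pdivlMr // => h; left; left.
  - by move=> ->; right.
case=> [[[x0 h]|[x0 h]]|].
- by rewrite gt_eqF // -[x^-1]mul1r ltr_pdivlMr.
- by rewrite lt_eqF // -[x^-1]mul1r ltr_ndivlMr.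
- by case: ifP => // c0 ->; rewrite eqxx.
Qed.

Lemma cmeas_inv (f : R -> R[i]) : cmeas f -> cmeas (fun t => (f t)^-1).
Proof.
move=> [f1 f2].
have mn : measurable_fun setT (fun t => (complex.Re (f t) ^+ 2 + complex.Im (f t) ^+ 2)^-1).
  apply: (measurableT_comp measurable_invr); apply: measurable_funD; exact: measurable_funX.
have f2' : measurable_fun setT (fun t => - complex.Im (f t)) by exact: measurableT_comp.
split; [have := measurable_funM f1 mn|have := measurable_funM f2' mn].
  by congr measurable_fun; apply/funext => t /=; case: (f t).
by congr measurable_fun; apply/funext => t /=; case: (f t) => u v /=; rewrite mulNr.
Qed.

End cmeas_more.

(** * The criterion for density *)

Section density_criterion.
Context {R : realType}.
Local Notation mu := (@leb R).
Variables (a b L : R) (y : R -> R) (phi : R[i] -> \bar R) (ts : seq R).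
Hypotheses (ab : a < b) (ylip : forall s t, a <= s <= b -> a <= t <= b -> `|y s - y t| <= L * `|s - t|).
Hypotheses (phiP : subharmonic phi) (uts : uniq ts).
Hypothesis htsP : forall t : R, t \in ts <-> (a <= t <= b /\ (1 <= lelong phi (gam y t))%E).

Let ye t := y (clamp a b t).
Let yelip : forall s t, `|ye s - ye t| <= L * `|s - t| := clamp_lip ab ylip.
Let mye : measurable_fun setT ye := measurable_clamped ab ylip.
Let L0 : 0 <= L := lipschitz_ge0 ab ylip.
Local Notation Phi := (plane_fun phi).
Let Q : {poly R[i]} := Qpoly y phi ts.

Let gamE t : a <= t <= b -> gam y t = graph ye t.
Proof. by move=> tab; rewrite /gam /graph /ye clamp_id. Qed.

Let omega t := expeR (- phi (graph ye t)).

Let momega : measurable_fun setT omega.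
Proof.
apply: (measurableT_comp (@measurable_expeR R)); apply: measurableT_comp => //.
have mg : measurable_fun setT (fun t => (t, ye t)) by exact: measurable_fun_pair.
exact: (measurableT_comp (measurable_subharmonic_plane (subharmonic_planeP phiP)) mg).
Qed.

Let omega0 t : (0 <= omega t)%E. Proof. exact: expeR_ge0. Qed.

(** At every point of the graph [Q] contains the factor of order the integer part of the Lelong
    number: at the listed points by construction, elsewhere with exponent [0] since the Lelong
    number is below [1]. *)
Let Q_factor t0 : a <= t0 <= b -> exists q : {poly R[i]},
  Q = ('X - (gam y t0)%:P) ^+ Num.truncn (fine (lelong phi (gam y t0))) * q.
Proof.
move=> tab; have [tin|tout] := boolP (t0 \in ts).
  by rewrite /Q /Qpoly (bigD1_seq t0) //=; eexists; reflexivity.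
exists Q; rewrite (_ : Num.truncn _ = 0%N) ?expr0 ?mul1r //.
have [nu [nu0 E _ _]] := lelong_slope phiP (gam y t0).
rewrite E /=; apply/eqP; rewrite -leqn0 leqNgt; apply/negP => h.
move/negP: tout; apply; apply/htsP; split => //.
by rewrite E lee_fin; move: h; rewrite truncn_gt0.
Qed.

Let poly_bounded (q : {poly R[i]}) : exists2 B : R, 0 <= B & forall t, a <= t <= b -> cabs q.[graph ye t] <= B.
Proof.
have [M gM] := graph_bounded a b yelip; have [B B0 hB] := horner_bounded gM q.
by exists B => // t tab; apply: hB; rewrite /= in_itv.
Qed.

Let W t := ((cabs Q.[graph ye t])%:E * omega t)%E.

Let mabsQ : measurable_fun setT (fun t => cabs Q.[graph ye t]).
Proof.
have [q1 q2] := @cmeas_poly _ ye mye Q.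
rewrite /cabs; apply: (measurableT_comp (f := @Num.sqrt R)); first by apply: continuous_measurable_fun; exact: sqrt_continuous.
by apply: measurable_funD; exact: measurable_funX.
Qed.

Let mW : measurable_fun setT W.
Proof. by apply: emeasurable_funM => //; apply/measurable_EFinP. Qed.

Let W0 t : (0 <= W t)%E.
Proof. by rewrite mule_ge0 // lee_fin cabs_ge0. Qed.

(** Near [t0] the cofactor of [Q] is bounded, so [W] is at most a multiple of the locally integrable
    [pole_weight]; finiteness on [[a, b]] follows from finiteness near each of its points. *)
Let Wfin : (\int[mu]_(t in `[a, b]) W t < +oo)%E.
Proof.
apply: (integral_segment_lty mW W0 ab) => t0 tab.
have [q QE] := Q_factor tab; have [C C0 hC] := poly_bounded q.
have [e e0 he] := lelong_weight_integrable phiP (z := gam y t0) yelip mye (gamE tab).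
exists e => //.
set k := Num.truncn _ in QE he.
have mI : measurable (`[a, b]%classic `&` `](t0 - e)%R, (t0 + e)%R[%classic : set R) by exact: measurableI.
have PhiP := subharmonic_planeP phiP.
pose pw := pole_weight Phi k%:R (complex.Re (gam y t0), complex.Im (gam y t0)) ye.
have mpw : measurable_fun setT pw by exact: measurable_pole_weight.
have pw0 t : (0 <= pw t)%E by exact: pole_weight_ge0.
apply: (@le_lt_trans _ _ (\int[mu]_(t in `[a, b]%classic `&` `](t0 - e)%R, (t0 + e)%R[%classic) (C%:E * pw t))%E).
  apply: ge0_le_integral => //.
  - exact: measurable_funTS.
  - by apply: measurable_funeM; exact: measurable_funTS.
  move=> t [/=]; rewrite in_itv /= => tab' _.
  rewrite /pw /pole_weight muleA; apply: lee_wpmul2r; first exact: expeR_ge0.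
  rewrite -EFinM lee_fin QE hornerM horner_exp hornerXsubC cabsM cabsX mulrC.
  apply: ler_pM; rewrite ?cabs_ge0 ?exprn_ge0 ?cabs_ge0 //; first exact: hC.
  have [D0|D0] := ltP 0 (sqn (psub (t, ye t) (complex.Re (gam y t0), complex.Im (gam y t0)))).
    rewrite expRM_natl /logdist.
    have c0 : 0 < cabs (graph ye t - gam y t0) by rewrite sqrtr_gt0.
    have -> : ln (sqn (psub (t, ye t) (complex.Re (gam y t0), complex.Im (gam y t0)))) / 2 =
        ln (cabs (graph ye t - gam y t0)).
      rewrite (_ : sqn _ = cabs (graph ye t - gam y t0) ^+ 2); last by rewrite cabs_sqr.
      by rewrite lnXn // -mulr_natl; field.
    by rewrite lnK ?posrE.
  have -> : cabs (graph ye t - gam y t0) = 0.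
    by apply/eqP; rewrite /cabs sqrtr_eq0.
  by case: k {QE he pw mpw pw0} => [|k]; rewrite ?expr0 ?mul0r ?expR0 // expr0n expR_ge0.
rewrite ge0_integralZl_EFin //; last exact: measurable_funTS.
apply: lte_mul_pinfty; rewrite ?lee_fin //.
apply: le_lt_trans he; apply: ge0_subset_integral => //.
  by apply: measurable_funTS.
Qed.

(** The approximation results take a real weight. [W] may be [+oo], but only on a null set because
    its integral is finite, so integrals against [w] and [W] agree. *)
Let w t := fine (W t).

Let mw : measurable_fun setT w.
Proof. exact: (measurableT_comp (fine_measurable _) mW). Qed.

Let w0 t : 0 <= w t. Proof. by rewrite /w fine_ge0. Qed.

Let W_ae : {ae mu, forall t, `[a, b]%classic t -> W t \is a fin_num}.
Proof.
apply: integrable_ae => //; apply/integrableP; split; first exact: measurable_funTS.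
by have -> : (\int[mu]_(t in `[a, b]) `|W t| = \int[mu]_(t in `[a, b]) W t)%E by apply: eq_integral => t _; rewrite gee0_abs.
Qed.

Let integral_w (h : R -> R) : measurable_fun setT h -> (forall t, 0 <= h t) ->
  (\int[mu]_(t in `[a, b]) (h t * w t)%:E = \int[mu]_(t in `[a, b]) ((h t)%:E * W t))%E.
Proof.
move=> mh h0; apply: ge0_ae_eq_integral => //.
- by apply/measurable_EFinP; apply: measurable_funTS; exact: measurable_funM.
- by apply: measurable_funTS; apply: emeasurable_funM => //; apply/measurable_EFinP.
- by move=> t _; rewrite lee_fin mulr_ge0.
- by move=> t _; rewrite mule_ge0 // lee_fin.
have := W_ae; apply: filterS => t ht tab.
by rewrite EFinM /w fineK // ht.
Qed.

Let wfin : (\int[mu]_(t in `[a, b]) (w t)%:E < +oo)%E.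
Proof.
have -> : (\int[mu]_(t in `[a, b]) (w t)%:E = \int[mu]_(t in `[a, b]) (1 * w t)%:E)%E.
  by apply: eq_integral => t _; rewrite mul1r.
rewrite integral_w //; apply: le_lt_trans Wfin; rewrite le_eqVlt; apply/orP; left; apply/eqP.
by apply: eq_integral => t _; rewrite mul1e.
Qed.

Definition weighted_norm2 (F : R -> R[i]) : \bar R :=
  (\int[mu]_(t in `[a, b]) ((cabs (F t) ^+ 2)%:E * omega t))%E.
Local Notation N := weighted_norm2.

Let mN F : cmeas F -> measurable_fun setT (fun t => (cabs (F t) ^+ 2)%:E * omega t)%E.
Proof. by move=> mF; apply: emeasurable_funM => //; apply/measurable_EFinP; exact: measurable_cabs_sqr. Qed.

Let N0 (z : R[i]) t : (0 <= (cabs z ^+ 2)%:E * omega t)%E.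
Proof. by rewrite mule_ge0 // lee_fin sqr_ge0. Qed.

Let C := Num.sqrt (1 + L ^+ 2).
Let C0 : 0 <= C. Proof. exact: sqrtr_ge0. Qed.

Let l2_ge (f g : R[i] -> R[i]) F : cmeas F -> (forall t, a <= t <= b -> f (gam y t) - g (gam y t) = F t) ->
  (N F <= l2dist2 a b y phi f g)%E.
Proof.
move=> mF FE; rewrite /N ge0_integral_leb //; last exact: measurable_funTS (mN mF).
apply: integral_le_unmeasured => // t /=; rewrite in_itv /= => tab.
rewrite FE // weightE gamE // -/(omega t) -[leLHS]mule1.
by apply: lee_wpmul2l => //; rewrite lee_fin arcdens_ge1.
Qed.

(** The bound on the arc length density may fail at [a] and [b], where the derivative depends on
    values outside [[a, b]]. The majorant [U] is therefore [+oo] at these two points, which changes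
    no integral. *)
Let l2_le (f g : R[i] -> R[i]) F : cmeas F -> (forall t, a <= t <= b -> f (gam y t) - g (gam y t) = F t) ->
  (l2dist2 a b y phi f g <= C%:E * N F)%E.
Proof.
move=> mF FE; have mG := mN mF.
pose U t := (C%:E * ((cabs (F t) ^+ 2)%:E * omega t) + (\1_[set a; b] t)%:E * +oo)%E.
have mi : measurable_fun setT (fun t : R => ((\1_[set a; b] t : R)%:E * +oo)%E).
  by apply: emeasurable_funM => //; apply/measurable_EFinP; apply: measurable_indic; exact: measurableU.
have i0 t : (0 <= (\1_[set a; b] t : R)%:E * +oo)%E by rewrite mule_ge0.
have mU : measurable_fun setT U by apply: emeasurable_funD => //; exact: measurable_funeM.
have U0 t : (0 <= U t)%E by rewrite adde_ge0 // mule_ge0 // lee_fin.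
rewrite /N -ge0_integralZl_EFin //; last exact: measurable_funTS.
have -> : (\int[mu]_(t in `[a, b]) (C%:E * ((cabs (F t) ^+ 2)%:E * omega t)) = \int[mu]_(t in `[a, b]) U t)%E.
  apply: ge0_ae_eq_integral => //.
  - by apply: measurable_funeM; exact: measurable_funTS.
  - exact: measurable_funTS.
  - by move=> t _; rewrite mule_ge0 // lee_fin.
  exists [set a; b]; split; first exact: measurableU.
    have : (@lebesgue_measure R [set a; b] = 0)%E by apply: countable_lebesgue_measure0; exact: finite_set_countable.
    by [].
  move=> t /= /not_implyP[_ h]; apply: contrapT => nt; apply: h.
  by rewrite /U indicE memNset //= mul0e adde0.
rewrite ge0_integral_leb //; last exact: measurable_funTS.
apply: integral_le_unmeasured => // t /=; rewrite in_itv /= => tab.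
  by rewrite FE // weightE !mule_ge0 ?expeR_ge0 // lee_fin ?sqr_ge0 // (le_trans ler01) // arcdens_ge1.
have [tE|tN] := boolP (t \in [set a; b]).
  rewrite /U indicE tE mul1e.
  have : (0 <= C%:E * ((cabs (F t) ^+ 2)%:E * omega t))%E by rewrite mule_ge0 // lee_fin.
  by case: (C%:E * _)%E => [x| |] //= _; rewrite leey.
rewrite FE // weightE gamE // -/(omega t) /U indicE (negbTE tN) mul0e adde0 muleC.
apply: lee_wpmul2r => //; rewrite lee_fin; apply: (arcdens_le ab ylip).
case/andP: tab; rewrite !le_eqVlt => /predU1P[ta|->]; last first.
  by move=> /predU1P[tb|->] //; move/negP: tN; case; rewrite mem_set // tb; right.
by move/negP: tN; case; rewrite mem_set // -ta; left.
Qed.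

Let N_add F G : cmeas F -> cmeas G -> (N (fun t => F t + G t)%R <= 2%:E * N F + 2%:E * N G)%E.
Proof.
move=> mF mG; have m1 := mN mF; have m2 := mN mG.
rewrite /N -!ge0_integralZl_EFin //; last 2 first.
- exact: measurable_funTS.
- exact: measurable_funTS.
rewrite -ge0_integralD //; last 4 first.
- by move=> t _; rewrite mule_ge0.
- by apply: measurable_funeM; exact: measurable_funTS.
- by move=> t _; rewrite mule_ge0.
- by apply: measurable_funeM; exact: measurable_funTS.
apply: ge0_le_integral => //.
- by apply: measurable_funTS; apply: mN; exact: cmeas_add.
- by apply: emeasurable_funD; apply: measurable_funeM; exact: measurable_funTS.
move=> t _; rewrite !muleA -!EFinM -ge0_muleDl ?lee_fin ?mulr_ge0 ?cabs_ge0 //.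
by apply: lee_wpmul2r => //; rewrite -EFinD lee_fin cabs_sqr_add.
Qed.

Variable sqrtQ : R[i] -> R[i].
Hypothesis msq : meas_on_gamma a b y sqrtQ.
Hypothesis hsq : forall t, a <= t <= b -> sqrtQ (gam y t) ^+ 2 = Q.[gam y t].

Let s t := if a <= t <= b then sqrtQ (gam y t) else 0.
Let ms : cmeas s. Proof. by case: msq => h1 h2; exact: cmeas_restrict. Qed.

Let s_sqr t : a <= t <= b -> cabs (s t) ^+ 2 = cabs Q.[graph ye t].
Proof. by move=> tab; rewrite /s tab -cabsX hsq // gamE. Qed.

Let Q_root t : a <= t <= b -> Q.[graph ye t] = 0 -> t \in ts.
Proof.
move=> tab; rewrite /Q /Qpoly horner_prod => /eqP; rewrite prodf_seq_eq0 => /hasP[t' t'ts /=].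
rewrite horner_exp hornerXsubC expf_eq0 => /andP[_]; rewrite subr_eq0 eq_complex /= => /andP[/eqP -> _].
by [].
Qed.

(** Off the finitely many roots of [Q], dividing by [sqrtQ] turns the weight [omega] into [W]. *)
Let N_div F (q : {poly R[i]}) : cmeas F ->
  N (fun t => F t - q.[graph ye t] * s t) = wnorm2 a b w (fun t => F t / s t - q.[graph ye t]).
Proof.
move=> mF; have mq := @cmeas_poly _ ye mye q.
have m1 : cmeas (fun t => F t - q.[graph ye t] * s t) by apply: cmeas_sub => //; exact: cmeas_mul.
have m2 : cmeas (fun t => F t / s t - q.[graph ye t]).
  by apply: cmeas_sub => //; apply: cmeas_mul => //; exact: cmeas_inv.
rewrite /wnorm2 integral_w; [|exact: measurable_cabs_sqr|by move=> t; exact: sqr_ge0].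
apply: ge0_ae_eq_integral => //.
- by apply: measurable_funTS; exact: mN.
- apply: measurable_funTS; apply: emeasurable_funM => //.
  by apply/measurable_EFinP; exact: measurable_cabs_sqr.
- by move=> t _; rewrite mule_ge0 // lee_fin sqr_ge0.
exists [set` ts]; split.
- by apply: countable_measurable => //; apply: finite_set_countable; exact: finite_seq.
- have : (@lebesgue_measure R [set` ts] = 0)%E.
    by apply: countable_lebesgue_measure0; apply: finite_set_countable; exact: finite_seq.
  by [].
move=> t /= /not_implyP[]; rewrite in_itv /= => tab h; apply: contrapT => nt; apply: h.
have sn0 : s t != 0.
  apply/eqP => s0; apply: nt; apply: Q_root => //; apply/eqP.
  by rewrite -cabs_eq0 -s_sqr // s0 cabs0 expr0n.
rewrite /W muleA -EFinM -s_sqr // -exprMn -cabsM; congr ((cabs _ ^+ 2)%:E * _)%E.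
by rewrite mulrBl mulfVK.
Qed.

Let N_sqrtQ_fin : (N s < +oo)%E.
Proof.
apply: le_lt_trans Wfin; apply: ge0_le_integral => //.
- by apply: measurable_funTS; exact: mN.
- exact: measurable_funTS.
by move=> t /=; rewrite in_itv /= => tab; rewrite s_sqr.
Qed.

Lemma inL2_sqrtQ : inL2 a b y phi sqrtQ.
Proof.
split => //; apply: le_lt_trans (l2_le ms _) _ => [t tab|]; first by rewrite subr0 /s tab.
by apply: lte_mul_pinfty; rewrite ?lee_fin.
Qed.

Lemma polys_dense_of_sqrtQ : poly_approx a b y phi sqrtQ -> polys_dense a b y phi.
Proof.
move=> hs f [[f1 f2] ffin] eps eps0.
pose F t := if a <= t <= b then f (gam y t) else 0.
have mF : cmeas F by exact: cmeas_restrict.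
have NF : (N F < +oo)%E.
  by apply: le_lt_trans (l2_ge mF _) ffin => t tab; rewrite subr0 /F tab.
have mh : cmeas (fun t => F t / s t) by apply: cmeas_mul => //; exact: cmeas_inv.
have Nh : (wnorm2 a b w (fun t => F t / s t)%R < +oo)%E.
  have := N_div 0 mF; have -> : (fun t => F t / s t - (0 : {poly R[i]}).[graph ye t]) = (fun t => F t / s t).
    by apply/funext => t; rewrite horner0 subr0.
  move=> <-; apply: le_lt_trans NF; rewrite le_eqVlt; apply/orP; left; apply/eqP.
  by congr N; apply/funext => t; rewrite horner0 mul0r subr0.
have C1 : 0 < C + 1 by rewrite ltr_wpDl.
(* The two errors add up to at most [C * (2 * e1 + 2 * e1)], which is below [eps]. *)
pose e1 := eps / (8 * (C + 1)).
have e10 : 0 < e1 by rewrite divr_gt0 // mulr_gt0.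
have [q hq] := poly_appr_L2 mye mw w0 wfin yelip mh Nh e10.
rewrite -N_div // in hq.
have [B B0 hB] := poly_bounded q.
have B1 : 0 < B ^+ 2 + 1 by rewrite ltr_wpDl // sqr_ge0.
(* [q] is fixed before [p]: multiplying the error of [p] by [q] costs at most the factor [B ^ 2],
   which has to be known when [p] is chosen. *)
have [p hp] := hs (e1 / (B ^+ 2 + 1)) ltac:(by rewrite divr_gt0).
have mp := @cmeas_poly _ ye mye p; have mq := @cmeas_poly _ ye mye q.
have msp : cmeas (fun t => s t - p.[graph ye t]) by exact: cmeas_sub.
have {}hp : (N (fun t => s t - p.[graph ye t])%R < (e1 / (B ^+ 2 + 1))%:E)%E.
  by apply: le_lt_trans (l2_ge msp _) hp => t tab; rewrite /s tab gamE.
have mqsp : cmeas (fun t => q.[graph ye t] * (s t - p.[graph ye t])) by exact: cmeas_mul.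
have hqp : (N (fun t => q.[graph ye t] * (s t - p.[graph ye t]))%R < e1%:E)%E.
  apply: (@le_lt_trans _ _ ((B ^+ 2 + 1)%:E * N (fun t => s t - p.[graph ye t])%R)%E).
    have m1 := mN msp; rewrite /N -ge0_integralZl_EFin ?(ltW B1) //; last exact: measurable_funTS.
    apply: ge0_le_integral => //.
    - by apply: measurable_funTS; exact: mN.
    - by apply: measurable_funeM; exact: measurable_funTS.
    move=> t /=; rewrite in_itv /= => tab; rewrite muleA -EFinM; apply: lee_wpmul2r => //.
    rewrite lee_fin cabsM exprMn ler_wpM2r ?sqr_ge0 //.
    apply: (@le_trans _ _ (B ^+ 2)); last by rewrite lerDl.
    by rewrite ler_pXn2r ?nnegrE ?cabs_ge0 // hB.
  have -> : e1%:E = ((B ^+ 2 + 1)%:E * (e1 / (B ^+ 2 + 1))%:E)%E.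
    by rewrite -EFinM mulrC mulfVK // gt_eqF.
  by rewrite lte_pmul2l.
(* The error splits as [F - q * p = (F - q * s) + q * (s - p)]. *)
exists (q * p).
have mqs : cmeas (fun t => F t - q.[graph ye t] * s t) by apply: cmeas_sub => //; exact: cmeas_mul.
have msum := cmeas_add mqs mqsp.
apply: le_lt_trans (l2_le msum _) _ => [t tab|].
  by rewrite hornerM /F tab gamE //; ring.
apply: (@le_lt_trans _ _ (C%:E * (2%:E * e1%:E + 2%:E * e1%:E))%E).
  apply: lee_wpmul2l; rewrite ?lee_fin //.
  apply: le_trans (N_add mqs mqsp) _; apply: leeD; apply: lee_wpmul2l; rewrite ?lee_fin //; exact: ltW.
have -> : (C%:E * (2%:E * e1%:E + 2%:E * e1%:E) = (C * (2 * e1 + 2 * e1))%:E)%E by rewrite !(EFinM, EFinD).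
rewrite lte_fin /e1.
have -> : C * (2 * (eps / (8 * (C + 1))) + 2 * (eps / (8 * (C + 1)))) = eps * (C / (2 * (C + 1))).
  by field; rewrite gt_eqF.
rewrite gtr_pMr // ltr_pdivrMr ?mulr_gt0 // mul1r; have := C0; lra.
Qed.

End density_criterion.

Theorem theorem3p7 (R : realType) (a b : R) (y : R -> R) (phi : R[i] -> \bar R)
  (hab : a < b)
  (hlip : exists L : R, forall s t : R, a <= s <= b -> a <= t <= b ->
            `|y s - y t| <= L * `|s - t|)
  (hphi : subharmonic phi)
  (ts : seq R) (hts_uniq : uniq ts)
  (hts : forall t : R, t \in ts <-> (a <= t <= b /\ (1 <= lelong phi (gam y t))%E))
  (sqrtQ : R[i] -> R[i])
  (hsq_meas : meas_on_gamma a b y sqrtQ)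
  (hsq : forall t : R, a <= t <= b ->
           sqrtQ (gam y t) ^+ 2 = (Qpoly y phi ts).[gam y t]) :
  polys_dense a b y phi <-> poly_approx a b y phi sqrtQ.
Proof.
have [L ylip] := hlip; split.
  by apply; apply: (inL2_sqrtQ hab ylip hphi hts_uniq hts).
exact: (polys_dense_of_sqrtQ hab ylip hphi hts_uniq hts).
Qed.
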